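(* Let $I=[0,1]$. There is a constant $C$ such that for all smooth scalar functions $g,h$ on $I\times\mathbb R^2$ (variables $(t,x)$, with finite $H^1(I\times\mathbb R^2)$ norm), $$\Big\|\int_I \partial_t g\cdot h\,dt\Big\|_{B^0_{2,1}(\mathbb R^2)}\le C\,\|g\|_{H^1(I\times\mathbb R^2)}\,\|h\|_{H^1(I\times\mathbb R^2)} .$$
   Context: $\|f\|_{H^1(I\times\mathbb R^2)}=\big(\sum_{i+j\le 1}\int_0^1\int_{\mathbb R^2}|\partial_t^i\nabla^j f|^2\,dx\,dt\big)^{1/2}$, where $\nabla$ denotes derivatives in $x\in\mathbb R^2$. Littlewood-Paley projections in $x$: $(P_kf)^\wedge(\xi)=\chi(2^{-k}\xi)\hat f(\xi)$, $k\in\mathbb Z$, with $\chi=\chi(|\xi|)$ a real smooth function supported in $\frac12\le|\xi|\le2$ and $\sum_{k}\chi(2^{-k}\xi)=1$ for $\xi\neq0$; $P_{<0}=\sum_{k<0}P_k$. For a function $f$ on $\mathbb R^2$, $\|f\|_{B^0_{2,1}(\mathbb R^2)}=\sum_{k\ge0}\|P_kf\|_{L^2(\mathbb R^2)}+\|P_{<0}f\|_{L^2(\mathbb R^2)}$. *)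

(* Defs.v *)
From HB Require Import structures.
From mathcomp Require Import all_boot all_order all_algebra.
From mathcomp Require Import complex.
From mathcomp Require Import all_classical all_reals all_analysis.

Set Implicit Arguments.
Unset Strict Implicit.
Unset Printing Implicit Defensive.

Import Order.TTheory GRing.Theory Num.Theory.
Import numFieldNormedType.Exports.

Local Open Scope classical_set_scope.
Local Open Scope ring_scope.
Local Open Scope complex_scope.

(* R^o is R as a normed module over itself; without it the product types
   carry no normed-module structure. *)
Notation plane R := (R^o * R^o)%type.
Notation spacetime R := (R^o * (R^o * R^o))%type.

Section Smooth.
Context {R : realType} {V : normedModType R}.

Definition iter_derive (s : seq V) (f : V -> R^o) : V -> R^o :=
  foldr (fun v u => 'D_v u) f s.

(* Smoothness up to the boundary: f is infinitely differentiable in the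
   interior of A, and f and all its iterated directional derivatives extend
   continuously to A.  The values of f outside A are irrelevant, and on an
   open set this is plain infinite differentiability (V is finite-dimensional
   in all uses below). *)
Definition smooth_on (A : set V) (f : V -> R^o) : Prop :=
  [/\ {within A, continuous f},
      forall (s : seq V) (v p : V), A° p -> derivable (iter_derive s f) p v
    & forall s : seq V, exists2 u : V -> R^o,
        {within A, continuous u} & forall p, A° p -> iter_derive s f p = u p].

End Smooth.

Section LittlewoodPaley.
Context {R : realType}.

Local Notation leb2 := ((@lebesgue_measure R \x @lebesgue_measure R)%E).

Definition dot (x y : plane R) : R := x.1 * y.1 + x.2 * y.2.

(* The library norm on a product is the maximum norm, so the Euclidean one is
   introduced separately. *)
Definition enorm (x : plane R) : R := Num.sqrt (dot x x).

Definition cintegral (f : plane R -> R[i]) : R[i] :=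
  (\int[leb2]_x complex.Re (f x)) +i* (\int[leb2]_x complex.Im (f x)).

Definition expi (a : R) : R[i] := cos a +i* sin a.

Definition fourier (f : plane R -> R[i]) (xi : plane R) : R[i] :=
  cintegral (fun x => expi (- dot x xi) * f x).

Definition inv_fourier (f : plane R -> R[i]) (x : plane R) : R[i] :=
  ((2 * pi) ^- 2)%:C * cintegral (fun xi => expi (dot x xi) * f xi).

(* The sum over k : int is a finitely supported sum (\sum_(_ \in _) of
   fsbigop); for xi <> 0 the support condition leaves finitely many nonzero
   terms, so this is the genuine sum over Z. *)
Definition LP_cutoff (chi : plane R -> R) : Prop :=
  [/\ smooth_on setT (chi : plane R -> R^o),
      forall xi eta, enorm xi = enorm eta -> chi xi = chi eta,
      forall xi, chi xi != 0 -> 2^-1 <= enorm xi <= 2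
    & forall xi : plane R, xi != 0 ->
        \sum_(k \in [set: int]) chi ((2 : R) ^ (- k) *: xi) = 1].

Variable chi : plane R -> R.

(* The function with Fourier transform chi(2^-k xi) * fourier f xi.  For
   integrable f that product is bounded with compact support, so the inverse
   transform is an absolutely convergent integral. *)
Definition LP (k : int) (f : plane R -> R[i]) : plane R -> R[i] :=
  inv_fourier (fun xi => (chi ((2 : R) ^ (- k) *: xi))%:C * fourier f xi).

(* \sum_(k < 0) P_k f, as a pointwise series over k = - n.+1. *)
Definition LP_neg (f : plane R -> R[i]) (x : plane R) : R[i] :=
  limn (series (fun n : nat => complex.Re (LP (- n.+1%:Z) f x))) +i*
  limn (series (fun n : nat => complex.Im (LP (- n.+1%:Z) f x))).

Definition L2norm (f : plane R -> R[i]) : \bar R :=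
  Lnorm leb2 2%:E (fun x => (ComplexField.Normc.normc (f x))%:E).

Definition besov (f : plane R -> R[i]) : \bar R :=
  ((\sum_(0 <= k <oo) L2norm (LP k%:Z f)) + L2norm (LP_neg f))%E.

End LittlewoodPaley.

Section Slab.
Context {R : realType}.

Local Notation leb := (@lebesgue_measure R).
Local Notation leb2 := ((@lebesgue_measure R \x @lebesgue_measure R)%E).

Definition slab : set (spacetime R) := [set p | 0 <= p.1 <= 1].

Definition e_t : spacetime R := (1, (0, 0)).
Definition e_1 : spacetime R := (0, (1, 0)).
Definition e_2 : spacetime R := (0, (0, 1)).

(* On the faces t = 0 and t = 1 the two-sided derivatives below may be
   meaningless; these are null sets for the integrals over t. *)
Definition H1norm (f : spacetime R -> R^o) : \bar R :=
  sqrte (\int[leb]_(t in `[0%R, 1%R]) \int[leb2]_x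
    (f (t, x) ^+ 2 + 'D_e_t f (t, x) ^+ 2
     + ('D_e_1 f (t, x) ^+ 2 + 'D_e_2 f (t, x) ^+ 2))%:E)%E.

Definition time_integral (g h : spacetime R -> R^o) (x : plane R) : R :=
  \int[leb]_(t in `[0, 1]) ('D_e_t g (t, x) * h (t, x)).

End Slab.

(* Main.v *)
(* Write F(x) for the integral over t of (d_t g) h. Let E_m be the average in x
   over a square of side 2^-m and S_m = E_m^* E_m; then S_m - S_(m-1) = E_m^* W_m,
   where W_m is built from differences of E_m. Since
   |(f + tau f)/2|^2 + |(f - tau f)/2|^2 = |f|^2 in L^2, the square norms of W_m
   telescope, and gamma_m^2 = 4^m |W_m g|^2 + |W_m d_t g|^2 satisfies
   sum_m gamma_m^2 <= C |g|_{H^1}^2; let delta_l be the same quantities for h.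
   For fixed x, integration by parts in t and an interpolation bound give
   (int a' b)^2 <= C 2^(-m-l) (4^m |a|^2 + |a'|^2) (4^l |b|^2 + |b'|^2). Together
   with the Bernstein gain of the averages this bounds the contribution of the
   pieces m, l to |P_k F|_2 by C gamma_m delta_l r^(|k-m|+|k-l|) for some r < 1:
   P_k is controlled through |F|_1 if k <= min(m,l), and through differences of F
   at the scale 2^-k otherwise. These bounds are summable over k >= 0, m and l.
   The low frequencies only need |F|_1. Fourier inversion is never used:
   P_k is treated as a convolution whose kernel decays by integration by parts. *)

Require Import Defs.
From HB Require Import structures.
From mathcomp Require Import all_boot all_order all_algebra.
From mathcomp Require Import complex.
From mathcomp Require Import all_classical all_reals all_analysis.
From mathcomp Require Import measurable_realfun ring lra zify.
Import Order.TTheory GRing.Theory Num.Theory.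
Import numFieldNormedType.Exports.
Local Open Scope classical_set_scope.
Local Open Scope ring_scope.
Local Open Scope complex_scope.

Set Implicit Arguments.
Unset Strict Implicit.
Unset Printing Implicit Defensive.

(** * Integrals over intervals *)

(** The scaling is critical. In two dimensions [P_k] costs a factor 2^k from L^1 to L^2, and the
    time integral gains only 2^(-(m+l)/2), which just pays for it when k = m = l. Nothing is left
    over for summing there, so the diagonal must close through square summability of the two
    sequences, and geometric decay has to be found in every direction away from it. The time gain
    exists because the time derivative can always be made to fall on the factor of lower frequency;
    when it starts on the other one it is moved, and the boundary terms at the two faces obey the
    same bound. Averages over squares are used to split g and h since they need nothing but
    translations in x: the parallelogram identity replaces Plancherel, and a difference at a scale
    finer than the square acts on an average like a derivative, which yields the decay for k above m
    and l. Only pieces up to a level M are summed. The remainder is small in L^1, and M is chosen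
    after the number of projections considered, so that the factors 2^k do no harm. *)

Section Continuity.
Context {R : realType}.

Lemma continuous_compose (T U V : topologicalType) (f : T -> U) (g : U -> V) :
  continuous f -> continuous g -> continuous (fun x => g (f x)).
Proof. by move=> cf cg x; apply: continuous_comp; [exact: cf|exact: cg]. Qed.

Lemma continuous_id (T : topologicalType) : continuous (fun x : T => x).
Proof. by move=> x; exact: cvg_id. Qed.

Lemma continuous_cst (T U : topologicalType) (c : U) :
  continuous (fun _ : T => c).
Proof. by move=> x; exact: cvg_cst. Qed.

Lemma continuous_pair (T U V : topologicalType) (f : T -> U) (g : T -> V) :
  continuous f -> continuous g -> continuous (fun x => (f x, g x)).
Proof. by move=> cf cg x; apply: cvg_pair; [exact: cf|exact: cg]. Qed.

Lemma continuous_fst_fun (T U V : topologicalType) (f : T -> U * V) :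
  continuous f -> continuous (fun x => (f x).1).
Proof. by move=> cf; apply: (continuous_compose cf) => x; exact: cvg_fst. Qed.

Lemma continuous_snd_fun (T U V : topologicalType) (f : T -> U * V) :
  continuous f -> continuous (fun x => (f x).2).
Proof. by move=> cf; apply: (continuous_compose cf) => x; exact: cvg_snd. Qed.

Lemma continuous_funD (T : topologicalType) (f g : T -> R) :
  continuous f -> continuous g -> continuous (fun x => f x + g x).
Proof. by move=> cf cg x; apply: (@cvgD R R^o); [exact: cf|exact: cg]. Qed.

Lemma continuous_funN (T : topologicalType) (f : T -> R) :
  continuous f -> continuous (fun x => - f x).
Proof. by move=> cf x; apply: (@cvgN R R^o); exact: cf. Qed.

Lemma continuous_funM (T : topologicalType) (f g : T -> R) :
  continuous f -> continuous g -> continuous (fun x => f x * g x).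
Proof. by move=> cf cg x; apply: (@cvgM R); [exact: cf|exact: cg]. Qed.

Lemma continuous_funX (T : topologicalType) (f : T -> R) n :
  continuous f -> continuous (fun x => f x ^+ n).
Proof.
move=> cf; elim: n => [|n IH]; first exact: continuous_cst.
under eq_fun do rewrite exprS.
exact: continuous_funM.
Qed.

Lemma continuous_fun_norm (T : topologicalType) (f : T -> R) :
  continuous f -> continuous (fun x => `|f x|).
Proof. by move=> cf x; apply: (@cvg_norm R R^o); exact: cf. Qed.

Lemma continuous_fun_cos (T : topologicalType) (f : T -> R) :
  continuous f -> continuous (fun x => cos (f x)).
Proof. by move=> cf; apply: (continuous_compose cf); exact: continuous_cos. Qed.

Lemma continuous_fun_sin (T : topologicalType) (f : T -> R) :
  continuous f -> continuous (fun x => sin (f x)).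
Proof. by move=> cf; apply: (continuous_compose cf); exact: continuous_sin. Qed.

Lemma continuous_fun_sqrt (T : topologicalType) (f : T -> R) :
  continuous f -> continuous (fun x => Num.sqrt (f x)).
Proof. by move=> cf; apply: (continuous_compose cf); exact: sqrt_continuous. Qed.

End Continuity.

(** Follows the syntax of the function. The continuity lemmas above are therefore stated for
    explicit abstractions and not for the algebraic operations on functions. *)
Ltac cont :=
  solve [repeat first
    [ assumption
    | lazymatch goal with
      | |- continuous (fun x => x) => exact: continuous_id
      | |- continuous (fun _ => ?c) => exact: continuous_cst
      | |- continuous (fun x => (@?f x, @?g x)) =>
          apply: (@continuous_pair _ _ _ f g)
      | |- continuous (fun x => @?f x + @?g x) => apply: (@continuous_funD _ _ f g)
      | |- continuous (fun x => - @?f x) => apply: (@continuous_funN _ _ f)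
      | |- continuous (fun x => @?f x * @?g x) => apply: (@continuous_funM _ _ f g)
      | |- continuous (fun x => @?f x ^+ ?n) => apply: (@continuous_funX _ _ f n)
      | |- continuous (fun x => `|@?f x|) => apply: (@continuous_fun_norm _ _ f)
      | |- continuous (fun x => cos (@?f x)) => apply: (@continuous_fun_cos _ _ f)
      | |- continuous (fun x => sin (@?f x)) => apply: (@continuous_fun_sin _ _ f)
      | |- continuous (fun x => Num.sqrt (@?f x)) =>
          apply: (@continuous_fun_sqrt _ _ f)
      | |- continuous (fun x => (@?f x).1) => apply: (@continuous_fst_fun _ _ _ f)
      | |- continuous (fun x => (@?f x).2) => apply: (@continuous_snd_fun _ _ _ f)
      | H : continuous ?g |- continuous (fun x => ?g (@?f x)) =>
          apply: (@continuous_compose _ _ _ f g); [|exact: H]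
      end ]].

(** * Affine changes of variable on the line *)

Section Affine.
Context {R : realType}.
Local Notation leb := (@lebesgue_measure R).

Definition affine (c h x : R) : R := c + h * x.

Lemma continuous_affine (c h : R) : continuous (affine c h).
Proof. rewrite /affine. cont. Qed.

Lemma measurable_affine (c h : R) :
  measurable_fun [set: measurableTypeR R] (affine c h : _ -> measurableTypeR R).
Proof. by apply: continuous_measurable_fun; exact: continuous_affine. Qed.

(** Both sides are measures in [A] that agree on half-open intervals, so uniqueness of Lebesgue
    measure applies. For [h < 0] the preimage is half-open on the other side, with the same
    length. *)
Lemma lebesgue_affine (c h : R) (A : set R) : h != 0 -> measurable A ->
  (`|h|%:E * leb (affine c h @^-1` A))%E = leb A.
Proof.
move=> h0 mA.
have ha : 0 <= `|h| by [].
have mphi := measurable_affine c h.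
pose mu2 : {measure set (measurableTypeR R) -> \bar R} := mscale (NngNum ha)
  (measure_function_pushforward__canonical__measure_function_Measure leb mphi).
rewrite [RHS](@lebesgue_measure_unique R mu2)//.
move=> _ [[a b] _ <-] /=.
rewrite /mu2 /mscale /= /pushforward.
have [hp|hn|] := ltrgtP h 0; last by move/eqP; rewrite (negbTE h0).
- have -> : affine c h @^-1` `]a, b]%classic = `[(b - c) / h, (a - c) / h[%classic.
    apply/seteqP; split => x /=; rewrite /affine !in_itv/=.
      rewrite ler_ndivrMr// ltr_ndivlMr// => /andP[? ?]; apply/andP; split; lra.
    rewrite ler_ndivrMr// ltr_ndivlMr// => /andP[? ?]; apply/andP; split; lra.
  rewrite !lebesgue_measure_itv/= !lte_fin.
  have -> : ((b - c) / h < (a - c) / h) = (a < b).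
    by rewrite ltr_nM2r ?invr_lt0// ltrBlDr subrK.
  case: ifPn => _; last by rewrite mule0.
  rewrite -EFinB -EFinM; congr (_%:E).
  rewrite ltr0_norm//. by field.
- have -> : affine c h @^-1` `]a, b]%classic = `](a - c) / h, (b - c) / h]%classic.
    apply/seteqP; split => x /=; rewrite /affine !in_itv/=.
      rewrite ler_pdivlMr// ltr_pdivrMr// => /andP[? ?]; apply/andP; split; lra.
    rewrite ler_pdivlMr// ltr_pdivrMr// => /andP[? ?]; apply/andP; split; lra.
  rewrite !lebesgue_measure_itv/= !lte_fin.
  have -> : ((a - c) / h < (b - c) / h) = (a < b).
    by rewrite ltr_pM2r ?invr_gt0// ltrBlDr subrK.
  case: ifPn => _; last by rewrite mule0.
  rewrite -EFinB -EFinM; congr (_%:E).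
  rewrite gtr0_norm//. by field.
Qed.

Lemma integral_affine (c h : R) (f : R -> \bar R) : h != 0 ->
  measurable_fun [set: R] f -> (forall x, 0 <= f x)%E ->
  (`|h|%:E * \int[leb]_x f (affine c h x) = \int[leb]_x f x)%E.
Proof.
move=> h0 mf f0.
have ha : 0 <= `|h| by [].
have mphi := measurable_affine c h.
pose mu2 : {measure set (measurableTypeR R) -> \bar R} := mscale (NngNum ha)
  (measure_function_pushforward__canonical__measure_function_Measure leb mphi).
have -> : (\int[leb]_x f x = \int[mu2]_x f x)%E.
  by apply: eq_measure_integral => A mA _; exact/esym/(lebesgue_affine c h0 mA).
by rewrite ge0_integral_mscale// ge0_integral_pushforward.
Qed.

End Affine.

(** * Measurability of continuous functions of several variables *)

Section Measurability.
Context {R : realType}.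

Lemma measurable_continuous (f : R -> R) :
  continuous f -> measurable_fun [set: R] f.
Proof. exact: continuous_measurable_fun. Qed.

(* Freezing the first variable on a grid of mesh 1/(n+1) gives measurable
   approximations of a Caratheodory function. *)
Lemma measurable_caratheodory d (Y : measurableType d) (f : R * Y -> R) :
  (forall x, measurable_fun [set: Y] (fun y => f (x, y))) ->
  (forall y, continuous (fun x => f (x, y))) ->
  measurable_fun [set: R * Y] f.
Proof.
move=> mf cf.
pose q (n : nat) (x : R) : int := Num.floor (x * n.+1%:R).
pose fn (n : nat) (p : R * Y) := f ((q n p.1)%:~R / n.+1%:R, p.2).
apply: (@measurable_fun_cvg _ _ _ _ fn) => //.
- move=> n _ B mB; rewrite setTI.
  have -> : fn n @^-1` B = \bigcup_(k in [set: int])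
      ([set x | q n x == k] `*` ((fun y => f (k%:~R / n.+1%:R, y)) @^-1` B)).
    apply/seteqP; split => [[x y] /= Bxy|[x y] [k _ [/= /eqP <-]]]; last by [].
    by exists (q n x) => //; split => //=; exact: eqxx.
  apply: countable_bigcupT_measurable => [|k]; first exact: countableP.
  apply: measurableX.
    have -> : [set x | q n x == k] =
        `[k%:~R / n.+1%:R, (k + 1)%:~R / n.+1%:R[%classic.
      apply/seteqP; split => x /=; rewrite in_itv/= /q floor_eq;
        by rewrite ler_pdivrMr ?ltr0n// ltr_pdivlMr ?ltr0n.
    exact: measurable_itv.
  by rewrite -[X in measurable X]setTI; exact: mf.
- move=> [x y] _ /=.
  have : (fun n => (q n x)%:~R / n.+1%:R) @ \oo --> x.
    apply/cvgrPdist_le => e e0; near=> n.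
    have n0 : 0 < n.+1%:R :> R by rewrite ltr0n.
    have /andP[h1 h2] := floor_itv (x * n.+1%:R).
    have ne : n.+1%:R^-1 <= e.
      by apply: ltW; near: n; exact: (near_infty_natSinv_lt (PosNum e0)).
    rewrite ger0_norm ?subr_ge0 ?ler_pdivrMr//.
    apply: le_trans ne; rewrite lerBlDr -[X in X + _]mul1r -mulrDl.
    by rewrite ler_pdivlMr// ltW//; move: h2; rewrite intrD addrC.
  by move=> qx; exact: (cvg_comp _ _ qx (cf y x)).
Unshelve. all: end_near. Qed.

(** The sigma-algebra is the product one, so measurability is taken from the sections and not from
    preimages of open sets. *)
Lemma measurable_continuous2 (f : R * R -> R) :
  continuous f -> measurable_fun [set: R * R] f.
Proof.
move=> cf; apply: measurable_caratheodory => [x|y].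
  by apply: measurable_continuous; cont.
by cont.
Qed.

Lemma measurable_continuous3 (f : R * (R * R) -> R) :
  continuous f -> measurable_fun [set: R * (R * R)] f.
Proof.
move=> cf; apply: measurable_caratheodory => [x|y].
  by apply: measurable_continuous2; cont.
by cont.
Qed.

End Measurability.

Section IntervalIntegral.
Context {R : realType}.
Local Notation leb := (@lebesgue_measure R).
Implicit Types (a b c : R) (f g : R -> R).

Definition itvint a b f : R := \int[leb]_(s in `[a, b]) f s.

Lemma itv_integrable a b f : continuous f ->
  leb.-integrable `[a, b] (EFin \o f).
Proof.
move=> cf; apply: continuous_compact_integrable; first exact: segment_compact.
exact: continuous_subspaceT.
Qed.

Lemma itvint_EFin a b f : continuous f ->
  ((itvint a b f)%:E = \int[leb]_(s in `[a, b]) (f s)%:E)%E.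
Proof.
move=> cf; rewrite /itvint /Rintegral fineK//.
by apply: integrable_fin_num => //; exact: itv_integrable.
Qed.

Lemma eq_itvint a b f g : (forall s, a <= s <= b -> f s = g s) ->
  itvint a b f = itvint a b g.
Proof.
by move=> fg; apply: eq_Rintegral => s; rewrite inE /= in_itv/= => /fg.
Qed.

Lemma itvintD a b f g : continuous f -> continuous g ->
  itvint a b (fun s => f s + g s) = itvint a b f + itvint a b g.
Proof. by move=> cf cg; apply: RintegralD => //; exact: itv_integrable. Qed.

Lemma itvintB a b f g : continuous f -> continuous g ->
  itvint a b (fun s => f s - g s) = itvint a b f - itvint a b g.
Proof. by move=> cf cg; apply: RintegralB => //; exact: itv_integrable. Qed.

Lemma itvintZ a b c f : continuous f ->
  itvint a b (fun s => c * f s) = c * itvint a b f.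
Proof. by move=> cf; apply: RintegralZl => //; exact: itv_integrable. Qed.

Lemma itvintN a b f : continuous f ->
  itvint a b (fun s => - f s) = - itvint a b f.
Proof.
move=> cf; rewrite -mulN1r -itvintZ//.
by apply: eq_itvint => s _; rewrite mulN1r.
Qed.

Lemma itvint_cst a b c : a <= b -> itvint a b (fun=> c) = (b - a) * c.
Proof.
move=> ab; rewrite /itvint Rintegral_cst//= lebesgue_measure_itv/= lte_fin.
case: ltgtP ab => // [ab _|-> _]; first by rewrite -EFinB /= mulrC.
by rewrite subrr mulr0 mul0r.
Qed.

Lemma le_itvint a b f g : continuous f -> continuous g ->
  (forall s, a <= s <= b -> f s <= g s) -> itvint a b f <= itvint a b g.
Proof.
move=> cf cg fg; apply: le_Rintegral => //; exact: itv_integrable.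
Qed.

Lemma itvint_ge0 a b f : (forall s, a <= s <= b -> 0 <= f s) -> 0 <= itvint a b f.
Proof. by move=> f0; apply: Rintegral_ge0 => s /=; rewrite in_itv => /f0. Qed.

Lemma le_norm_itvint a b f : continuous f ->
  `|itvint a b f| <= itvint a b (fun s => `|f s|).
Proof. by move=> cf; apply: le_normr_Rintegral => //; exact: itv_integrable. Qed.

Lemma norm_itvint_le a b c f : continuous f -> a <= b ->
  (forall s, a <= s <= b -> `|f s| <= c) -> `|itvint a b f| <= (b - a) * c.
Proof.
move=> cf ab fc; apply: le_trans (le_norm_itvint _ _ cf) _.
rewrite -itvint_cst//; apply: le_itvint => //; first by cont.
exact: continuous_cst.
Qed.

(** Compactness of the interval makes the continuity of [F] uniform in [s], even though [T] is only
    a topological space. *)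
Lemma continuous_itvint (T : topologicalType) a b (F : T * R -> R) :
  a <= b -> continuous F -> continuous (fun p => itvint a b (fun s => F (p, s))).
Proof.
move=> ab cF p0; apply/(@cvgrPdist_le R R^o) => e e0.
(* The added 1 keeps the denominator positive when [a = b]. *)
have d0 : 0 < e / (b - a + 1) by rewrite divr_gt0//; lra.
pose G (q : R * T) := `|F (p0, q.1) - F (q.2, q.1)|.
have cG : continuous G by rewrite /G; cont.
have /compact_near_coveringP ncov := @segment_compact R a b.
have := @ncov T (nbhs p0) (fun p s => G (s, p) <= e / (b - a + 1)) (nbhs_filter p0).
have Gs s : `[a, b]%classic s -> \forall x' \near s & p \near p0, G (x', p) <= e / (b - a + 1).
  move=> _; have := @cvgr_le R _ _ _ G _ (cG (s, p0)) (e / (b - a + 1)).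
  by apply; rewrite /G /= subrr normr0.
move=> /(_ Gs); apply: filterS => p Gp.
rewrite -itvintB; [|by cont|by cont].
apply: (@le_trans _ _ ((b - a) * (e / (b - a + 1)))).
  by apply: norm_itvint_le => //; cont.
have ba : 0 < b - a + 1 by lra.
by rewrite mulrCA -[X in _ <= X]mulr1 ler_pM2l// ler_pdivrMr// mul1r; lra.
Qed.

(** Discriminant argument. For [D = 0] the polynomial is affine, and if [B] is nonzero a suitable
    [x] gives it the value -1. *)
Lemma sqr_le_of_quadratic (A B D : R) : 0 <= D ->
  (forall x, 0 <= A - 2 * x * B + x ^+ 2 * D) -> B ^+ 2 <= A * D.
Proof.
move=> Dge0 H; have [D0|D0] := eqVneq D 0.
  have [->|B0] := eqVneq B 0; first by rewrite D0 mulr0 expr0n.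
  have := H ((A + 1) / (2 * B)); rewrite D0 mulr0 addr0.
  have -> : 2 * ((A + 1) / (2 * B)) * B = A + 1 by field.
  by rewrite opprD addNKr oppr_ge0 ler10.
have Dp : 0 < D by rewrite lt_neqAle eq_sym D0.
have := H (B / D).
have -> : A - 2 * (B / D) * B + (B / D) ^+ 2 * D = A - B ^+ 2 / D by field.
by rewrite subr_ge0 ler_pdivrMr.
Qed.

Lemma itvint_cauchy_schwarz a b f g : continuous f -> continuous g ->
  (itvint a b (fun s => f s * g s)) ^+ 2 <=
  itvint a b (fun s => f s ^+ 2) * itvint a b (fun s => g s ^+ 2).
Proof.
move=> cf cg; apply: sqr_le_of_quadratic => [|x].
  by apply: itvint_ge0 => s _; exact: sqr_ge0.
have -> : itvint a b (fun s => f s ^+ 2) - 2 * x * itvint a b (fun s => f s * g s)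
    + x ^+ 2 * itvint a b (fun s => g s ^+ 2) =
    itvint a b (fun s => (f s - x * g s) ^+ 2).
  rewrite -!itvintZ; [|by cont|by cont].
  rewrite -itvintB; [|by cont|by cont].
  rewrite -itvintD; [|by cont|by cont].
  by apply: eq_itvint => s _; ring.
by apply: itvint_ge0 => s _; exact: sqr_ge0.
Qed.

Lemma tonelli_itv d (Y : measurableType d)
    (mu : {sigma_finite_measure set Y -> \bar R}) a b (f : R * Y -> \bar R) :
  measurable_fun [set: R * Y] f -> (forall p, 0 <= f p)%E ->
  (\int[leb]_(s in `[a, b]) \int[mu]_y f (s, y) =
   \int[mu]_y \int[leb]_(s in `[a, b]) f (s, y))%E.
Proof.
move=> mf f0.
pose f' (p : R * Y) : \bar R := ((\1_`[a, b] p.1)%:E * f p)%E.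
have mf' : measurable_fun setT f'.
  apply: emeasurable_funM => //; apply/measurable_EFinP.
  have mi : measurable_fun [set: R] (\1_`[a, b] : R -> R) by exact: measurable_indic.
  exact: (measurableT_comp mi (@measurable_fst _ _ _ _)).
have f'0 p : (0 <= f' p)%E by rewrite mule_ge0// lee_fin.
have := fubini_tonelli (m1 := leb) (m2 := mu) f' mf' f'0.
rewrite /f' /= => E; rewrite [LHS]integral_mkcond.
transitivity (\int[leb]_x \int[mu]_y ((\1_`[a, b] x)%:E * f (x, y)))%E.
  apply: eq_integral => s _; rewrite patchE indicE.
  case: ifPn => sab; rewrite /=.
    by apply: eq_integral => y _; rewrite mul1e.
  by rewrite integral0_eq// => y _; rewrite mul0e.
rewrite E; apply: eq_integral => y _; rewrite [RHS]integral_mkcond.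
apply: eq_integral => s _; rewrite patchE indicE.
by case: ifPn => sab; rewrite /= ?mul1e ?mul0e.
Qed.

Lemma continuous_rect_bounded a b c d (F : R * R -> R) : continuous F ->
  exists K, forall s r, a <= s <= b -> c <= r <= d -> `|F (s, r)| <= K.
Proof.
move=> cF.
have /compact_bounded : compact (F @` (`[a, b]%classic `*` `[c, d]%classic)).
  apply: continuous_compact; first exact: continuous_subspaceT.
  by apply: compact_setX; exact: segment_compact.
move=> [K [_ /(_ (K + 1))]]; rewrite ltrDl ltr01 => /(_ isT) H.
exists (K + 1) => s r sab rcd; apply: H.
by exists (s, r) => //; split; rewrite /= in_itv.
Qed.

(** Tonelli needs a nonnegative integrand off the rectangle as well. With [K] a bound for [F] on the
    rectangle, [G] is nonnegative everywhere and equals [F + K] there; the constant contributes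
    equally to both sides. *)
Lemma itvint_swap a b c d (F : R * R -> R) : a <= b -> c <= d -> continuous F ->
  itvint a b (fun s => itvint c d (fun r => F (s, r))) =
  itvint c d (fun r => itvint a b (fun s => F (s, r))).
Proof.
move=> ab cd cF.
have [K FK] := continuous_rect_bounded a b c d cF.
pose G (p : R * R) := `|F p + K|.
have cG : continuous G by rewrite /G; cont.
have GF s r : a <= s <= b -> c <= r <= d -> G (s, r) = F (s, r) + K.
  move=> sab rcd; rewrite /G ger0_norm//.
  by have := FK s r sab rcd; rewrite ler_norml => /andP[]; lra.
have cFs s : continuous (fun r => F (s, r)) by cont.
have cFr r : continuous (fun s => F (s, r)) by cont.
have cis : continuous (fun s => itvint c d (fun r => F (s, r))).
  exact: (continuous_itvint cd).
have cF' : continuous (fun p : R * R => F (p.2, p.1)) by cont.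
have cir : continuous (fun r => itvint a b (fun s => F (s, r))).
  exact: (continuous_itvint ab cF').
have cG' : continuous (fun p : R * R => G (p.2, p.1)) by cont.
suff : itvint a b (fun s => itvint c d (fun r => G (s, r))) =
       itvint c d (fun r => itvint a b (fun s => G (s, r))).
  have -> : itvint a b (fun s => itvint c d (fun r => G (s, r))) =
      itvint a b (fun s => itvint c d (fun r => F (s, r))) + (b - a) * ((d - c) * K).
    rewrite -(itvint_cst _ ab) -itvintD//; last exact: continuous_cst.
    apply: eq_itvint => s sab; rewrite -itvint_cst// -itvintD//; last exact: continuous_cst.
    by apply: eq_itvint => r rcd; rewrite GF.
  have -> : itvint c d (fun r => itvint a b (fun s => G (s, r))) =
      itvint c d (fun r => itvint a b (fun s => F (s, r))) + (d - c) * ((b - a) * K).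
    rewrite -(itvint_cst _ cd) -itvintD//; last exact: continuous_cst.
    apply: eq_itvint => s sab; rewrite -itvint_cst// -itvintD//; last exact: continuous_cst.
    by apply: eq_itvint => r rcd; rewrite GF.
  by rewrite (mulrCA (d - c)); apply: addIr.
have cGs s : continuous (fun r => G (s, r)) by cont.
have cGr r : continuous (fun s => G (s, r)) by cont.
apply: EFin_inj.
rewrite (itvint_EFin a b (continuous_itvint cd cG)).
rewrite (itvint_EFin c d (continuous_itvint ab cG')).
pose f (p : R * R) : \bar R := (G p * \1_`[c, d] p.2)%:E.
have f0 p : (0 <= f p)%E by rewrite lee_fin mulr_ge0// ?indicE ?ler0n// /G normr_ge0.
have mf : measurable_fun setT f.
  apply/measurable_EFinP; apply: measurable_funM; first exact: measurable_continuous2.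
  have mi : measurable_fun [set: R] (\1_`[c, d] : R -> R) by exact: measurable_indic.
  exact: (measurableT_comp mi (@measurable_snd _ _ _ _)).
have := tonelli_itv leb a b mf f0 => E.
transitivity (\int[leb]_(s in `[a, b]) \int[leb]_y f (s, y))%E.
  apply: eq_integral => s _; rewrite (itvint_EFin c d (cGs s)) integral_mkcond.
  apply: eq_integral => r _; rewrite patchE /f /= indicE.
  by case: ifPn; rewrite ?mulr1 ?mulr0.
rewrite E [RHS]integral_mkcond; apply: eq_integral => r _.
rewrite patchE /f /= indicE; case: ifPn => _ /=.
  by rewrite (itvint_EFin a b (cGr r)); apply: eq_integral => s _; rewrite mulr1.
rewrite integral0_eq; first by [].
by move=> s _; rewrite mulr0.
Qed.

End IntervalIntegral.

(** * Energies in one variable *)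

Section SignedAffine.
Context {R : realType}.
Local Notation leb := (@lebesgue_measure R).

Lemma integrable_affine (c h : R) (f : R -> R) : h != 0 ->
  leb.-integrable setT (EFin \o f) ->
  leb.-integrable setT (EFin \o (fun x => f (affine c h x))).
Proof.
move=> h0 /integrableP[mf fi]; apply/integrableP; split.
  exact: (measurableT_comp mf (@measurable_affine R c h)).
have mf' : measurable_fun [set: R] (fun x => `|(EFin \o f) x|%E).
  exact: measurableT_comp.
have := @integral_affine R c h _ h0 mf' (fun x => abse_ge0 _).
move: fi; rewrite /= => fi E.
have ha : (0 < `|h|%:E)%E by rewrite lte_fin normr_gt0.
rewrite ltey; apply/negP => /eqP Ey.
by move: fi; rewrite -E Ey gt0_muley// ltxx.
Qed.

Lemma Rintegral_affine (c h : R) (f : R -> R) : h != 0 ->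
  leb.-integrable setT (EFin \o f) ->
  `|h| * (\int[leb]_x f (affine c h x)) = \int[leb]_x f x.
Proof.
move=> h0 fi; have fi' := integrable_affine c h0 fi.
rewrite /Rintegral.
have [/integrableP[mf _]] := fi.
have -> : (\int[leb]_x (f x)%:E = `|h|%:E * \int[leb]_x (f (affine c h x))%:E)%E.
  rewrite integralE [in RHS]integralE muleBr//; last exact: integrable_add_def.
  congr (_ - _)%E.
    have mp : measurable_fun [set: R] ((EFin \o f)^\+)%E by exact: measurable_funepos.
    transitivity (\int[leb]_x (EFin \o f)^\+ x)%E; first by [].
    rewrite -(integral_affine c h0 mp (fun x => funepos_ge0 _ x)).
    by congr (_ * _)%E; apply: eq_integral => x _; rewrite !funeposE.
  have mn : measurable_fun [set: R] ((EFin \o f)^\-)%E by exact: measurable_funeneg.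
  transitivity (\int[leb]_x (EFin \o f)^\- x)%E; first by [].
  rewrite -(integral_affine c h0 mn (fun x => funeneg_ge0 _ x)).
  by congr (_ * _)%E; apply: eq_integral => x _; rewrite !funenegE.
by rewrite fineM//; exact: integrable_fin_num.
Qed.

End SignedAffine.

Section IntervalCalculus.
Context {R : realType}.
Local Notation leb := (@lebesgue_measure R).
Implicit Types (a b c h : R) (f g : R -> R).

Lemma itvint_affine a b c h f : 0 < h -> continuous f ->
  h * itvint a b (fun s => f (affine c h s)) = itvint (affine c h a) (affine c h b) f.
Proof.
move=> h0 cf; rewrite /itvint [in LHS]Rintegral_mkcond [RHS]Rintegral_mkcond.
have fi : leb.-integrable setT (EFin \o (f \_ `[affine c h a, affine c h b])).
  rewrite -restrict_EFin; apply/(integrable_restrict _ _ _) => //.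
  by rewrite setTI; exact: itv_integrable.
have hn0 : h != 0 by rewrite gt_eqF.
rewrite -(@Rintegral_affine _ c h _ hn0 fi) gtr0_norm//; congr (_ * _); apply: eq_Rintegral => s _.
rewrite !patchE /affine.
have -> : (c + h * s \in `[c + h * a, c + h * b]%classic) = (s \in `[a, b]%classic).
  apply/idP/idP; rewrite !inE/= !in_itv/= !lerD2l !ler_pM2l//.
by [].
Qed.

Lemma itvint_split a b c f : a <= b -> b <= c -> continuous f ->
  itvint a c f = itvint a b f + itvint b c f.
Proof.
move=> ab bc cf; rewrite /itvint addrC.
have fi := @itv_integrable R a c f cf.
rewrite -(@Rintegral_itv_obnd_cbnd _ b); last first.
  apply: (integrableS _ _ _ (@itv_integrable R b c f cf)) => //.
  exact: subset_itv_oc_cc.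
by rewrite -(@Rintegral_itvB _ _ (BLeft a) (BRight c) b)// subrK.
Qed.

(** One-dimensional source of [avg_double], the passage from one dyadic scale to the next. *)
Lemma itvint_double f : continuous f ->
  itvint 0 1 (fun s => f (2 * s)) =
  2^-1 * (itvint 0 1 f + itvint 0 1 (fun s => f (1 + s))).
Proof.
move=> cf.
have := @itvint_affine 0 1 0 2 f (@ltr0Sn R 1) cf.
have := @itvint_affine 0 1 1 1 f (@ltr01 R) cf.
rewrite /affine !mulr0 !mulr1 !addr0 !add0r !mul1r => E1 E2.
have E3 := @itvint_split 0 1 2 f (@ler01 R) _ cf.
have -> : itvint 0 1 (fun s => f (2 * s)) = itvint 0 1 (fun s => f (0 + 2 * s)).
  by apply: eq_itvint => s _; rewrite add0r.
have -> : itvint 0 1 (fun s => f (1 + s)) = itvint 0 1 (fun s => f (1 + 1 * s)).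
  by apply: eq_itvint => s _; rewrite mul1r.
rewrite E1 -E3 -?E2; [by rewrite mulrA mulVf// mul1r|by rewrite ler1n].
Qed.

Lemma le_itvint_sub t f : 0 <= t <= 1 -> continuous f -> (forall s, 0 <= f s) ->
  itvint 0 t f <= itvint 0 1 f.
Proof.
move=> /andP[t0 t1] cf f0; rewrite (itvint_split t0 t1 cf) lerDl.
exact: itvint_ge0.
Qed.

Lemma derivable_addl (c : R) (G : R -> R) t : derivable G t 1 ->
  derivable (fun x => c + G x) t 1 /\ derive1 (fun x => c + G x) t = derive1 G t.
Proof.
move=> dG.
have E : (fun x => c + G x) = ((cst c : R -> R^o) + (G : R -> R^o)) by [].
have dc : derivable (cst c : R -> R^o) t 1 by exact: derivable_cst.
split; first by rewrite E; exact: (derivableD dc dG).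
by rewrite E !derive1E (deriveD dc dG) derive_cst add0r.
Qed.

Lemma derivable_mul (F G : R -> R) t : derivable F t 1 -> derivable G t 1 ->
  derivable (fun x => F x * G x) t 1 /\
  derive1 (fun x => F x * G x) t = derive1 F t * G t + F t * derive1 G t.
Proof.
move=> dF dG.
have E : (fun x => F x * G x) = ((F : R -> R^o) * (G : R -> R^o)) by [].
split; first by rewrite E; exact: (derivableM dF dG).
by rewrite E !derive1E (deriveM dF dG) addrC /GRing.scale/= (mulrC (G t)).
Qed.

(** Integrated form of [g] being the derivative of [f]: it asks for no derivative at the end points
    and survives averaging in [x] by an exchange of integrals. *)
Definition primitive f g := forall t, 0 <= t <= 1 -> f t = f 0 + itvint 0 t g.

Lemma primitive_is_derive f g t : continuous g -> primitive f g -> 0 < t < 1 ->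
  derivable f t 1 /\ derive1 f t = g t.
Proof.
move=> cg fg /andP[t0 t1].
have [dG G't] := @continuous_FTC1_closed R g 0 t 1 t1 (itv_integrable 0 1 cg) t0 (cg t).
have nfG : {near t, (fun x => f 0 + itvint 0 x g) =1 f}.
  near=> x; rewrite [RHS]fg//.
  have x0 : 0 < x by near: x; exact: lt_nbhsr.
  have x1 : x < 1 by near: x; exact: lt_nbhsl.
  by rewrite !ltW.
have [dfG G''] := derivable_addl (f 0) dG.
split; first exact: (near_eq_derivable nfG dfG).
by rewrite -G't -G'' !derive1E -(near_eq_derive _ nfG).
Unshelve. all: end_near. Qed.

Lemma itvint_derive f g : continuous f -> continuous g ->
  (forall t, 0 < t < 1 -> derivable f t 1 /\ derive1 f t = g t) ->
  forall t, 0 < t <= 1 -> itvint 0 t g = f t - f 0.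
Proof.
move=> cf cg fg t /andP[t0 t1].
rewrite /itvint /Rintegral (@continuous_FTC2 R g f 0 t t0)//.
- exact: continuous_subspaceT.
- split=> [x|  |]; last 2 first.
  + exact: (cvg_at_right_filter (cf 0)).
  + exact: (cvg_at_left_filter (cf t)).
  by rewrite in_itv/= => /andP[x0 xt]; have [|] := fg x; rewrite // x0 (lt_le_trans xt).
- move=> x; rewrite in_itv/= => /andP[x0 xt].
  by have [|] := fg x; rewrite // x0 (lt_le_trans xt).
Qed.

(** The product rule is applied to honest derivatives in the open interval and then integrated back;
    continuity takes care of the end points. *)
Lemma primitiveM f f' g g' : continuous f -> continuous f' -> continuous g ->
  continuous g' -> primitive f f' -> primitive g g' ->
  primitive (fun t => f t * g t) (fun t => f' t * g t + f t * g' t).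
Proof.
move=> cf cf' cg cg' Pf Pg t /andP[t0 t1].
have [->|tn0] := eqVneq t 0.
  by rewrite /itvint set_itv1 Rintegral_set1 addr0.
rewrite (@itvint_derive (fun t => f t * g t)); [by rewrite addrC subrK|by cont|by cont| |].
  move=> s s01; have [df f's] := primitive_is_derive cf' Pf s01.
  have [dg g's] := primitive_is_derive cg' Pg s01.
  by have [? ->] := derivable_mul df dg; rewrite f's g's.
by rewrite lt_neqAle eq_sym tn0 t0.
Qed.

Definition energy (k : R) f f' :=
  k ^+ 2 * itvint 0 1 (fun t => f t ^+ 2) + itvint 0 1 (fun t => f' t ^+ 2).

Lemma energy_ge0 k f f' : 0 <= energy k f f'.
Proof.
apply: addr_ge0; first apply: mulr_ge0; rewrite ?sqr_ge0//.
  by apply: itvint_ge0 => s _; exact: sqr_ge0.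
by apply: itvint_ge0 => s _; exact: sqr_ge0.
Qed.

(** The derivative of [f ^ 2] is at most [k f ^ 2 + k^-1 f' ^ 2] in absolute value, and this
    integrates to [V]. So [f 0 ^ 2] is at most the mean of [f ^ 2] plus [V], the mean is at most [V]
    because [1 <= k], and going from 0 to [t] costs a third [V]. *)
Lemma energy_sup k f f' t : 1 <= k -> continuous f -> continuous f' ->
  primitive f f' -> 0 <= t <= 1 -> f t ^+ 2 <= 3 * k^-1 * energy k f f'.
Proof.
move=> k1 cf cf' Pf t01.
have k0 : 0 < k by exact: lt_le_trans k1.
have P2 := primitiveM cf cf' cf cf' Pf Pf.
pose phi s := f' s * f s + f s * f' s.
have cphi : continuous phi by rewrite /phi; cont.
set V := k^-1 * energy k f f'.
have phiV : itvint 0 1 (fun s => `|phi s|) <= V.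
  have -> : V = itvint 0 1 (fun s => k * f s ^+ 2 + k^-1 * f' s ^+ 2).
    rewrite itvintD; [|by cont|by cont]; rewrite !itvintZ; [|by cont|by cont].
    by rewrite /V /energy mulrDr mulrA; congr (_ * _ + _); field; rewrite gt_eqF.
  apply: le_itvint; [by cont|by cont|] => s _.
  have : 0 <= k^-1 * (k * `|f s| - `|f' s|) ^+ 2.
    by rewrite mulr_ge0 ?sqr_ge0 ?invr_ge0 ?ltW.
  have -> : k^-1 * (k * `|f s| - `|f' s|) ^+ 2 =
      k * f s ^+ 2 + k^-1 * f' s ^+ 2 - 2 * (`|f s| * `|f' s|).
    by rewrite -(real_normK (num_real (f s))) -(real_normK (num_real (f' s)));
       field; rewrite gt_eqF.
  rewrite subr_ge0 => H; apply: le_trans H.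
  have -> : phi s = 2 * (f s * f' s) by rewrite /phi; ring.
  by rewrite normrM normrM ger0_norm.
have itv_phi s : 0 <= s <= 1 -> `|itvint 0 s phi| <= V.
  move=> s01; apply: le_trans (le_norm_itvint _ _ cphi) _.
  by apply: le_trans phiV; apply: le_itvint_sub => //; cont.
have ft := P2 t t01; rewrite -!expr2 -/phi in ft.
have f0 : f 0 ^+ 2 <= itvint 0 1 (fun s => f s ^+ 2) + V.
  have -> : f 0 ^+ 2 = itvint 0 1 (fun=> f 0 ^+ 2).
    by rewrite itvint_cst// subr0 mul1r.
  have -> : V = itvint 0 1 (fun=> V) by rewrite itvint_cst// subr0 mul1r.
  rewrite -itvintD; [|by cont|by cont].
  apply: le_itvint; [by cont|by cont|] => s s01.
  have := P2 s s01; rewrite -!expr2 -/phi => ->.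
  have := itv_phi s s01; rewrite ler_norml => /andP[]; lra.
have fV : itvint 0 1 (fun s => f s ^+ 2) <= V.
  rewrite /V ler_pdivlMl//; apply: (@le_trans _ _ (k ^+ 2 * itvint 0 1 (fun s => f s ^+ 2))).
    rewrite ler_wpM2r ?ler_eXnr//.
    by apply: itvint_ge0 => s _; exact: sqr_ge0.
  by rewrite lerDl; apply: itvint_ge0 => s _; exact: sqr_ge0.
rewrite -mulrA -/V.
have := itv_phi t t01; rewrite ler_norml => /andP[]; lra.
Qed.

(** For [k <= l] the derivative already sits on the lower frequency and Cauchy-Schwarz suffices.
    Otherwise integrate by parts. In units of [(k * l)^-1] times the energies, each boundary product
    has square at most 9 by [energy_sup] and the new integral at most 1; the square of three terms
    then gives 57 = 3 (9 + 9 + 1). *)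
Lemma itvint_energy k l f f' g g' : 1 <= k -> 1 <= l -> continuous f ->
  continuous f' -> continuous g -> continuous g' -> primitive f f' ->
  primitive g g' ->
  itvint 0 1 (fun t => f' t * g t) ^+ 2 <=
  57 * (k * l)^-1 * (energy k f f' * energy l g g').
Proof.
move=> k1 l1 cf cf' cg cg' Pf Pg.
have k0 : 0 < k by exact: lt_le_trans k1.
have l0 : 0 < l by exact: lt_le_trans l1.
have ki : 0 < k^-1 by rewrite invr_gt0.
have li : 0 < l^-1 by rewrite invr_gt0.
have sqi (h : R -> R) : continuous h -> 0 <= itvint 0 1 (fun s => h s ^+ 2).
  by move=> _; apply: itvint_ge0 => s _; exact: sqr_ge0.
have := @energy_sup k f f' 1 k1 cf cf' Pf; have := @energy_sup k f f' 0 k1 cf cf' Pf.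
have := @energy_sup l g g' 1 l1 cg cg' Pg; have := @energy_sup l g g' 0 l1 cg cg' Pg.
rewrite !lexx ler01 /= => /(_ isT) g0 /(_ isT) g1 /(_ isT) f0 /(_ isT) f1.
have X0 := energy_ge0 k f f'; have Y0 := energy_ge0 l g g'.
have fX : itvint 0 1 (fun s => f s ^+ 2) <= k^-1 ^+ 2 * energy k f f'.
  rewrite exprVn ler_pdivlMl ?exprn_gt0// lerDl; exact: sqi.
have f'X : itvint 0 1 (fun s => f' s ^+ 2) <= energy k f f'.
  by rewrite lerDr mulr_ge0 ?sqr_ge0//; exact: sqi.
have gY : itvint 0 1 (fun s => g s ^+ 2) <= l^-1 ^+ 2 * energy l g g'.
  rewrite exprVn ler_pdivlMl ?exprn_gt0// lerDl; exact: sqi.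
have g'Y : itvint 0 1 (fun s => g' s ^+ 2) <= energy l g g'.
  by rewrite lerDr mulr_ge0 ?sqr_ge0//; exact: sqi.
rewrite invfM.
set X := energy k f f' in X0 fX f'X f0 f1 *; set Y := energy l g g' in Y0 gY g'Y g0 g1 *.
have XY0 : 0 <= X * Y by exact: mulr_ge0.
have [kl|lk] := lerP k l.
  apply: le_trans (itvint_cauchy_schwarz 0 1 cf' cg) _.
  apply: (@le_trans _ _ (X * (l^-1 ^+ 2 * Y))).
    by apply: ler_pM => //; exact: sqi.
  have lk : l^-1 <= k^-1 by rewrite lef_pV2.
  rewrite mulrCA ler_wpM2r// expr2.
  apply: (@le_trans _ _ (k^-1 * l^-1)); first by rewrite ler_wpM2r// ltW.
  by rewrite ler_peMl// ?ler1n// mulr_ge0// ltW.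
have kl : k^-1 <= l^-1 by rewrite lef_pV2// ltW.
have P1 := primitiveM cf cf' cg cg' Pf Pg; have := P1 1.
rewrite lexx ler01 => /(_ isT).
rewrite itvintD; [|by cont|by cont] => E.
have -> : itvint 0 1 (fun t => f' t * g t) =
    f 1 * g 1 - f 0 * g 0 - itvint 0 1 (fun t => f t * g' t) by rewrite E; ring.
have I := itvint_cauchy_schwarz 0 1 cf cg'.
set J := itvint 0 1 _ in I *.
have {}I : J ^+ 2 <= k^-1 * l^-1 * (X * Y).
  apply: (le_trans I); apply: (@le_trans _ _ ((k^-1 ^+ 2 * X) * Y)).
    by apply: ler_pM => //; exact: sqi.
  by rewrite -mulrA ler_wpM2r// expr2 ler_wpM2l// ltW.
have bd x y : x ^+ 2 <= 3 * k^-1 * X -> y ^+ 2 <= 3 * l^-1 * Y ->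
    (x * y) ^+ 2 <= 9 * (k^-1 * l^-1 * (X * Y)).
  move=> xX yY; rewrite exprMn.
  have -> : 9 * (k^-1 * l^-1 * (X * Y)) = (3 * k^-1 * X) * (3 * l^-1 * Y) by ring.
  by apply: ler_pM => //; exact: sqr_ge0.
have b1 := bd _ _ f1 g1; have b0 := bd _ _ f0 g0.
have -> : 57 * (k^-1 * l^-1) * (X * Y) = 57 * (k^-1 * l^-1 * (X * Y)) by ring.
move: (k^-1 * l^-1 * (X * Y)) b1 b0 I => Z b1 b0 I.
set p := f 1 * g 1 in b1 *; set q := f 0 * g 0 in b0 *.
have := sqr_ge0 (p + q); have := sqr_ge0 (p + J); have := sqr_ge0 (q - J).
nra.
Qed.

End IntervalCalculus.

(** * Integration over the plane *)

Section RealBounds.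
Context {R : realType}.

(** The optimal weight is [sqrt b / sqrt a]. If [a] or [b] vanishes the optimum is only approached,
    which is why the bound is proved up to [e]. The lemma turns weighted sums, which are easy to add
    up, into products of norms. *)
Lemma le_sqrt_of_weighted (a b : R) (x : \bar R) : 0 <= a -> 0 <= b ->
  (forall l : R, 0 < l -> (x <= (2^-1 * (l * a + l^-1 * b))%:E)%E) ->
  (x <= (Num.sqrt (a * b))%:E)%E.
Proof.
move=> a0 b0 H; apply/lee_addgt0Pr => e e0.
have [az|an] := eqVneq a 0.
  have l0 : 0 < (b + 1) / e by rewrite divr_gt0//; lra.
  apply: le_trans (H _ l0) _; rewrite az mul0r sqrtr0 add0e lee_fin mulr0 add0r.
  have : e / (b + 1) * b <= e by rewrite mulrAC ler_pdivrMr; nra.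
  by rewrite invf_div; lra.
have ap : 0 < a by rewrite lt_neqAle eq_sym an.
have [bz|bn] := eqVneq b 0.
  have l0 : 0 < e / (a + 1) by rewrite divr_gt0//; lra.
  apply: le_trans (H _ l0) _; rewrite bz !mulr0 sqrtr0 add0e lee_fin addr0.
  have : e / (a + 1) * a <= e by rewrite mulrAC ler_pdivrMr; nra.
  by lra.
have bp : 0 < b by rewrite lt_neqAle eq_sym bn.
have l0 : 0 < Num.sqrt b / Num.sqrt a by rewrite divr_gt0// sqrtr_gt0.
apply: le_trans (H _ l0) _; rewrite -EFinD lee_fin.
rewrite sqrtrM//.
have sa : 0 < Num.sqrt a by rewrite sqrtr_gt0.
have sb : 0 < Num.sqrt b by rewrite sqrtr_gt0.
have := sqr_sqrtr a0; have := sqr_sqrtr b0.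
move: sa sb; move: (Num.sqrt a) (Num.sqrt b) => u v u0 v0 <- <-.
have -> : 2^-1 * (v / u * u ^+ 2 + (v / u)^-1 * v ^+ 2) = u * v.
  by field; rewrite !gt_eqF.
by lra.
Qed.

Lemma weighted_am_gm (l x y : R) : 0 < l -> x * y <= 2^-1 * (l * x ^+ 2 + l^-1 * y ^+ 2).
Proof.
move=> l0; have li : 0 < l^-1 by rewrite invr_gt0.
rewrite -subr_ge0.
have -> : 2^-1 * (l * x ^+ 2 + l^-1 * y ^+ 2) - x * y =
    2^-1 * l^-1 * (l * x - y) ^+ 2 by field; rewrite gt_eqF.
by rewrite mulr_ge0 ?sqr_ge0// mulr_ge0// ltW.
Qed.

End RealBounds.

(** * Cauchy-Schwarz inequalities for extended integrals *)

Section CauchySchwarz.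
Context d (T : measurableType d) {R : realType} (mu : {measure set T -> \bar R}).
Implicit Types (f g : T -> R).

Lemma measurable_EFin_sqr f : measurable_fun setT f ->
  measurable_fun setT (fun x => (f x ^+ 2)%:E).
Proof. by move=> mf; apply/measurable_EFinP; exact: measurable_funX. Qed.

Lemma measurable_EFin_norm f : measurable_fun setT f ->
  measurable_fun setT (fun x => `|f x|%:E).
Proof. by move=> mf; apply/measurable_EFinP; exact: measurableT_comp. Qed.

Lemma le_integral_EFin f g : measurable_fun setT f -> measurable_fun setT g ->
  (forall x, 0 <= f x) -> (forall x, f x <= g x) ->
  (\int[mu]_x (f x)%:E <= \int[mu]_x (g x)%:E)%E.
Proof.
move=> mf mg f0 fg; apply: ge0_le_integral => //.
- by move=> x _; rewrite lee_fin.
- exact/measurable_EFinP.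
- exact/measurable_EFinP.
- by move=> x _; rewrite lee_fin.
Qed.

Lemma integral_EFinZl (c : R) f : measurable_fun setT f -> 0 <= c ->
  (forall x, 0 <= f x) -> (\int[mu]_x (c * f x)%:E = c%:E * \int[mu]_x (f x)%:E)%E.
Proof.
move=> mf c0 f0; under eq_integral do rewrite EFinM.
rewrite ge0_integralZl//; first exact/measurable_EFinP.
by move=> x _; rewrite lee_fin.
Qed.

Lemma integral_EFinD f g : measurable_fun setT f -> measurable_fun setT g ->
  (forall x, 0 <= f x) -> (forall x, 0 <= g x) ->
  (\int[mu]_x (f x + g x)%:E = \int[mu]_x (f x)%:E + \int[mu]_x (g x)%:E)%E.
Proof.
move=> mf mg f0 g0; under eq_integral do rewrite EFinD.
rewrite ge0_integralD//.
- by move=> x _; rewrite lee_fin.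
- exact/measurable_EFinP.
- by move=> x _; rewrite lee_fin.
- exact/measurable_EFinP.
Qed.

Lemma integral_EFin_ge0 f : (forall x, 0 <= f x) ->
  (0 <= \int[mu]_x (f x)%:E)%E.
Proof. by move=> f0; apply: integral_ge0 => x _; rewrite lee_fin. Qed.

(** AM-GM with a free weight under the integral, optimised at the end; the integrals need not be
    known to be finite in advance. *)
Lemma integral_cauchy_schwarz f g (a b : R) : measurable_fun setT f ->
  measurable_fun setT g -> 0 <= a -> 0 <= b ->
  (\int[mu]_x (f x ^+ 2)%:E <= a%:E)%E -> (\int[mu]_x (g x ^+ 2)%:E <= b%:E)%E ->
  (\int[mu]_x `|f x * g x|%:E <= (Num.sqrt (a * b))%:E)%E.
Proof.
move=> mf mg a0 b0 fa gb; apply: le_sqrt_of_weighted => // l l0.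
have li : 0 < l^-1 by rewrite invr_gt0.
apply: (@le_trans _ _ (\int[mu]_x
    ((2^-1 * l)%:E * (f x ^+ 2)%:E + (2^-1 * l^-1)%:E * (g x ^+ 2)%:E))%E).
  apply: ge0_le_integral => //.
  - exact/measurable_EFin_norm/measurable_funM.
  - apply: emeasurable_funD; apply: emeasurable_funM;
      try exact: measurable_cst; exact: measurable_EFin_sqr.
  move=> x _; rewrite -!EFinM -EFinD lee_fin.
  have := @weighted_am_gm R l `|f x| `|g x| l0.
  by rewrite !real_normK ?num_real// normrM mulrDr !mulrA.
have h1 : 0 <= 2^-1 * l by rewrite mulr_ge0// ltW.
have h2 : 0 <= 2^-1 * l^-1 by rewrite mulr_ge0// ltW.
rewrite ge0_integralD//; last 4 first.
- by move=> x _; rewrite -EFinM lee_fin mulr_ge0// sqr_ge0.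
- by apply: emeasurable_funM; [exact: measurable_cst|exact: measurable_EFin_sqr].
- by move=> x _; rewrite -EFinM lee_fin mulr_ge0// sqr_ge0.
- by apply: emeasurable_funM; [exact: measurable_cst|exact: measurable_EFin_sqr].
rewrite !ge0_integralZl//; try exact: measurable_EFin_sqr.
  rewrite mulrDr EFinD; apply: leeD.
    by rewrite mulrA [leRHS]EFinM; apply: lee_wpmul2l; rewrite ?lee_fin.
  by rewrite mulrA [leRHS]EFinM; apply: lee_wpmul2l; rewrite ?lee_fin.
all: by move=> x _; rewrite lee_fin sqr_ge0.
Qed.

(** Cauchy-Schwarz for [s sqrt r] against [sqrt r]. It is the pointwise step of both Young
    inequalities below. *)
Lemma weighted_cauchy_schwarz (s r : T -> R) (c : R) : measurable_fun setT s ->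
  measurable_fun setT r -> (forall x, 0 <= r x) -> 0 < c ->
  (\int[mu]_x (r x)%:E <= c%:E)%E ->
  ((\int[mu]_x `|s x * r x|%:E) ^+ 2 <=
   c%:E * \int[mu]_x (s x ^+ 2 * r x)%:E)%E.
Proof.
move=> ms mr r0 c0 rc.
have U0 : (0 <= \int[mu]_x (s x ^+ 2 * r x)%:E)%E.
  by apply: integral_ge0 => x _; rewrite lee_fin mulr_ge0 ?sqr_ge0.
have [Uoo|Ufin] := eqVneq (\int[mu]_x (s x ^+ 2 * r x)%:E)%E +oo%E.
  by rewrite Uoo gt0_muley ?lte_fin// leey.
have : (\int[mu]_x (s x ^+ 2 * r x)%:E)%E \is a fin_num.
  by rewrite ge0_fin_numE// ltey.
move/fineK => UE; set u := fine _ in UE.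
have u0 : 0 <= u by rewrite /u fine_ge0.
have mq : measurable_fun setT (fun x => Num.sqrt (r x)).
  apply: (measurableT_comp (measurable_continuous (@sqrt_continuous R))) => //.
have := @integral_cauchy_schwarz (fun x => s x * Num.sqrt (r x)) (fun x => Num.sqrt (r x)) u c.
move=> /(_ (measurable_funM ms mq) mq u0 (ltW c0)).
have -> : (\int[mu]_x ((s x * Num.sqrt (r x)) ^+ 2)%:E =
    \int[mu]_x (s x ^+ 2 * r x)%:E)%E.
  by apply: eq_integral => x _; rewrite exprMn sqr_sqrtr.
have -> : (\int[mu]_x (Num.sqrt (r x) ^+ 2)%:E = \int[mu]_x (r x)%:E)%E.
  by apply: eq_integral => x _; rewrite sqr_sqrtr.
have -> : (\int[mu]_x `|s x * Num.sqrt (r x) * Num.sqrt (r x)|%:E =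
    \int[mu]_x `|s x * r x|%:E)%E.
  by apply: eq_integral => x _; rewrite -mulrA -expr2 sqr_sqrtr.
rewrite -UE => /(_ (lexx _) rc) H.
have I0 : (0 <= \int[mu]_x `|s x * r x|%:E)%E by apply: integral_ge0 => x _; rewrite lee_fin.
move: H I0; case: (\int[mu]_x `|s x * r x|%:E)%E => [i| |] //.
move=> H i0; rewrite lee_fin in H; rewrite lee_fin in i0.
rewrite -EFin_expe -EFinM lee_fin.
have : i ^+ 2 <= Num.sqrt (u * c) ^+ 2 by rewrite lerXn2r ?nnegrE// sqrtr_ge0.
by rewrite sqr_sqrtr ?mulr_ge0// ?(ltW c0)// mulrC.
Qed.

End CauchySchwarz.

(** * The product measure on the plane *)

Section PlaneMeasure.
Context {R : realType}.
Local Notation leb := (@lebesgue_measure R).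

Lemma sigma_finite_lebesgue2 : sigma_finite setT (leb \x leb)%E.
Proof.
have /sigma_finiteP[F [TF ndF Foo]] := sigma_finiteT leb.
exists (fun n => F n `*` F n).
  rewrite -setXTT TF predeqE => -[x y]; split => [[/= [n _ Fnx] [k _ Gky]]|].
    by exists (maxn n k) => //; split; [move: x Fnx|move: y Gky];
      apply/subsetPset/ndF; rewrite ?leq_maxl ?leq_maxr.
  by move=> [n _ []/= ? ?]; split; exists n.
move=> k; have [? ?] := Foo k; split; first exact: measurableX.
by rewrite product_measure1E// lte_mul_pinfty// ge0_fin_numE.
Qed.

(* The library loses the sigma-finite structure of a product of sigma-finite
   measures (its canonical key is taken by sub-probabilities), so it is
   restored on a copy of the product. *)
Definition plane_measure :
    set (measurableTypeR R * measurableTypeR R)%type -> \bar R := (leb \x leb)%E.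

HB.instance Definition _ := Measure.copy plane_measure (leb \x leb)%E.
HB.instance Definition _ :=
  Measure_isSigmaFinite.Build _ _ _ plane_measure sigma_finite_lebesgue2.

End PlaneMeasure.

Section Plane.
Context {R : realType}.
Local Notation leb := (@lebesgue_measure R).
Local Notation leb2 := (@plane_measure R).
Local Notation X := (R * R)%type.
Implicit Types (f g : X -> R).

Lemma plane_tonelli (f : X -> \bar R) : measurable_fun [set: X] f ->
  (forall x, 0 <= f x)%E ->
  (\int[leb2]_x f x = \int[leb]_a \int[leb]_b f (a, b))%E.
Proof. by move=> mf f0; exact: (fubini_tonelli1 (m1 := leb) (m2 := leb) f mf f0). Qed.

Lemma plane_fubini (f : X -> \bar R) : leb2.-integrable setT f ->
  (\int[leb2]_x f x = \int[leb]_a \int[leb]_b f (a, b))%E.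
Proof.
by move=> fi; exact: esym (integral12_prod_meas1 (m1 := leb) (m2 := leb) fi).
Qed.

Definition affine2 (c h x : X) : X := (affine c.1 h.1 x.1, affine c.2 h.2 x.2).

Lemma measurable_affine2 (c h : X) : measurable_fun [set: X] (affine2 c h : X -> X).
Proof.
apply/measurable_fun_pairP; split => /=.
  exact: (measurableT_comp (measurable_affine c.1 h.1) (@measurable_fst _ _ _ _)).
exact: (measurableT_comp (measurable_affine c.2 h.2) (@measurable_snd _ _ _ _)).
Qed.

Lemma integral_affine2 (c h : X) (f : X -> \bar R) : h.1 != 0 -> h.2 != 0 ->
  measurable_fun [set: X] f -> (forall x, 0 <= f x)%E ->
  (`|h.1 * h.2|%:E * \int[leb2]_x f (affine2 c h x) = \int[leb2]_x f x)%E.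
Proof.
move=> h1 h2 mf f0.
have mfa : measurable_fun [set: X] (fun x => f (affine2 c h x)).
  exact: (measurableT_comp mf (measurable_affine2 c h)).
rewrite (plane_tonelli mf f0) (plane_tonelli mfa (fun x => f0 _)).
have mF := measurable_fun_fubini_tonelli_F (m2 := leb) f mf f0.
have mFa := measurable_fun_fubini_tonelli_F (m2 := leb) _ mfa (fun x => f0 _).
rewrite -(@integral_affine R c.1 h.1 _ h1 mF); last by move=> x; exact: integral_ge0.
rewrite normrM EFinM -muleA -ge0_integralZl//; last by move=> x _; exact: integral_ge0.
congr (_ * _)%E; apply: eq_integral => x _.
have mfx : measurable_fun [set: R] (fun y => f (affine c.1 h.1 x, y)).
  exact: (measurableT_comp mf (pair1_measurable _)).
exact: (integral_affine c.2 h2 mfx).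
Qed.

Lemma integrable_affine2 (c h : X) f : h.1 != 0 -> h.2 != 0 ->
  leb2.-integrable setT (EFin \o f) ->
  leb2.-integrable setT (EFin \o (fun x => f (affine2 c h x))).
Proof.
move=> h1 h2 /integrableP[mf fi]; apply/integrableP; split.
  exact: (measurableT_comp mf (measurable_affine2 c h)).
have mf' : measurable_fun [set: X] (fun x => `|(EFin \o f) x|%E).
  exact: measurableT_comp.
have := @integral_affine2 c h _ h1 h2 mf' (fun x => abse_ge0 _).
move: fi; rewrite /= => fi E.
have ha : (0 < `|h.1 * h.2|%:E)%E by rewrite lte_fin normr_gt0 mulf_neq0.
rewrite ltey; apply/negP => /eqP Ey.
by move: fi; rewrite -E Ey gt0_muley// ltxx.
Qed.

Lemma Rintegral_affine2 (c h : X) f : h.1 != 0 -> h.2 != 0 ->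
  leb2.-integrable setT (EFin \o f) ->
  `|h.1 * h.2| * (\int[leb2]_x f (affine2 c h x)) = \int[leb2]_x f x.
Proof.
move=> h1 h2 fi; have fi' := integrable_affine2 c h1 h2 fi.
rewrite /Rintegral.
have [/integrableP[mf _]] := fi.
have -> : (\int[leb2]_x (f x)%:E = `|h.1 * h.2|%:E * \int[leb2]_x (f (affine2 c h x))%:E)%E.
  rewrite integralE [in RHS]integralE muleBr//; last exact: integrable_add_def.
  congr (_ - _)%E.
    have mp : measurable_fun [set: X] ((EFin \o f)^\+)%E by exact: measurable_funepos.
    transitivity (\int[leb2]_x (EFin \o f)^\+ x)%E; first by [].
    rewrite -(integral_affine2 c h1 h2 mp (fun x => funepos_ge0 _ x)).
    by congr (_ * _)%E; apply: eq_integral => x _; rewrite !funeposE.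
  have mn : measurable_fun [set: X] ((EFin \o f)^\-)%E by exact: measurable_funeneg.
  transitivity (\int[leb2]_x (EFin \o f)^\- x)%E; first by [].
  rewrite -(integral_affine2 c h1 h2 mn (fun x => funeneg_ge0 _ x)).
  by congr (_ * _)%E; apply: eq_integral => x _; rewrite !funenegE.
by rewrite fineM//; exact: integrable_fin_num.
Qed.

Lemma integral_shift (v : X) (f : X -> \bar R) :
  measurable_fun [set: X] f -> (forall x, 0 <= f x)%E ->
  (\int[leb2]_x f (x + v)%R = \int[leb2]_x f x)%E.
Proof.
move=> mf f0; rewrite -(@integral_affine2 v (1, 1) f)//= ?oner_neq0//.
rewrite mulr1 normr1 mul1e; apply: eq_integral => -[x1 x2] _.
by rewrite /affine2 /affine /= !mul1r (addrC v.1) (addrC v.2).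
Qed.

Lemma integral_reflect (v : X) (f : X -> \bar R) :
  measurable_fun [set: X] f -> (forall x, 0 <= f x)%E ->
  (\int[leb2]_x f (v - x)%R = \int[leb2]_x f x)%E.
Proof.
move=> mf f0; rewrite -(@integral_affine2 v (-1, -1) f)//= ?oppr_eq0 ?oner_neq0//.
rewrite mulrNN mulr1 normr1 mul1e; apply: eq_integral => -[x1 x2] _.
by rewrite /affine2 /affine /= !mulN1r.
Qed.

End Plane.

(** * Continuous functions supported in a square *)

Section CompactSupport.
Context {R : realType}.
Local Notation leb := (@lebesgue_measure R).
Local Notation leb2 := (@plane_measure R).
Local Notation X := (R * R)%type.
Implicit Types (f m : X -> R) (r : R).

Definition box_supported r m := forall x, m x != 0 -> `|x.1| <= r /\ `|x.2| <= r.

Lemma itv_supported_integral (r : R) (g : R -> R) : continuous g ->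
  (forall s, g s != 0 -> `|s| <= r) ->
  (\int[leb]_s (g s)%:E = (itvint (- r) r g)%:E)%E.
Proof.
move=> cg gr; rewrite (itvint_EFin _ _ cg) [RHS]integral_mkcond.
apply: eq_integral => s _; rewrite patchE; case: ifPn => // /negP sr.
have [-> //|/gr gs] := eqVneq (g s) 0.
by exfalso; apply: sr; rewrite inE /= in_itv/= -ler_norml.
Qed.

Definition box_int r m := itvint (- r) r (fun a => itvint (- r) r (fun b => m (a, b))).

Lemma continuous_box_inner r m : 0 <= r -> continuous m ->
  continuous (fun a => itvint (- r) r (fun b => m (a, b))).
Proof. by move=> r0 cm; apply: continuous_itvint => //; lra. Qed.

Lemma box_inner_supported r m : 0 <= r -> box_supported r m -> forall a,
  itvint (- r) r (fun b => m (a, b)) != 0 -> `|a| <= r.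
Proof.
move=> r0 mr a; have [//|ra] := lerP `|a| r.
rewrite (@eq_itvint _ _ _ _ (fun=> 0)) ?itvint_cst ?mulr0 ?eqxx//; first lra.
move=> b _; have [//|/mr[/= ar _]] := eqVneq (m (a, b)) 0.
by move: ar; rewrite leNgt ra.
Qed.

Lemma box_ge0_integral r m : 0 <= r -> continuous m -> box_supported r m ->
  (forall x, 0 <= m x) -> (\int[leb2]_x (m x)%:E = (box_int r m)%:E)%E.
Proof.
move=> r0 cm mr m0.
have mm : measurable_fun [set: X] (fun x => (m x)%:E).
  by apply/measurable_EFinP; exact: measurable_continuous2.
rewrite (plane_tonelli mm); last by move=> x; rewrite lee_fin.
rewrite /box_int -itv_supported_integral; last 2 first.
- exact: continuous_box_inner.
- exact: box_inner_supported.
apply: eq_integral => a _; apply: itv_supported_integral; first by cont.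
by move=> b /mr[].
Qed.

Lemma box_integrable r m : 0 <= r -> continuous m -> box_supported r m ->
  leb2.-integrable setT (EFin \o m).
Proof.
move=> r0 cm mr; apply/integrableP; split.
  by apply/measurable_EFinP; exact: measurable_continuous2.
have := @box_ge0_integral r (fun x => `|m x|) r0 _ _ _.
move=> ->//; first by rewrite ltry.
- by cont.
- by move=> x; rewrite normr_eq0 => /mr.
Qed.

Lemma box_Rintegral r m : 0 <= r -> continuous m -> box_supported r m ->
  \int[leb2]_x m x = box_int r m.
Proof.
move=> r0 cm mr; have im := box_integrable r0 cm mr.
rewrite /Rintegral (plane_fubini im); suff -> : (\int[leb]_x \int[leb]_y (EFin \o m) (x, y) = (box_int r m)%:E)%E by [].
rewrite /box_int -itv_supported_integral; last 2 first.
- exact: continuous_box_inner.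
- exact: box_inner_supported.
apply: eq_integral => a _; apply: itv_supported_integral; first by cont.
by move=> b /mr[].
Qed.

End CompactSupport.

(** * Exchange of integrals against a bounded kernel *)

Section OscillatoryFubini.
Context d1 d2 (X : measurableType d1) (Y : measurableType d2) {R : realType}.
Variables (m1 : {sigma_finite_measure set X -> \bar R})
  (m2 : {sigma_finite_measure set Y -> \bar R}).

(** The tensor product of [m] and [F] dominates. In the application [phi] is the cosine or the sine
    of the product of frequency and position. *)
Lemma bounded_kernel_integrable (m : X -> R) (F : Y -> R) (phi : X * Y -> R) :
  m1.-integrable setT (EFin \o m) -> m2.-integrable setT (EFin \o F) ->
  measurable_fun setT phi -> (forall p, `|phi p| <= 1) ->
  (m1 \x m2)%E.-integrable setT
    (fun p : X * Y => (m p.1 * (phi p * F p.2))%:E).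
Proof.
move=> im iF mphi phi1.
have /integrableP[/measurable_EFinP mm mfin] := im.
have /integrableP[/measurable_EFinP mF Ffin] := iF.
have mm1 : measurable_fun setT (fun p : X * Y => m p.1).
  exact: (measurableT_comp mm (@measurable_fst _ _ _ _)).
have mF2 : measurable_fun setT (fun p : X * Y => F p.2).
  exact: (measurableT_comp mF (@measurable_snd _ _ _ _)).
have mH : measurable_fun setT (fun p : X * Y => m p.1 * (phi p * F p.2)).
  by apply: measurable_funM => //; exact: measurable_funM.
have mG : measurable_fun setT (fun p : X * Y => m p.1 * F p.2).
  exact: measurable_funM.
apply/integrableP; split; first exact/measurable_EFinP.
apply: (@le_lt_trans _ _ (\int[(m1 \x m2)]_p `|m p.1 * F p.2|%:E)%E).
  apply: (@le_integral_EFin _ _ _ _ (fun p => `|m p.1 * (phi p * F p.2)|)).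
  - exact: measurableT_comp.
  - exact: measurableT_comp.
  - by move=> p; exact: normr_ge0.
  by move=> p; rewrite !normrM ler_wpM2l// ler_piMl.
rewrite (fubini_tonelli1 _ (measurable_EFin_norm mG)); last first.
  by move=> p; rewrite lee_fin.
rewrite /fubini_F /=.
have -> : (\int[m1]_x \int[m2]_y `|m x * F y|%:E =
    \int[m1]_x (`|m x|%:E * \int[m2]_y `|F y|%:E))%E.
  apply: eq_integral => x _.
  rewrite -(@integral_EFinZl _ _ _ _ `|m x| (fun y => `|F y|)); last 3 first.
  - exact: measurableT_comp.
  - exact: normr_ge0.
  - by move=> y; exact: normr_ge0.
  by apply: eq_integral => y _; rewrite normrM.
have F0 : (0 <= \int[m2]_y `|F y|%:E)%E by apply: integral_EFin_ge0.
rewrite (ge0_integralZr m1 measurableT (measurable_EFin_norm mm) (fun x _ => _) F0)//.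
apply: lte_mul_pinfty; [by apply: integral_EFin_ge0| |exact: Ffin].
by rewrite ge0_fin_numE; [exact: mfin|apply: integral_EFin_ge0].
Qed.

Lemma oscillatory_integrable (m : X -> R) (F : Y -> R) (phi : X * Y -> R) :
  m1.-integrable setT (EFin \o m) -> m2.-integrable setT (EFin \o F) ->
  measurable_fun setT phi -> (forall p, `|phi p| <= 1) ->
  m1.-integrable setT
    (EFin \o (fun xi => m xi * \int[m2]_y (phi (xi, y) * F y))).
Proof.
move=> im iF mphi phi1.
have iH := bounded_kernel_integrable im iF mphi phi1.
have := integrable_fubini_F iH.
apply: eq_integrable => // xi _; rewrite /fubini_F /=.
have /integrableP[/measurable_EFinP mF Ffin] := iF.
have iy : m2.-integrable setT (EFin \o (fun y => phi (xi, y) * F y)).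
  apply: (le_integrable _ _ _ iF) => //.
    apply/measurable_EFinP; apply: measurable_funM => //.
    exact: (measurableT_comp mphi (pair1_measurable _)).
  by move=> y _; rewrite /= lee_fin normrM ler_piMl.
rewrite -RintegralZl// /Rintegral fineK//.
have := integrableZl measurableT (m xi) iy.
by move=> /integrable_fin_num; apply.
Qed.

Lemma oscillatory_fubini (m : X -> R) (F : Y -> R) (phi : X * Y -> R) :
  m1.-integrable setT (EFin \o m) -> m2.-integrable setT (EFin \o F) ->
  measurable_fun setT phi -> (forall p, `|phi p| <= 1) ->
  \int[m1]_xi (m xi * \int[m2]_y (phi (xi, y) * F y)) =
  \int[m2]_y (F y * \int[m1]_xi (phi (xi, y) * m xi)).
Proof.
move=> im iF mphi phi1.
have iH := bounded_kernel_integrable im iF mphi phi1.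
have E := Fubini iH.
have /integrableP[/measurable_EFinP mF Ffin] := iF.
have /integrableP[/measurable_EFinP mm mfin] := im.
have iy xi : m2.-integrable setT (EFin \o (fun y => phi (xi, y) * F y)).
  apply: (le_integrable _ _ _ iF) => //.
    apply/measurable_EFinP; apply: measurable_funM => //.
    exact: (measurableT_comp mphi (pair1_measurable _)).
  by move=> y _; rewrite /= lee_fin normrM ler_piMl.
have ix y : m1.-integrable setT (EFin \o (fun xi => phi (xi, y) * m xi)).
  apply: (le_integrable _ _ _ im) => //.
    apply/measurable_EFinP; apply: measurable_funM => //.
    exact: (measurableT_comp mphi (pair2_measurable _)).
  by move=> xi _; rewrite /= lee_fin normrM ler_piMl.
rewrite {1}/Rintegral {2}/Rintegral; congr fine.
transitivity (\int[m1]_x \int[m2]_y (m x * (phi (x, y) * F y))%:E)%E.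
  apply: eq_integral => xi _; rewrite -RintegralZl// /Rintegral fineK//.
  have := integrableZl measurableT (m xi) (iy xi).
  by move=> /integrable_fin_num; apply.
rewrite E; apply: eq_integral => y _; rewrite -RintegralZl// /Rintegral fineK//.
  by apply: eq_integral => xi _; congr (_%:E); ring.
have := integrableZl measurableT (F y) (ix y).
by move=> /integrable_fin_num; apply.
Qed.

End OscillatoryFubini.

(** * Convolution kernels of the Littlewood-Paley projections *)

Section KernelFormula.
Context {R : realType}.
Local Notation leb := (@lebesgue_measure R).
Local Notation leb2 := (@plane_measure R).
Local Notation X := (R * R)%type.
Implicit Types (F m : X -> R) (x y z xi eta : X).

Lemma measurable_dot_sub x :
  measurable_fun setT (fun p : X * X => dot (x - p.2) p.1).
Proof.
have m1 : measurable_fun setT (fun p : X * X => p.1.1).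
  exact: (measurableT_comp (@measurable_fst _ _ _ _) (@measurable_fst _ _ _ _)).
have m2 : measurable_fun setT (fun p : X * X => p.1.2).
  exact: (measurableT_comp (@measurable_snd _ _ _ _) (@measurable_fst _ _ _ _)).
have m3 : measurable_fun setT (fun p : X * X => p.2.1).
  exact: (measurableT_comp (@measurable_fst _ _ _ _) (@measurable_snd _ _ _ _)).
have m4 : measurable_fun setT (fun p : X * X => p.2.2).
  exact: (measurableT_comp (@measurable_snd _ _ _ _) (@measurable_snd _ _ _ _)).
have mm1 : measurable_fun setT (fun p : X * X => (x.1 - p.2.1) * p.1.1).
  by apply: measurable_funM => //; exact: measurable_funB.
have mm2 : measurable_fun setT (fun p : X * X => (x.2 - p.2.2) * p.1.2).
  by apply: measurable_funM => //; exact: measurable_funB.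
exact: measurable_funD mm1 mm2.
Qed.

Lemma measurable_cos_dot x :
  measurable_fun setT (fun p : X * X => cos (dot (x - p.2) p.1)).
Proof.
exact: (measurableT_comp (measurable_continuous (@continuous_cos R)) (measurable_dot_sub x)).
Qed.

Lemma measurable_sin_dot x :
  measurable_fun setT (fun p : X * X => sin (dot (x - p.2) p.1)).
Proof.
exact: (measurableT_comp (measurable_continuous (@continuous_sin R)) (measurable_dot_sub x)).
Qed.

Lemma norm_cos_le1 (a : R) : `|cos a| <= 1.
Proof. by rewrite ler_norml cos_geN1 cos_le1. Qed.

Lemma norm_sin_le1 (a : R) : `|sin a| <= 1.
Proof. by rewrite ler_norml sin_geN1 sin_le1. Qed.

Lemma integrable_bounded_mul (phi F : X -> R) : measurable_fun setT phi ->
  (forall y, `|phi y| <= 1) -> leb2.-integrable setT (EFin \o F) ->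
  leb2.-integrable setT (EFin \o (fun y => phi y * F y)).
Proof.
move=> mphi phi1 iF; have /integrableP[/measurable_EFinP mF _] := iF.
apply: (le_integrable _ _ _ iF) => //.
  by apply/measurable_EFinP; exact: measurable_funM.
by move=> y _; rewrite /= lee_fin normrM ler_piMl.
Qed.

Lemma integrable_cos_mul (u : X -> X) xi F : continuous u ->
  leb2.-integrable setT (EFin \o F) ->
  leb2.-integrable setT (EFin \o (fun y => cos (dot (u y) xi) * F y)).
Proof.
move=> cu; apply: integrable_bounded_mul => [|y]; last exact: norm_cos_le1.
by apply: measurable_continuous2; rewrite /dot; cont.
Qed.

Lemma integrable_sin_mul (u : X -> X) xi F : continuous u ->
  leb2.-integrable setT (EFin \o F) ->
  leb2.-integrable setT (EFin \o (fun y => sin (dot (u y) xi) * F y)).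
Proof.
move=> cu; apply: integrable_bounded_mul => [|y]; last exact: norm_sin_le1.
by apply: measurable_continuous2; rewrite /dot; cont.
Qed.

Lemma dotBl x y xi : dot (x - y) xi = dot x xi - dot y xi.
Proof. by rewrite /dot /=; ring. Qed.

Lemma continuous_subX x : continuous (fun y : X => x - y).
Proof.
have -> : (fun y : X => x - y) = (fun y : X => (x.1 - y.1, x.2 - y.2)) by [].
by cont.
Qed.

(** For real [F], this and [sin_transform] are the real and imaginary parts of [expi (dot x xi)]
    times the Fourier transform. Keeping the base point [x] inside the kernel lets all later
    computations stay real. *)
Definition cos_transform F x xi : R := \int[leb2]_y (cos (dot (x - y) xi) * F y).
Definition sin_transform F x xi : R := \int[leb2]_y (sin (dot (x - y) xi) * F y).

Lemma fourierE F xi : leb2.-integrable setT (EFin \o F) ->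
  fourier (fun y => (F y)%:C) xi =
  (\int[leb2]_y (cos (dot y xi) * F y)) +i* (- \int[leb2]_y (sin (dot y xi) * F y)).
Proof.
move=> iF; rewrite /fourier /cintegral; congr (_ +i* _).
  by apply: eq_Rintegral => y _; rewrite /expi /= cosN mulr0 subr0.
rewrite -mulN1r -RintegralZl//; last exact: (integrable_sin_mul xi (@continuous_id X) iF).
by apply: eq_Rintegral => y _; rewrite /expi /= sinN; ring.
Qed.

Lemma cos_transformE F x xi : leb2.-integrable setT (EFin \o F) ->
  cos_transform F x xi = cos (dot x xi) * (\int[leb2]_y (cos (dot y xi) * F y)) +
    sin (dot x xi) * (\int[leb2]_y (sin (dot y xi) * F y)).
Proof.
move=> iF.
have ic := integrable_cos_mul xi (@continuous_id X) iF.
have is' := integrable_sin_mul xi (@continuous_id X) iF.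
rewrite -!RintegralZl// -RintegralD//; last 2 first.
- exact: (integrableZl measurableT _ ic).
- exact: (integrableZl measurableT _ is').
by apply: eq_Rintegral => y _; rewrite dotBl cosB; ring.
Qed.

Lemma sin_transformE F x xi : leb2.-integrable setT (EFin \o F) ->
  sin_transform F x xi = sin (dot x xi) * (\int[leb2]_y (cos (dot y xi) * F y)) -
    cos (dot x xi) * (\int[leb2]_y (sin (dot y xi) * F y)).
Proof.
move=> iF.
have ic := integrable_cos_mul xi (@continuous_id X) iF.
have is' := integrable_sin_mul xi (@continuous_id X) iF.
rewrite -!RintegralZl// -RintegralB//; last 2 first.
- exact: (integrableZl measurableT _ ic).
- exact: (integrableZl measurableT _ is').
by apply: eq_Rintegral => y _; rewrite dotBl sinB; ring.
Qed.

Lemma real_complexM (r a b : R) : r%:C * (a +i* b) = (r * a) +i* (r * b).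
Proof. by apply/eqP; rewrite eq_complex /=; apply/andP; split; apply/eqP; ring. Qed.

Lemma inv_fourierE (c : X -> R) F x : leb2.-integrable setT (EFin \o F) ->
  inv_fourier (fun xi => (c xi)%:C * fourier (fun y => (F y)%:C) xi) x =
  ((2 * pi) ^- 2 * \int[leb2]_xi (c xi * cos_transform F x xi)) +i*
  ((2 * pi) ^- 2 * \int[leb2]_xi (c xi * sin_transform F x xi)).
Proof.
move=> iF; rewrite /inv_fourier /cintegral.
have -> : \int[leb2]_xi (complex.Re (expi (dot x xi) *
    ((c xi)%:C * fourier (fun y => (F y)%:C) xi))) =
    \int[leb2]_xi (c xi * cos_transform F x xi).
  by apply: eq_Rintegral => xi _; rewrite fourierE// cos_transformE// /expi /=; ring.
have -> : \int[leb2]_xi (complex.Im (expi (dot x xi) *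
    ((c xi)%:C * fourier (fun y => (F y)%:C) xi))) =
    \int[leb2]_xi (c xi * sin_transform F x xi).
  by apply: eq_Rintegral => xi _; rewrite fourierE// sin_transformE// /expi /=; ring.
exact: real_complexM.
Qed.

(** The reflection of [xi] changes the sign of the sine transform and fixes [c]. Since the cutoff is
    radial, [P_k] of a real function is real. *)
Lemma sin_transform_integral0 (c : X -> R) F x : (forall xi, c (- xi) = c xi) ->
  leb2.-integrable setT (EFin \o c) -> leb2.-integrable setT (EFin \o F) ->
  \int[leb2]_xi (c xi * sin_transform F x xi) = 0.
Proof.
move=> ceven ic iF.
have io := oscillatory_integrable ic iF
  (measurable_sin_dot x) (fun p => norm_sin_le1 _).
have := @Rintegral_affine2 R (0, 0) (-1, -1) _ _ _ io.
rewrite /= !oppr_eq0 !oner_neq0 mulrNN mulr1 normr1 mul1r => /(_ isT isT).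
rewrite -/(sin_transform F x).
have -> : \int[leb2]_x0 (c (affine2 (0, 0) (-1, -1) x0) *
    sin_transform F x (affine2 (0, 0) (-1, -1) x0)) =
    \int[leb2]_xi (- (c xi * sin_transform F x xi)).
  apply: eq_Rintegral => xi _.
  have -> : affine2 (0, 0) (-1, -1) xi = - xi.
    by rewrite /affine2 /affine/= !add0r !mulN1r.
  rewrite ceven -mulrN; congr (_ * _).
  rewrite /sin_transform -mulN1r -RintegralZl//; last first.
    exact: (integrable_sin_mul xi (@continuous_subX x) iF).
  apply: eq_Rintegral => y _.
  have -> : dot (x - y) (- xi) = - dot (x - y) xi by rewrite /dot /=; ring.
  by rewrite sinN; ring.
have -> : \int[leb2]_xi (- (c xi * sin_transform F x xi)) =
    - \int[leb2]_xi (c xi * sin_transform F x xi).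
  by rewrite -mulN1r -RintegralZl//; apply: eq_Rintegral => xi _; rewrite mulN1r.
by move=> E; lra.
Qed.

Definition second_diff eta F y := 2 * F y - F (y + eta) - F (y - eta).

Lemma cos_transform_shift F x xi eta : leb2.-integrable setT (EFin \o F) ->
  cos_transform (fun y => F (y + eta)) x xi = cos_transform F (x + eta) xi.
Proof.
move=> iF; rewrite /cos_transform.
have ic := integrable_cos_mul xi (@continuous_subX (x + eta)) iF.
rewrite -(@Rintegral_affine2 R eta (1, 1) _ _ _ ic)/= ?oner_neq0//.
rewrite mulr1 normr1 mul1r; apply: eq_Rintegral => y _.
have -> : affine2 eta (1, 1) y = y + eta.
  by case: y => y1 y2; rewrite /affine2 /affine/= !mul1r !(addrC eta.1) !(addrC eta.2).
by congr (cos (dot _ xi) * _); rewrite opprD addrACA subrr addr0.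
Qed.

Lemma integrable_shift F eta : leb2.-integrable setT (EFin \o F) ->
  leb2.-integrable setT (EFin \o (fun y => F (y + eta))).
Proof.
move=> iF; have := @integrable_affine2 R eta (1, 1) _ _ _ iF.
rewrite /= oner_neq0 => /(_ isT isT); apply: eq_integrable => // y _ /=.
by case: y => y1 y2; rewrite /affine2 /affine/= !mul1r !(addrC eta.1) !(addrC eta.2).
Qed.

Lemma integrable_second_diff F eta : leb2.-integrable setT (EFin \o F) ->
  leb2.-integrable setT (EFin \o second_diff eta F).
Proof.
move=> iF.
have i2 := integrableZl measurableT 2 iF.
have ip := integrable_shift eta iF; have im := integrable_shift (- eta) iF.
have := integrableB measurableT (integrableB measurableT i2 ip) im.
by apply: eq_integrable.
Qed.

(** The sine terms of the two opposite shifts cancel, so only an even real factor remains. The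
    factors for the two axes add up to [denom]. *)
Lemma cos_transform_second_diff F x xi eta : leb2.-integrable setT (EFin \o F) ->
  cos_transform (second_diff eta F) x xi =
  (2 - 2 * cos (dot eta xi)) * cos_transform F x xi.
Proof.
move=> iF.
have i0 := integrable_cos_mul xi (@continuous_subX x) iF.
have ip := integrable_cos_mul xi (@continuous_subX x) (integrable_shift eta iF).
have im := integrable_cos_mul xi (@continuous_subX x) (integrable_shift (- eta) iF).
have -> : cos_transform (second_diff eta F) x xi =
   2 * cos_transform F x xi - cos_transform (fun y => F (y + eta)) x xi -
   cos_transform (fun y => F (y - eta)) x xi.
  rewrite /cos_transform -RintegralZl// -RintegralB//; last first.
    exact: (integrableZl measurableT 2 i0).
  rewrite -RintegralB//; last first.
    exact: (integrableB measurableT (integrableZl measurableT 2 i0) ip).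
  by apply: eq_Rintegral => y _; rewrite /second_diff; ring.
rewrite !cos_transform_shift// !cos_transformE//.
have -> : dot (x + eta) xi = dot x xi + dot eta xi by rewrite /dot /=; ring.
by rewrite dotBl cosD cosB sinD sinB; ring.
Qed.

End KernelFormula.

(** * Derivatives in one variable and integration by parts against a cosine *)

Section OneVariable.
Context {R : realType}.
Implicit Types (f g : R -> R) (a : R).

Definition deriv_at f a (l : R) := derivable f a 1 /\ derive1 f a = l.

Lemma deriv_at_eq f a k l : deriv_at f a k -> k = l -> deriv_at f a l.
Proof. by move=> ? <-. Qed.

Lemma deriv_at_mul f g a k l : deriv_at f a k -> deriv_at g a l ->
  deriv_at (fun x => f x * g x) a (k * g a + f a * l).
Proof.
by move=> [df <-] [dg <-]; have [d e] := derivable_mul df dg; split.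
Qed.

Lemma deriv_at_cst (c a : R) : deriv_at (fun=> c) a 0.
Proof.
split; first exact: (derivable_cst c).
by rewrite derive1E (derive_cst c).
Qed.

Lemma deriv_at_add f g a k l : deriv_at f a k -> deriv_at g a l ->
  deriv_at (fun x => f x + g x) a (k + l).
Proof.
move=> [df <-] [dg <-].
have E : (fun x => f x + g x) = ((f : R -> R^o) + (g : R -> R^o)) by [].
split; first by rewrite E; exact: (derivableD df dg).
by rewrite E !derive1E (deriveD df dg).
Qed.

Lemma deriv_at_inv f a k : f a != 0 -> deriv_at f a k ->
  deriv_at (fun x => (f x)^-1) a (- (f a)^-1 ^+ 2 * k).
Proof.
move=> fa [df <-].
split; first exact: (derivableV fa df).
rewrite !derive1E (@deriveV R R^o f a 1 fa df) /GRing.scale/= exprVn.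
by rewrite exprnP.
Qed.

Lemma deriv_at_near f g a l : (\forall x \near a, f x = g x) ->
  deriv_at f a l -> deriv_at g a l.
Proof.
move=> nfg [df <-]; split; first exact: (near_eq_derivable nfg df).
by rewrite !derive1E (near_eq_derive _ nfg).
Qed.

Lemma deriv_at_affine (c k a : R) : deriv_at (fun x => k * x + c) a k.
Proof.
have di : deriv_at (fun x : R => x) a 1.
  by split; [exact: derivable_id|rewrite derive1E (@derive_id R R^o)].
have := deriv_at_add (deriv_at_mul (deriv_at_cst k a) di) (deriv_at_cst c a).
by rewrite mul0r add0r mulr1 addr0.
Qed.

Lemma deriv_at_cos (c k a : R) :
  deriv_at (fun x => cos (k * x + c)) a (- k * sin (k * a + c)).
Proof.
have [d1 e1] := deriv_at_affine c k a.
rewrite derive1E in e1.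
have [d2 e2] := @is_derive1_comp R cos (fun x => k * x + c) a _ _
  (is_derive_cos (k * a + c)) (DeriveDef d1 e1).
by split; [exact: d2|rewrite derive1E [LHS]e2; ring].
Qed.

Lemma deriv_at_sin (c k a : R) :
  deriv_at (fun x => sin (k * x + c)) a (k * cos (k * a + c)).
Proof.
have [d1 e1] := deriv_at_affine c k a.
rewrite derive1E in e1.
have [d2 e2] := @is_derive1_comp R sin (fun x => k * x + c) a _ _
  (is_derive_sin (k * a + c)) (DeriveDef d1 e1).
by split; [exact: d2|rewrite derive1E [LHS]e2; ring].
Qed.

Lemma deriv_at_scale (k a : R) f l : deriv_at f a l ->
  deriv_at (fun x => k * f x) a (k * l).
Proof.
move=> df; apply: (deriv_at_eq (deriv_at_mul (deriv_at_cst k a) df)).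
by rewrite mul0r add0r.
Qed.

Lemma deriv_at_cos1 (k a : R) : deriv_at (fun x => k * cos x) a (- k * sin a).
Proof.
have [d e] := is_derive_cos a.
have dc : deriv_at cos a (- sin a) by split; [exact: d|rewrite derive1E].
by apply: (deriv_at_eq (deriv_at_scale k dc)); rewrite mulrN mulNr.
Qed.

Lemma deriv_at_sin1 (k a : R) : deriv_at (fun x => k * sin x) a (k * cos a).
Proof.
have [d e] := is_derive_sin a.
have dc : deriv_at sin a (cos a) by split; [exact: d|rewrite derive1E].
exact: (deriv_at_scale k dc).
Qed.

Lemma itvint_FTC (a b : R) f g : a < b -> continuous f ->
  (forall x, deriv_at g x (f x)) -> itvint a b f = g b - g a.
Proof.
move=> ab cf dg.
have cg : continuous g.
  by move=> x; apply: differentiable_continuous; apply/derivable1_diffP; have [] := dg x.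
rewrite /itvint /Rintegral (@continuous_FTC2 R f g a b ab)//.
- exact: continuous_subspaceT.
- split=> [x _|  |]; first by have [] := dg x.
    exact: (cvg_at_right_filter (cg a)).
  exact: (cvg_at_left_filter (cg b)).
- by move=> x _; have [] := dg x.
Qed.

(** [W] collects the boundary terms of two integrations by parts; it vanishes at both ends because
    [g] and [g1] do. *)
Lemma itvint_cos_by_parts (r c z : R) g g1 g2 : 0 < r ->
  continuous g -> continuous g1 -> continuous g2 ->
  (forall x, deriv_at g x (g1 x)) -> (forall x, deriv_at g1 x (g2 x)) ->
  g r = 0 -> g (- r) = 0 -> g1 r = 0 -> g1 (- r) = 0 ->
  z ^+ 2 * itvint (- r) r (fun a => g a * cos (z * a + c)) =
  - itvint (- r) r (fun a => g2 a * cos (z * a + c)).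
Proof.
move=> r0 cg cg1 cg2 dg dg1 gr gnr g1r g1nr.
have rr : - r < r by lra.
pose W a := z * (g a * sin (z * a + c)) + g1 a * cos (z * a + c).
pose W' a := z ^+ 2 * (g a * cos (z * a + c)) + g2 a * cos (z * a + c).
have dW a : deriv_at W a (W' a).
  have dgs := deriv_at_mul (dg a) (deriv_at_sin c z a).
  have dgc := deriv_at_mul (dg1 a) (deriv_at_cos c z a).
  have := deriv_at_add (deriv_at_mul (deriv_at_cst z a) dgs) dgc.
  by congr (deriv_at _ _ _); rewrite /W'; ring.
have cW' : continuous W' by rewrite /W'; cont.
have := itvint_FTC rr cW' dW.
rewrite /W gr gnr g1r g1nr !mul0r !mulr0 addr0 subrr /W'.
rewrite itvintD; [|by cont|by cont]; rewrite itvintZ; [|by cont].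
by move/eqP; rewrite addr_eq0 => /eqP.
Qed.

End OneVariable.

(** * Functions of class C^n vanishing on an open set *)

Section SmoothClass.
Context {R : realType}.
Local Notation X := (R * R)%type.
Implicit Types (O : set X) (f g : X -> R) (n : nat).

Definition partials f f1 f2 :=
  (forall a b, deriv_at (fun s => f (s, b)) a (f1 (a, b))) /\
  (forall a b, deriv_at (fun s => f (a, s)) b (f2 (a, b))).

(** Class C^n through iterated partial derivatives, all of which are also required to vanish on [O].
    With [O = set0] this is plain C^n. *)
Fixpoint vanishing_Cn O n f : Prop :=
  [/\ continuous f, (forall p, O p -> f p = 0) &
    if n is n'.+1 then exists f1 f2,
      [/\ partials f f1 f2, vanishing_Cn O n' f1 & vanishing_Cn O n' f2]
    else True].

Lemma vanishing_CnW O n f : vanishing_Cn O n.+1 f -> vanishing_Cn O n f.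
Proof.
elim: n f => [|n IH] f [cf f0 [f1 [f2 [pf c1 c2]]]]; split => //.
by exists f1, f2; split => //; exact: IH.
Qed.

Lemma vanishing_Cn_cst n (c : R) : vanishing_Cn set0 n (fun=> c).
Proof.
elim: n c => [|n IH] c; split => //; try by cont.
exists (fun=> 0), (fun=> 0); split; [|exact: IH|exact: IH].
by split=> a b; exact: deriv_at_cst.
Qed.

Lemma vanishing_CnD O n f g : vanishing_Cn O n f -> vanishing_Cn O n g ->
  vanishing_Cn O n (fun p => f p + g p).
Proof.
elim: n f g => [|n IH] f g [cf f0 Hf] [cg g0 Hg]; split; try by cont.
- by move=> p Op; rewrite f0// g0// addr0.
- by move=> p Op; rewrite f0// g0// addr0.
move: Hf Hg => [f1 [f2 [[pf1 pf2] cf1 cf2]]] [g1 [g2 [[pg1 pg2] cg1 cg2]]].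
exists (fun p => f1 p + g1 p), (fun p => f2 p + g2 p); split; [|exact: IH|exact: IH].
by split=> a b; exact: deriv_at_add.
Qed.

Lemma vanishing_CnM O n f g : vanishing_Cn O n f -> vanishing_Cn set0 n g ->
  vanishing_Cn O n (fun p => f p * g p).
Proof.
elim: n f g => [|n IH] f g Hf Hg.
  move: Hf Hg => [cf f0 _] [cg _ _]; split => //; first by cont.
  by move=> p Op; rewrite f0// mul0r.
have Wf := vanishing_CnW Hf; have Wg := vanishing_CnW Hg.
move: Hf Hg => [cf f0 [f1 [f2 [[pf1 pf2] cf1 cf2]]]] [cg _ [g1 [g2 [[pg1 pg2] cg1 cg2]]]].
split; [by cont|by move=> p Op; rewrite f0// mul0r|].
exists (fun p => f1 p * g p + f p * g1 p), (fun p => f2 p * g p + f p * g2 p).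
split; [|by apply: vanishing_CnD; exact: IH|by apply: vanishing_CnD; exact: IH].
by split=> a b; [exact: deriv_at_mul|exact: deriv_at_mul].
Qed.

(** Around a zero of [D] the numerator vanishes identically, so the quotient is locally 0 there, in
    agreement with division by 0 giving 0. Elsewhere the quotient rule expresses the derivative
    through [f1 / D] and [f / D / D], both within reach of the induction. *)
Lemma vanishing_CnV O n f D : open O -> vanishing_Cn O n f ->
  (forall k, vanishing_Cn set0 k D) -> (forall p, D p = 0 -> O p) ->
  vanishing_Cn O n (fun p => f p / D p).
Proof.
move=> oO + HD D0.
have [cD _ _] := HD 0%N.
have cdiv (h : X -> R) : continuous h -> (forall p, O p -> h p = 0) ->
    continuous (fun p => h p / D p).
  move=> ch h0 p; have [Dp|Dp] := eqVneq (D p) 0.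
    have nz : \forall q \near p, 0 = h q / D q.
      apply: filterS (open_nbhs_nbhs (conj oO (D0 _ Dp))) => q Oq.
      by rewrite h0// mul0r.
    have hp : h p / D p = 0 by rewrite (h0 _ (D0 _ Dp)) mul0r.
    rewrite /continuous_at hp.
    exact: (cvg_trans (near_eq_cvg nz) (cvg_cst 0)).
  by apply: cvgM; [exact: ch|apply: cvgV => //; exact: cD].
have line1 p : O p -> \forall s \near p.1, O (s, p.2).
  move=> Op; have c1 : continuous (fun s : R => (s, p.2)) by cont.
  by apply: c1; rewrite -surjective_pairing; exact: open_nbhs_nbhs.
have line2 p : O p -> \forall s \near p.2, O (p.1, s).
  move=> Op; have c2 : continuous (fun s : R => (p.1, s)) by cont.
  by apply: c2; rewrite -surjective_pairing; exact: open_nbhs_nbhs.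
elim: n f => [|n IHn] f Hf.
  move: Hf => [cf f0 _]; split => //; first exact: cdiv.
  by move=> p Op; rewrite f0// mul0r.
have Wf := vanishing_CnW Hf.
move: Hf => [cf f0 [f1 [f2 [[pf1 pf2] cf1 cf2]]]].
have [_ _ [D1 [D2 [[pD1 pD2] cD1 cD2]]]] := HD n.+1.
split; [exact: cdiv|by move=> p Op; rewrite f0// mul0r|].
pose q Di p := -1 * (f p / D p / D p * Di p).
exists (fun p => f1 p / D p + q D1 p), (fun p => f2 p / D p + q D2 p).
have Hq Di : vanishing_Cn set0 n Di -> vanishing_Cn O n (q Di).
  move=> HDi; rewrite /q.
  have -> : (fun p => -1 * (f p / D p / D p * Di p)) = (fun p => (f p / D p / D p * Di p) * -1).
    by apply/funext => p; rewrite mulrC.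
  by apply: vanishing_CnM; [apply: vanishing_CnM => //; apply: (IHn); exact: IHn|exact: vanishing_Cn_cst].
split; [split=> a b|apply: vanishing_CnD; [exact: IHn|exact: Hq]|
        apply: vanishing_CnD; [exact: IHn|exact: Hq]].
- have [Dp|Dp] := eqVneq (D (a, b)) 0.
    (* At a zero of [D] the formula for the derivative also takes the default value 0, which is the
       true derivative of a locally zero function. *)
    have E0 : 0 = f1 (a, b) / D (a, b) + q D1 (a, b).
      by rewrite /q Dp invr0 !mulr0 !mul0r mulr0 addr0.
    apply: deriv_at_eq E0.
    apply: (@deriv_at_near _ (fun=> 0)); last exact: deriv_at_cst.
    by apply: filterS (line1 _ (D0 _ Dp)) => s /= Os; rewrite f0// mul0r.
  have := deriv_at_mul (pf1 a b) (deriv_at_inv Dp (pD1 a b)).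
  by congr (deriv_at _ _ _); rewrite /q /=; field.
- have [Dp|Dp] := eqVneq (D (a, b)) 0.
    have E0 : 0 = f2 (a, b) / D (a, b) + q D2 (a, b).
      by rewrite /q Dp invr0 !mulr0 !mul0r mulr0 addr0.
    apply: deriv_at_eq E0.
    apply: (@deriv_at_near _ (fun=> 0)); last exact: deriv_at_cst.
    by apply: filterS (line2 _ (D0 _ Dp)) => s /= Os; rewrite f0// mul0r.
  have := deriv_at_mul (pf2 a b) (deriv_at_inv Dp (pD2 a b)).
  by congr (deriv_at _ _ _); rewrite /q /=; field.
Qed.

Lemma vanishing_Cn_trig1 n :
  (forall k, vanishing_Cn set0 n (fun p : X => k * cos p.1)) /\
  (forall k, vanishing_Cn set0 n (fun p : X => k * sin p.1)).
Proof.
elim: n => [|n [IHc IHs]]; split=> k; split => //; try by cont.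
- exists (fun p : X => - k * sin p.1), (fun=> 0).
  split; [|exact: IHs|exact: vanishing_Cn_cst].
  by split=> a b; [exact (deriv_at_cos1 k a)|exact (deriv_at_cst (k * cos a) b)].
- exists (fun p : X => k * cos p.1), (fun=> 0).
  split; [|exact: IHc|exact: vanishing_Cn_cst].
  by split=> a b; [exact (deriv_at_sin1 k a)|exact (deriv_at_cst (k * sin a) b)].
Qed.

Lemma vanishing_Cn_trig2 n :
  (forall k, vanishing_Cn set0 n (fun p : X => k * cos p.2)) /\
  (forall k, vanishing_Cn set0 n (fun p : X => k * sin p.2)).
Proof.
elim: n => [|n [IHc IHs]]; split=> k; split => //; try by cont.
- exists (fun=> 0), (fun p : X => - k * sin p.2).
  split; [|exact: vanishing_Cn_cst|exact: IHs].
  by split=> a b; [exact (deriv_at_cst (k * cos b) a)|exact (deriv_at_cos1 k b)].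
- exists (fun=> 0), (fun p : X => k * cos p.2).
  split; [|exact: vanishing_Cn_cst|exact: IHc].
  by split=> a b; [exact (deriv_at_cst (k * sin b) a)|exact (deriv_at_sin1 k b)].
Qed.

End SmoothClass.

(** * Decay of oscillatory integrals *)

Section KernelDecay.
Context {R : realType}.
Local Notation leb2 := (@plane_measure R).
Local Notation X := (R * R)%type.
Implicit Types (f m : X -> R) (z : X).

(** Cosine transform over a square of half side 3, large enough to contain the annulus of the cutoff
    in its interior. *)
Definition osc m z := box_int 3 (fun p => m p * cos (dot z p)).

(** The weakest convenient integrable decay: a product of one-dimensional profiles, each reached by
    two integrations by parts in its variable. *)
Definition weight z : R := (1 + z.1 ^+ 2)^-1 * (1 + z.2 ^+ 2)^-1.

Lemma one_sqr_gt0 (a : R) : 0 < 1 + a ^+ 2.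
Proof. by rewrite ltr_pwDl// sqr_ge0. Qed.

Lemma weight_gt0 z : 0 < weight z.
Proof. by rewrite mulr_gt0// invr_gt0 one_sqr_gt0. Qed.

Lemma continuous_inv_one_sqr (T : topologicalType) (g : T -> R) :
  continuous g -> continuous (fun t => (1 + g t ^+ 2)^-1).
Proof.
move=> cg t; apply: cvgV; first by rewrite gt_eqF// one_sqr_gt0.
have c1 : continuous (fun t => 1 + g t ^+ 2) by cont.
exact: c1.
Qed.

Lemma continuous_weight : continuous weight.
Proof.
have c1 : continuous (fun z : X => z.1) by cont.
have c2 : continuous (fun z : X => z.2) by cont.
exact: (continuous_funM (continuous_inv_one_sqr c1) (continuous_inv_one_sqr c2)).
Qed.

Lemma osc_swap f z : continuous f ->
  osc f z = itvint (- 3) 3 (fun b => itvint (- 3) 3 (fun a =>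
    f (a, b) * cos (z.1 * a + z.2 * b))).
Proof.
move=> cf; rewrite /osc /box_int.
have r3 : (- 3 : R) <= 3 by lra.
have cF : continuous (fun p : X => f p * cos (dot z p)) by rewrite /dot; cont.
by rewrite (itvint_swap r3 r3 cF).
Qed.

Lemma continuous_osc_inner2 f z : continuous f ->
  continuous (fun b => itvint (- 3) 3 (fun a => f (a, b) * cos (z.1 * a + z.2 * b))).
Proof.
move=> cf; have r3 : (- 3 : R) <= 3 by lra.
have cF : continuous (fun q : R * R => f (q.2, q.1) * cos (z.1 * q.2 + z.2 * q.1)) by cont.
exact: (continuous_itvint r3 cF).
Qed.

Lemma continuous_osc_inner1 f z : continuous f ->
  continuous (fun a => itvint (- 3) 3 (fun b => f (a, b) * cos (z.1 * a + z.2 * b))).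
Proof.
move=> cf; have r3 : (- 3 : R) <= 3 by lra.
have cF : continuous (fun q : R * R => f q * cos (z.1 * q.1 + z.2 * q.2)) by cont.
exact: (continuous_itvint r3 cF).
Qed.

Lemma vanishing_Cn_continuous (O : set X) n f : vanishing_Cn O n f -> continuous f.
Proof. by case: n => [|n] []. Qed.

Lemma osc_by_parts1 (O : set X) n f : (forall p, 3 <= `|p.1| -> O p) ->
  vanishing_Cn O n.+2 f ->
  exists2 g, vanishing_Cn O n g & forall z, z.1 ^+ 2 * osc f z = - osc g z.
Proof.
move=> O3 [cf f0 [f1 [f2 [[pf1 _] [cf1 f10 [f11 [f12 [[pf11 _] Hf11 _]]]] _]]]].
have cf11 := vanishing_Cn_continuous Hf11.
exists f11 => // z; rewrite !osc_swap// -itvintZ; last exact: continuous_osc_inner2.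
rewrite -itvintN; last exact: continuous_osc_inner2.
have O1 b : O (3, b) by apply: O3; rewrite /= ger0_norm.
have O2 b : O (- 3, b) by apply: O3; rewrite /= normrN ger0_norm.
apply: eq_itvint => b _.
apply: (@itvint_cos_by_parts _ 3 (z.2 * b) z.1 (fun a => f (a, b))
  (fun a => f1 (a, b)) (fun a => f11 (a, b))) => //; try by cont.
- exact: f0.
- exact: f0.
- exact: f10.
- exact: f10.
Qed.

Lemma osc_by_parts2 (O : set X) n f : (forall p, 3 <= `|p.2| -> O p) ->
  vanishing_Cn O n.+2 f ->
  exists2 g, vanishing_Cn O n g & forall z, z.2 ^+ 2 * osc f z = - osc g z.
Proof.
move=> O3 [cf f0 [f1 [f2 [[_ pf2] _ [cf2 f20 [f21 [f22 [[_ pf22] _ Hf22]]]]]]]].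
have cf22 := vanishing_Cn_continuous Hf22.
exists f22 => // z; rewrite /osc /box_int -itvintZ; last exact: continuous_osc_inner1.
rewrite -itvintN; last exact: continuous_osc_inner1.
have O1 a : O (a, 3) by apply: O3; rewrite /= ger0_norm.
have O2 a : O (a, - 3) by apply: O3; rewrite /= normrN ger0_norm.
apply: eq_itvint => a _.
have := @itvint_cos_by_parts _ 3 (z.1 * a) z.2 (fun b => f (a, b))
  (fun b => f2 (a, b)) (fun b => f22 (a, b)).
have E (h : X -> R) : itvint (- 3) 3 (fun b => h (a, b) * cos (z.2 * b + z.1 * a)) =
    itvint (- 3) 3 (fun b => h (a, b) * cos (dot z (a, b))).
  by apply: eq_itvint => b _; rewrite /dot /= addrC.
rewrite !E; apply => //; try by cont.
- exact: f0.
- exact: f0.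
- exact: f20.
- exact: f20.
Qed.

Lemma osc_bounded f : continuous f -> exists2 K, 0 <= K & forall z, `|osc f z| <= K.
Proof.
move=> cf; have [K HK] := continuous_rect_bounded (- 3) 3 (- 3) 3 cf.
have K0 : 0 <= K.
  apply: le_trans (HK 0 0 _ _); first exact: normr_ge0.
    by apply/andP; split; lra.
  by apply/andP; split; lra.
have r3 : (- 3 : R) <= 3 by lra.
exists ((3 - - 3) * ((3 - - 3) * K)); first by rewrite !mulr_ge0//; lra.
move=> z; rewrite /osc /box_int; apply: norm_itvint_le => //.
  exact: continuous_osc_inner1.
move=> a a3; apply: norm_itvint_le => //; first by rewrite /dot; cont.
move=> b b3; rewrite normrM; apply: (@le_trans _ _ `|f (a, b)|).
  by rewrite ler_piMr// norm_cos_le1.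
exact: HK.
Qed.

(** Multiplied by both polynomial factors, [osc f] becomes four terms, each up to sign the
    oscillatory integral of a derivative of [f] and hence bounded. The mixed term uses all four
    derivatives. *)
Lemma osc_decay (O : set X) f :
  (forall p, 3 <= `|p.1| -> O p) -> (forall p, 3 <= `|p.2| -> O p) ->
  vanishing_Cn O 4 f ->
  exists2 K, 0 <= K & forall z, `|osc f z| <= K * weight z.
Proof.
move=> O1 O2 Hf; have Hf3 := vanishing_CnW (vanishing_CnW Hf).
have [g1 Hg1 E1] := osc_by_parts1 O1 Hf.
have [g2 Hg2 E2] := osc_by_parts2 O2 Hf3.
have [g12 Hg12 E12] := osc_by_parts2 O2 Hg1.
have [K0 K00 HK0] := osc_bounded (vanishing_Cn_continuous Hf).
have [K1 K10 HK1] := osc_bounded (vanishing_Cn_continuous Hg1).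
have [K2 K20 HK2] := osc_bounded (vanishing_Cn_continuous Hg2).
have [K3 K30 HK3] := osc_bounded (vanishing_Cn_continuous Hg12).
exists (K0 + K1 + K2 + K3); first by rewrite !addr_ge0.
move=> z; rewrite /weight mulrA ler_pdivlMr ?one_sqr_gt0// ler_pdivlMr ?one_sqr_gt0//.
rewrite -[X in _ * X * _](ger0_norm (ltW (one_sqr_gt0 _))).
rewrite -[X in _ * X <= _](ger0_norm (ltW (one_sqr_gt0 _))) -!normrM.
have -> : osc f z * (1 + z.2 ^+ 2) * (1 + z.1 ^+ 2) =
    osc f z + - osc g1 z + - osc g2 z + osc g12 z.
  have e1 := E1 z; have e2 := E2 z; have e12 := E12 z.
  have -> : osc g12 z = z.2 ^+ 2 * (z.1 ^+ 2 * osc f z) by rewrite e1 mulrN e12 opprK.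
  by rewrite -e1 -e2; generalize (osc f z) => A; ring.
apply: (le_trans (ler_normD _ _)); apply: lerD => //.
apply: (le_trans (ler_normD _ _)); apply: lerD; last by rewrite normrN.
by apply: (le_trans (ler_normD _ _)); apply: lerD; last by rewrite normrN.
Qed.

Lemma continuous_osc f : continuous f -> continuous (osc f).
Proof.
move=> cf; have r3 : (- 3 : R) <= 3 by lra.
have c1 : continuous (fun q : (X * R) * R =>
    f (q.1.2, q.2) * cos (dot q.1.1 (q.1.2, q.2))) by rewrite /dot; cont.
have c2 := continuous_itvint r3 c1.
exact: (continuous_itvint r3 c2).
Qed.

End KernelDecay.

(** * The cutoff divided by the symbol of the discrete Laplacian *)

Section Multiplier.
Context {R : realType} (chi : plane R -> R).
Hypothesis hchi : LP_cutoff chi.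
Local Notation leb2 := (@plane_measure R).
Local Notation X := (R * R)%type.

Definition off_annulus : set X :=
  [set p | dot p p < 4^-1] `|` [set p | 4 < dot p p].

Lemma open_off_annulus : open off_annulus.
Proof.
have cd : continuous (fun p : X => dot p p) by rewrite /dot; cont.
apply: openU.
  rewrite (_ : mkset _ = (fun p : X => dot p p) @^-1` [set t | t < 4^-1])//.
  by apply: open_comp; [move=> p _; exact: cd|exact: open_lt].
rewrite (_ : mkset _ = (fun p : X => dot p p) @^-1` [set t | 4 < t])//.
by apply: open_comp; [move=> p _; exact: cd|exact: open_gt].
Qed.

Lemma dot_ge0 (p : X) : 0 <= dot p p.
Proof. by rewrite /dot addr_ge0// -expr2 sqr_ge0. Qed.

Lemma chi_off_annulus (p : X) : off_annulus p -> chi p = 0.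
Proof.
move=> Op; apply/eqP; apply/negPn/negP => cp.
case: hchi => _ _ /(_ p cp) /andP[h1 h2] _.
have e0 : 0 <= enorm p by exact: sqrtr_ge0.
have E : enorm p ^+ 2 = dot p p by rewrite sqr_sqrtr// dot_ge0.
case: Op; rewrite /= -E => h; nra.
Qed.

(** Directional derivatives along the two axes are the partial derivatives. Each is continuous as
    the restriction of its continuous extension, and the derivative of a locally zero function is
    zero. *)
Lemma iter_derive_vanishing n (s : seq (plane R)) :
  vanishing_Cn off_annulus n (iter_derive s (chi : plane R -> R^o) : X -> R).
Proof.
case: hchi => -[cchi dchi uchi] _ _ _.
have zero t p : off_annulus p -> iter_derive t (chi : plane R -> R^o) p = 0.
  elim: t p => [|v t IH] p Op; first exact: chi_off_annulus.
  have nz : \forall q \near (p : plane R), (cst 0 : plane R -> R^o) q =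
      iter_derive t (chi : plane R -> R^o) q.
    by apply: filterS (open_nbhs_nbhs (conj open_off_annulus Op)) => q /IH ->.
  by rewrite /= -(near_eq_derive _ nz) derive_cst.
have ct t : continuous (iter_derive t (chi : plane R -> R^o) : X -> R).
  have [u cu eu] := uchi t.
  have cu' : continuous u by apply/continuous_subspace_setT.
  have -> : iter_derive t (chi : plane R -> R^o) = u.
    by apply/funext => p; apply: eu; rewrite interiorT.
  exact: cu'.
elim: n s => [|n IH] s; split => //; try exact: ct; try exact: zero.
exists (iter_derive ((1, 0) :: s) (chi : plane R -> R^o)),
  (iter_derive ((0, 1) :: s) (chi : plane R -> R^o)).
split; [|exact: IH|exact: IH].
set f := iter_derive s _.
split=> a b.
  have df : derivable f (a, b) (1, 0) by apply: dchi; rewrite interiorT.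
  have E : (fun h : R => h^-1 *: ((f \o shift ((a, b) : plane R)) (h *: ((1, 0) : plane R)) - f (a, b))) =
     (fun h : R => h^-1 *: (((fun r => f (r, b)) \o shift a) (h *: (1 : R^o)) - f (a, b))).
    apply/funext => h; congr (_ *: (_ - _)); rewrite /= /shift /=; congr f.
    by rewrite -[LHS]/(h *: (1 : R^o) + a, h *: (0 : R^o) + b) scaler0 add0r.
  split; first by move: df; rewrite /derivable E.
  by rewrite derive1E /iter_derive /= /derive E.
have df : derivable f (a, b) (0, 1) by apply: dchi; rewrite interiorT.
have E : (fun h : R => h^-1 *: ((f \o shift ((a, b) : plane R)) (h *: ((0, 1) : plane R)) - f (a, b))) =
   (fun h : R => h^-1 *: (((fun r => f (a, r)) \o shift b) (h *: (1 : R^o)) - f (a, b))).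
  apply/funext => h; congr (_ *: (_ - _)); rewrite /= /shift /=; congr f.
  by rewrite -[LHS]/(h *: (0 : R^o) + a, h *: (1 : R^o) + b) scaler0 add0r.
split; first by move: df; rewrite /derivable E.
by rewrite derive1E /iter_derive /= /derive E.
Qed.

Definition denom (p : X) : R := 4 + -2 * cos p.1 + -2 * cos p.2.

Lemma vanishing_Cn_denom k : vanishing_Cn set0 k denom.
Proof.
apply: vanishing_CnD; last by have [] := @vanishing_Cn_trig2 R k.
apply: vanishing_CnD; last by have [] := @vanishing_Cn_trig1 R k.
exact: vanishing_Cn_cst.
Qed.

Lemma cos_eq1_small (a : R) : `|a| <= 2 -> cos a = 1 -> a = 0.
Proof.
move=> a2 ca; apply/eqP; rewrite -normr_eq0; apply/eqP.
have ca' : cos `|a| = cos 0.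
  by rewrite cos0; have [a0|a0] := lerP 0 a; rewrite ?(ger0_norm a0) ?(ltr0_norm a0) ?cosN.
apply: cos_inj ca'; rewrite in_itv/= ?lexx ?pi_ge0 ?normr_ge0//=.
exact: le_trans a2 (pi_ge2 R).
Qed.

(** Both cosines must equal 1. In the disc of radius 2, and [2 <= pi], this leaves only the origin,
    which lies inside the hole of the annulus. *)
Lemma denom_eq0 (p : X) : denom p = 0 -> off_annulus p.
Proof.
rewrite /denom => D0.
have c1 := cos_le1 p.1; have c2 := cos_le1 p.2.
have e1 : cos p.1 = 1 by lra.
have e2 : cos p.2 = 1 by lra.
have [h|h] := ltP 4 (dot p p); first by right.
left; rewrite /=.
have p1 : `|p.1| <= 2.
  rewrite -(@ler_pXn2r _ 2)// ?nnegrE// real_normK ?num_real//.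
  by move: h; rewrite /dot -!expr2; have := sqr_ge0 p.2; lra.
have p2 : `|p.2| <= 2.
  rewrite -(@ler_pXn2r _ 2)// ?nnegrE// real_normK ?num_real//.
  by move: h; rewrite /dot -!expr2; have := sqr_ge0 p.1; lra.
by rewrite /dot (cos_eq1_small p1 e1) (cos_eq1_small p2 e2) !mul0r addr0.
Qed.

(* [denom] is the symbol of the discrete Laplacian; [chi] vanishes near all its
   zeros, where the quotient is the junk value 0. *)
Definition multiplier (p : X) : R := chi p / denom p.

Lemma vanishing_Cn_multiplier n : vanishing_Cn off_annulus n multiplier.
Proof.
apply: vanishing_CnV => //; [exact: open_off_annulus|exact: (iter_derive_vanishing n [::])|
  exact: vanishing_Cn_denom|exact: denom_eq0].
Qed.

Lemma multiplierM (p : X) : multiplier p * denom p = chi p.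
Proof.
rewrite /multiplier; have [D0|D0] := eqVneq (denom p) 0; last by rewrite divfK.
by rewrite D0 mulr0 chi_off_annulus//; exact: denom_eq0.
Qed.

Lemma off_annulus1 (p : X) : 3 <= `|p.1| -> off_annulus p.
Proof.
move=> p3; right; rewrite /= /dot -!expr2.
by have := sqr_ge0 p.2; rewrite -(real_normK (num_real p.1)); nra.
Qed.

Lemma off_annulus2 (p : X) : 3 <= `|p.2| -> off_annulus p.
Proof.
move=> p3; right; rewrite /= /dot -!expr2.
by have := sqr_ge0 p.1; rewrite -(real_normK (num_real p.2)); nra.
Qed.

End Multiplier.

(** * Young inequalities for dominated kernels *)

Section Young.
Context {R : realType}.
Local Notation leb := (@lebesgue_measure R).
Local Notation leb2 := (@plane_measure R).
Local Notation X := (R * R)%type.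
Implicit Types (F G M W p q : X -> R) (x y : X).

Lemma measurable_subX : measurable_fun setT (fun u : X * X => u.1 - u.2).
Proof.
have m11 : measurable_fun setT (fun p : X * X => p.1.1).
  exact: (measurableT_comp (@measurable_fst _ _ _ _) (@measurable_fst _ _ _ _)).
have m12 : measurable_fun setT (fun p : X * X => p.1.2).
  exact: (measurableT_comp (@measurable_snd _ _ _ _) (@measurable_fst _ _ _ _)).
have m21 : measurable_fun setT (fun p : X * X => p.2.1).
  exact: (measurableT_comp (@measurable_fst _ _ _ _) (@measurable_snd _ _ _ _)).
have m22 : measurable_fun setT (fun p : X * X => p.2.2).
  exact: (measurableT_comp (@measurable_snd _ _ _ _) (@measurable_snd _ _ _ _)).
exact: (measurable_fun_pair (measurable_funB m11 m21) (measurable_funB m12 m22)).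
Qed.

Lemma measurable_conv p q : measurable_fun setT p -> measurable_fun setT q ->
  measurable_fun setT (fun u : X * X => p u.2 * q (u.1 - u.2)).
Proof.
move=> mp mq; apply: measurable_funM.
  exact: (measurableT_comp mp (@measurable_snd _ _ _ _)).
exact: (measurableT_comp mq measurable_subX).
Qed.

Lemma measurable_sub_left x q : measurable_fun setT q ->
  measurable_fun setT (fun y => q (x - y)).
Proof.
move=> mq; exact: (measurableT_comp mq (measurableT_comp measurable_subX (pair1_measurable x))).
Qed.

Lemma conv_tonelli p q : measurable_fun setT p -> measurable_fun setT q ->
  (forall y, 0 <= p y) -> (forall y, 0 <= q y) ->
  (\int[leb2]_x \int[leb2]_y (p y * q (x - y))%:E =
   (\int[leb2]_y (p y)%:E) * (\int[leb2]_y (q y)%:E))%E.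
Proof.
move=> mp mq p0 q0.
have mpq : measurable_fun setT (fun u : X * X => (p u.2 * q (u.1 - u.2))%:E).
  by apply/measurable_EFinP; exact: measurable_conv.
have pq0 (u : X * X) : (0 <= (p u.2 * q (u.1 - u.2))%:E)%E by rewrite lee_fin mulr_ge0.
have -> := fubini_tonelli (m1 := leb2) (m2 := leb2) _ mpq pq0.
have Q0 : (0 <= \int[leb2]_y (q y)%:E)%E by exact: integral_EFin_ge0.
have mpe : measurable_fun setT (EFin \o p) by exact/measurable_EFinP.
have pe0 y : setT y -> (0 <= (EFin \o p) y)%E by move=> _; rewrite lee_fin.
rewrite -(ge0_integralZr leb2 measurableT mpe pe0 Q0).
apply: eq_integral => y _ /=.
rewrite integral_EFinZl//; last first.
  exact: (measurableT_comp mq (measurableT_comp measurable_subX (pair2_measurable y))).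
  congr (_ * _)%E; rewrite -[RHS](integral_shift (- y))//.
  exact/measurable_EFinP.
Qed.

Lemma measurable_Rintegral_snd (H : X * X -> R) : measurable_fun setT H ->
  measurable_fun setT (fun x => \int[leb2]_y H (x, y)).
Proof.
move=> mH; have mHe : measurable_fun setT (EFin \o H) by exact/measurable_EFinP.
rewrite /Rintegral; apply: (measurableT_comp (fine_measurable measurableT)).
have -> : (fun x => \int[leb2]_y (H (x, y))%:E)%E =
    ((fun x => \int[leb2]_y ((EFin \o H)^\+ (x, y)))%E \-
     (fun x => \int[leb2]_y ((EFin \o H)^\- (x, y)))%E)%E.
  apply/funext => x; rewrite integralE; congr (_ - _)%E.
    by apply: eq_integral => y _; rewrite !funeposE.
  by apply: eq_integral => y _; rewrite !funenegE.
apply: emeasurable_funB.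
  exact: (measurable_fun_fubini_tonelli_F (m2 := leb2) _
    (measurable_funepos mHe) (fun u => funepos_ge0 _ u)).
exact: (measurable_fun_fubini_tonelli_F (m2 := leb2) _
    (measurable_funeneg mHe) (fun u => funeneg_ge0 _ u)).
Qed.

Definition conv G M x := \int[leb2]_y (G y * M (x - y)).

Lemma measurable_convolution G M : measurable_fun setT G -> measurable_fun setT M ->
  measurable_fun setT (conv G M).
Proof. by move=> mG mM; exact: (measurable_Rintegral_snd (measurable_conv mG mM)). Qed.

(** No integrability is assumed: an infinite right side is trivial, and a finite one makes the
    convolution absolutely convergent. *)
Lemma conv_norm_le G M W x : measurable_fun setT G -> measurable_fun setT M ->
  measurable_fun setT W -> (forall z, `|M z| <= W z) ->
  (`|conv G M x|%:E <= \int[leb2]_y `|G y * W (x - y)|%:E)%E.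
Proof.
move=> mG mM mW MW.
have mGM : measurable_fun setT (fun y => G y * M (x - y)).
  by apply: measurable_funM => //; exact: measurable_sub_left.
have mGW : measurable_fun setT (fun y => G y * W (x - y)).
  by apply: measurable_funM => //; exact: measurable_sub_left.
have le1 : (\int[leb2]_y `|G y * M (x - y)|%:E <= \int[leb2]_y `|G y * W (x - y)|%:E)%E.
  apply: (@le_integral_EFin _ _ R leb2 (fun y => `|G y * M (x - y)|)).
  - exact: measurableT_comp.
  - exact: measurableT_comp.
  - by move=> y; exact: normr_ge0.
  move=> y; rewrite !normrM ler_wpM2l//.
  by apply: le_trans (MW _) (ler_norm _).
have [E|E] := eqVneq (\int[leb2]_y `|G y * W (x - y)|%:E)%E +oo%E.
  by rewrite E leey.
have fin : (\int[leb2]_y `|G y * M (x - y)|%:E < +oo)%E.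
  by apply: le_lt_trans le1 _; rewrite ltey.
have im : leb2.-integrable setT (EFin \o (fun y => G y * M (x - y))).
  by apply/integrableP; split; [exact/measurable_EFinP|exact: fin].
apply: le_trans le1; rewrite /conv EFin_normr_Rintegral//.
have := le_abse_integral leb2 measurableT (measurable_int _ im).
exact.
Qed.

(** The free splitting into [s] and [r] serves both inequalities below: the weight [r] is the kernel
    in one and the function in the other. *)
Lemma conv_sqr_le (s r : X -> R) (G M W : X -> R) x (c : R) :
  measurable_fun setT G -> measurable_fun setT M ->
  measurable_fun setT W -> (forall z, `|M z| <= W z) ->
  measurable_fun setT s -> measurable_fun setT r -> (forall y, 0 <= r y) ->
  0 < c -> (\int[leb2]_y (r y)%:E <= c%:E)%E ->
  (forall y, `|G y * W (x - y)| = `|s y * r y|) ->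
  ((conv G M x ^+ 2)%:E <= c%:E * \int[leb2]_y (s y ^+ 2 * r y)%:E)%E.
Proof.
move=> mG mM mW MW ms mr r0 c0 rc E.
have := weighted_cauchy_schwarz (mu := leb2) ms mr r0 c0 rc; apply: le_trans.
have := conv_norm_le x mG mM mW MW.
have -> : (\int[leb2]_y `|G y * W (x - y)|%:E = \int[leb2]_y `|s y * r y|%:E)%E.
  by apply: eq_integral => y _; rewrite E.
have I0 : (0 <= \int[leb2]_y `|s y * r y|%:E)%E by exact: integral_EFin_ge0.
move: I0; case: (\int[leb2]_y `|s y * r y|%:E)%E => [i| |] // i0 H.
  rewrite lee_fin in i0; rewrite lee_fin in H.
  rewrite -EFin_expe lee_fin -(real_normK (num_real (conv G M x))).
  by rewrite lerXn2r ?nnegrE.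
by rewrite leey.
Qed.

(** Used when differences of [F] are controlled in L^2; the bound does not depend on the scale,
    since dilation preserves the L^1 norm of the kernel. *)
Lemma young_L1_kernel G M W (w A : R) : measurable_fun setT G ->
  measurable_fun setT M -> measurable_fun setT W -> (forall z, `|M z| <= W z) ->
  0 < w -> (\int[leb2]_x (W x)%:E <= w%:E)%E ->
  (\int[leb2]_x (G x ^+ 2)%:E <= A%:E)%E ->
  (\int[leb2]_x (conv G M x ^+ 2)%:E <= (w ^+ 2 * A)%:E)%E.
Proof.
move=> mG mM mW MW w0 Ww GA.
have W0 z : 0 <= W z by exact: le_trans (normr_ge0 _) (MW z).
have mG2 : measurable_fun setT (fun y => G y ^+ 2) by exact: measurable_funX.
have mH := measurable_conv mG2 mW.
pose H (u : X * X) := G u.2 ^+ 2 * W (u.1 - u.2).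
have mHe : measurable_fun setT (EFin \o H) by exact/measurable_EFinP.
have H0 u : (0 <= (EFin \o H) u)%E by rewrite lee_fin mulr_ge0// sqr_ge0.
have mU := measurable_fun_fubini_tonelli_F (m2 := leb2) _ mHe H0.
have U0 x : setT x -> (0 <= \int[leb2]_y (G y ^+ 2 * W (x - y))%:E)%E.
  by move=> _; apply: integral_EFin_ge0 => y; rewrite mulr_ge0// sqr_ge0.
apply: (@le_trans _ _ (\int[leb2]_x (w%:E * \int[leb2]_y (G y ^+ 2 * W (x - y))%:E))%E).
  apply: ge0_le_integral => //.
  - by move=> x _; rewrite lee_fin sqr_ge0.
  - by apply/measurable_EFinP; apply: measurable_funX; exact: (measurable_convolution mG mM).
  - exact: (emeasurable_funM (measurable_cst _) mU).
  move=> x _; apply: (@conv_sqr_le G (fun y => W (x - y)) G M W) => //.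
  - exact: measurable_sub_left.
  - by rewrite (integral_reflect x (f := fun z => (W z)%:E))//; exact/measurable_EFinP.
rewrite (ge0_integralZl leb2 measurableT mU U0); last by rewrite lee_fin ltW.
rewrite [X in (_ * X)%E](conv_tonelli mG2 mW (fun y => sqr_ge0 _) W0).
rewrite expr2 -mulrA EFinM (mulrC w) EFinM.
apply: lee_wpmul2l; first by rewrite lee_fin ltW.
apply: lee_pmul => //.
- by apply: integral_EFin_ge0 => y; exact: sqr_ge0.
- exact: integral_EFin_ge0.
Qed.

(** Used when [F] is controlled only in L^1; the L^2 norm of the dilated kernel is the origin of the
    factor 2^k. *)
Lemma young_L2_kernel G M W (a B : R) : measurable_fun setT G ->
  measurable_fun setT M -> measurable_fun setT W -> (forall z, `|M z| <= W z) ->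
  0 < a -> (\int[leb2]_x `|G x|%:E <= a%:E)%E ->
  (\int[leb2]_x (W x ^+ 2)%:E <= B%:E)%E ->
  (\int[leb2]_x (conv G M x ^+ 2)%:E <= (a ^+ 2 * B)%:E)%E.
Proof.
move=> mG mM mW MW a0 Ga WB.
have W0 z : 0 <= W z by exact: le_trans (normr_ge0 _) (MW z).
have mGn : measurable_fun setT (fun y => `|G y|) by exact: measurableT_comp.
have mW2 : measurable_fun setT (fun y => W y ^+ 2) by exact: measurable_funX.
have mH := measurable_conv mGn mW2.
pose H (u : X * X) := `|G u.2| * W (u.1 - u.2) ^+ 2.
have mHe : measurable_fun setT (EFin \o H) by exact/measurable_EFinP.
have H0 u : (0 <= (EFin \o H) u)%E by rewrite lee_fin mulr_ge0// sqr_ge0.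
have mU := measurable_fun_fubini_tonelli_F (m2 := leb2) _ mHe H0.
have U0 x : setT x -> (0 <= \int[leb2]_y (`|G y| * W (x - y) ^+ 2)%:E)%E.
  by move=> _; apply: integral_EFin_ge0 => y; rewrite mulr_ge0// sqr_ge0.
apply: (@le_trans _ _ (\int[leb2]_x (a%:E * \int[leb2]_y (`|G y| * W (x - y) ^+ 2)%:E))%E).
  apply: ge0_le_integral => //.
  - by move=> x _; rewrite lee_fin sqr_ge0.
  - by apply/measurable_EFinP; apply: measurable_funX; exact: (measurable_convolution mG mM).
  - exact: (emeasurable_funM (measurable_cst _) mU).
  move=> x _.
  have -> : (\int[leb2]_y (`|G y| * W (x - y) ^+ 2)%:E =
      \int[leb2]_y (W (x - y) ^+ 2 * `|G y|)%:E)%E.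
    by apply: eq_integral => y _; rewrite mulrC.
  apply: (@conv_sqr_le (fun y => W (x - y)) (fun y => `|G y|) G M W) => //.
  - exact: measurable_sub_left.
  - by move=> y; rewrite !normrM normr_id mulrC.
rewrite (ge0_integralZl leb2 measurableT mU U0); last by rewrite lee_fin ltW.
rewrite [X in (_ * X)%E](conv_tonelli mGn mW2 (fun y => normr_ge0 _) (fun y => sqr_ge0 _)).
rewrite expr2 -mulrA EFinM EFinM.
apply: lee_wpmul2l; first by rewrite lee_fin ltW.
apply: lee_pmul => //.
- exact: integral_EFin_ge0.
- by apply: integral_EFin_ge0 => y; exact: sqr_ge0.
Qed.

(** The weight is a product of two functions with integral [pi]. *)
Lemma integral_weight : (\int[leb2]_x (weight x)%:E = (pi ^+ 2)%:E)%E.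
Proof.
pose u (a : R) : R := (1 + a ^+ 2)^-1.
have u0 a : 0 <= u a by rewrite invr_ge0 ltW// one_sqr_gt0.
have cu : continuous u by exact: (continuous_inv_one_sqr (@continuous_id R)).
have mu : measurable_fun setT (EFin \o u).
  by apply/measurable_EFinP; exact: measurable_continuous.
have ue0 a : setT a -> (0 <= (EFin \o u) a)%E by move=> _; rewrite lee_fin.
have Iu : (\int[leb]_a (u a)%:E = pi%:E)%E.
  rewrite ge0_symfun_integralT//; last by move=> a; rewrite /u /= sqrrN.
  have -> : [set x : R | 0 <= x] = `[0, +oo[%classic by rewrite set_itvcy.
  rewrite [X in (_ * X)%E](_ : _ = (pi / 2)%:E); last exact: integral0y_oneDsqr.
  by rewrite -EFinM mulrC divfK.
have mw : measurable_fun setT (fun x : X => (weight x)%:E).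
  by apply/measurable_EFinP; apply: measurable_continuous2; exact: continuous_weight.
have wn (x : X) : (0 <= (weight x)%:E)%E.
  by rewrite lee_fin; exact: (ltW (weight_gt0 x)).
rewrite (plane_tonelli mw wn).
have -> : (\int[leb]_a \int[leb]_b (weight (a, b))%:E =
    \int[leb]_a ((u a)%:E * pi%:E))%E.
  apply: eq_integral => a _; rewrite -Iu -(ge0_integralZl leb measurableT mu ue0) ?lee_fin//.
rewrite (ge0_integralZr leb measurableT mu ue0) ?lee_fin ?pi_ge0//.
by rewrite Iu -EFinM expr2.
Qed.

End Young.

(** * The projections as convolutions of second differences *)

Section LPFormula.
Context {R : realType} (chi : plane R -> R).
Hypothesis hchi : LP_cutoff chi.
Local Notation leb2 := (@plane_measure R).
Local Notation X := (R * R)%type.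
Implicit Types (F G : X -> R) (k : int) (x : X).

Definition dyadic k : R := 2 ^ k.

Lemma dyadic_gt0 k : 0 < dyadic k.
Proof. by rewrite /dyadic exprz_gt0. Qed.

Definition dil (l : R) (z : X) : X := (l * z.1, l * z.2).

Lemma continuous_dil (l : R) : continuous (dil l).
Proof. by rewrite /dil; cont. Qed.

Lemma chi_dilE k (xi : X) :
  chi ((2 : R) ^ (- k) *: (xi : plane R)) =
  multiplier chi (dil (dyadic k)^-1 xi) * denom (dil (dyadic k)^-1 xi).
Proof.
rewrite multiplierM//; congr chi.
by rewrite /dil /dyadic invr_expz.
Qed.

Lemma multiplier_supported k :
  box_supported (3 * dyadic k) (fun xi => multiplier chi (dil (dyadic k)^-1 xi)).
Proof.
move=> xi mxi; have l0 := dyadic_gt0 k.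
have nO : ~ off_annulus (dil (dyadic k)^-1 xi).
  by move=> O; move/eqP: mxi; apply; rewrite /multiplier chi_off_annulus// mul0r.
have small (a : R) : ~~ (3 <= `|(dyadic k)^-1 * a|) -> `|a| <= 3 * dyadic k.
  rewrite -ltNge normrM ger0_norm; last by rewrite invr_ge0 ltW.
  by rewrite mulrC ltr_pdivrMr// => /ltW.
split; apply: small; apply/negP => h; apply: nO.
  exact: off_annulus1.
exact: off_annulus2.
Qed.

Lemma continuous_multiplier : continuous (multiplier chi).
Proof. exact: (vanishing_Cn_continuous (vanishing_Cn_multiplier hchi 0)). Qed.

Lemma integrable_multiplier k :
  leb2.-integrable setT (EFin \o (fun xi => multiplier chi (dil (dyadic k)^-1 xi))).
Proof.
apply: (@box_integrable _ (3 * dyadic k)).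
- by rewrite mulr_ge0// ltW// dyadic_gt0.
- exact: (continuous_compose (@continuous_dil _) continuous_multiplier).
- exact: multiplier_supported.
Qed.

Lemma integrable_chi k :
  leb2.-integrable setT (EFin \o (fun xi : X => chi ((2 : R) ^ (- k) *: (xi : plane R)))).
Proof.
have cm := continuous_multiplier.
have cd : continuous (@denom R) := vanishing_Cn_continuous (vanishing_Cn_denom 0).
rewrite (_ : (fun xi : X => _) = (fun xi => multiplier chi (dil (dyadic k)^-1 xi) *
    denom (dil (dyadic k)^-1 xi))); last by apply/funext => xi; exact: chi_dilE.
apply: (@box_integrable _ (3 * dyadic k)).
- by rewrite mulr_ge0// ltW// dyadic_gt0.
- have cdl := @continuous_dil (dyadic k)^-1; cont.
- move=> xi; have [m0|m0 _] := eqVneq (multiplier chi (dil (dyadic k)^-1 xi)) 0.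
    by rewrite m0 mul0r eqxx.
  exact: multiplier_supported m0.
Qed.

Definition kern (z : X) : R := (2 * pi) ^- 2 * osc (multiplier chi) z.

Definition dilated_kern k (z : X) : R := dyadic k ^+ 2 * kern (dil (dyadic k) z).

(** Minus the five-point discrete Laplacian with mesh [2 ^ - k], without the division by the square
    of the mesh. *)
Definition total_diff k F (y : X) : R :=
  second_diff ((dyadic k)^-1, 0) F y + second_diff (0, (dyadic k)^-1) F y.

(* Dividing [chi] by the discrete Laplacian turns [P_k F] into a convolution of
   second differences of [F] at the scale [2 ^- k]. *)
Definition LPre k F x : R := conv (total_diff k F) (dilated_kern k) x.

Lemma integrable_total_diff k F : leb2.-integrable setT (EFin \o F) ->
  leb2.-integrable setT (EFin \o total_diff k F).
Proof.
move=> iF; have := integrableD measurableT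
  (integrable_second_diff ((dyadic k)^-1, 0) iF) (integrable_second_diff (0, (dyadic k)^-1) iF).
by apply: eq_integrable.
Qed.

Lemma osc_multiplier_dil k z :
  \int[leb2]_xi (cos (dot z xi) * multiplier chi (dil (dyadic k)^-1 xi)) =
  dyadic k ^+ 2 * osc (multiplier chi) (dil (dyadic k) z).
Proof.
have l0 := dyadic_gt0 k; have ln0 : dyadic k != 0 by rewrite gt_eqF.
have cm := continuous_multiplier.
have b0 : 0 <= 3 * dyadic k by rewrite mulr_ge0// ltW.
pose f (xi : X) := multiplier chi xi * cos (dot (dil (dyadic k) z) xi).
have cf : continuous f by rewrite /f /dot; cont.
have bf : box_supported 3 f.
  move=> xi; rewrite /f; have [m0|m0 _] := eqVneq (multiplier chi xi) 0.
    by rewrite m0 mul0r eqxx.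
  have small (a : R) : ~~ (3 <= `|a|) -> `|a| <= 3 by rewrite -ltNge => /ltW.
  by split; apply: small; apply/negP => h; move/eqP: m0; apply;
    rewrite /multiplier chi_off_annulus ?mul0r//;
    [exact: off_annulus1|exact: off_annulus2].
have r3 : (0 : R) <= 3 by [].
have if_ := box_integrable r3 cf bf.
have := @Rintegral_affine2 R (0, 0) ((dyadic k)^-1, (dyadic k)^-1) f.
rewrite /= invr_eq0 ln0 => /(_ isT isT if_).
rewrite (box_Rintegral r3 cf bf) -/(osc (multiplier chi) (dil (dyadic k) z)).
rewrite ger0_norm ?mulr_ge0 ?invr_ge0 ?ltW// => <-.
rewrite mulrA -expr2 exprVn divff ?expf_neq0// mul1r.
apply: eq_Rintegral => xi _.
have -> : affine2 (0, 0) ((dyadic k)^-1, (dyadic k)^-1) xi = dil (dyadic k)^-1 xi.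
  by rewrite /affine2 /affine /dil/= !add0r.
rewrite /f mulrC; congr (_ * cos _).
by rewrite /dot /dil /=; field.
Qed.

Lemma continuous_kern : continuous kern.
Proof. have co := continuous_osc continuous_multiplier; by rewrite /kern; cont. Qed.

Lemma kern_decay : exists2 K, 0 <= K & forall z, `|kern z| <= K * weight z.
Proof.
have [K K0 HK] := osc_decay (@off_annulus1 R) (@off_annulus2 R)
  (vanishing_Cn_multiplier hchi 4).
have p0 : 0 <= ((2 * pi) ^- 2 : R) by rewrite invr_ge0 sqr_ge0.
exists ((2 * pi) ^- 2 * K); first by rewrite mulr_ge0.
by move=> z; rewrite /kern normrM ger0_norm// -mulrA ler_wpM2l.
Qed.

Lemma measurable_dilated_kern k : measurable_fun setT (dilated_kern k).
Proof.
apply: measurable_continuous2.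
exact: (continuous_funM (@continuous_cst _ _ _)
  (continuous_compose (@continuous_dil (dyadic k)) continuous_kern)).
Qed.

Lemma weight_le1 (z : X) : weight z <= 1.
Proof.
have inv1 (a : R) : (1 + a ^+ 2)^-1 <= 1.
  by rewrite invf_le1 ?one_sqr_gt0// lerDl sqr_ge0.
by rewrite /weight mulr_ile1// invr_ge0 ltW// one_sqr_gt0.
Qed.

Lemma dilated_kern_bounded (K : R) : (forall z, `|kern z| <= K * weight z) ->
  0 <= K -> forall k z, `|dilated_kern k z| <= dyadic k ^+ 2 * K.
Proof.
move=> HK K0 k z; rewrite /dilated_kern normrM ger0_norm ?sqr_ge0// ler_wpM2l ?sqr_ge0//.
by apply: le_trans (HK _) _; rewrite ler_piMr// weight_le1.
Qed.

Lemma integrable_conv G (M : X -> R) (K : R) x : leb2.-integrable setT (EFin \o G) ->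
  measurable_fun setT M -> (forall z, `|M z| <= K) ->
  leb2.-integrable setT (EFin \o (fun y => G y * M (x - y))).
Proof.
move=> iG mM MK; have /integrableP[/measurable_EFinP mG _] := iG.
have iKG := integrableZl measurableT K iG.
apply: (le_integrable _ _ _ iKG) => //.
  apply/measurable_EFinP; apply: measurable_funM => //; exact: measurable_sub_left.
move=> y _; rewrite /= lee_fin !normrM mulrC ler_wpM2r//.
exact: le_trans (MK _) (ler_norm _).
Qed.

(** Write the cutoff as [multiplier] times [denom], let [denom] act on [F] as [total_diff], and
    exchange the integrals. Compact support of the multiplier and integrability of [F] justify the
    exchange. *)
Lemma LP_formula k F x : leb2.-integrable setT (EFin \o F) ->
  LP chi k (fun y => (F y)%:C) x = (LPre k F x)%:C.
Proof.
move=> iF.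
rewrite /LP (inv_fourierE (fun xi : X => chi ((2 : R) ^ (- k) *: (xi : plane R))) x iF).
rewrite sin_transform_integral0//; last 2 first.
- move=> xi; case: hchi => _ rad _ _; apply: rad.
  by rewrite /enorm; congr Num.sqrt; rewrite /dot /=; rewrite /GRing.scale/=; ring.
- exact: integrable_chi.
rewrite mulr0; congr (_ +i* _).
have iG := integrable_total_diff k iF.
transitivity ((2 * pi) ^- 2 * \int[leb2]_xi (multiplier chi (dil (dyadic k)^-1 xi) *
    \int[leb2]_y (cos (dot (x - y) xi) * total_diff k F y))).
  apply: (congr1 (fun r => (2 * pi) ^- 2 * r)); apply: eq_Rintegral => xi _.
  rewrite chi_dilE -mulrA; apply: congr1.
  rewrite -/(cos_transform (total_diff k F) x xi).
  have -> : cos_transform (total_diff k F) x xi =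
     cos_transform (second_diff ((dyadic k)^-1, 0) F) x xi +
     cos_transform (second_diff (0, (dyadic k)^-1) F) x xi.
    rewrite /cos_transform -RintegralD//.
    - by apply: eq_Rintegral => y _; rewrite /total_diff mulrDr.
    - apply: (integrable_cos_mul xi (@continuous_subX R x)).
      exact: integrable_second_diff.
    - apply: (integrable_cos_mul xi (@continuous_subX R x)).
      exact: integrable_second_diff.
  rewrite !cos_transform_second_diff// /denom /dil /=.
  have -> : dot ((dyadic k)^-1, 0) xi = (dyadic k)^-1 * xi.1 by rewrite /dot /= mul0r addr0.
  have -> : dot (0, (dyadic k)^-1) xi = (dyadic k)^-1 * xi.2 by rewrite /dot /= mul0r add0r.
  by ring.
rewrite (oscillatory_fubini (m1 := leb2) (m2 := leb2) (integrable_multiplier k) iG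
  (measurable_cos_dot x) (fun p => norm_cos_le1 _)).
rewrite /LPre /conv -RintegralZl//; last first.
  have [K K0 HK] := osc_bounded continuous_multiplier.
  pose M0 (z : X) := dyadic k ^+ 2 * osc (multiplier chi) (dil (dyadic k) z).
  have mM0 : measurable_fun setT M0.
    apply: measurable_continuous2.
    exact: (continuous_funM (@continuous_cst _ _ _)
      (continuous_compose (@continuous_dil (dyadic k)) (continuous_osc continuous_multiplier))).
  have bM0 z : `|M0 z| <= dyadic k ^+ 2 * K.
    by rewrite /M0 normrM ger0_norm ?sqr_ge0// ler_wpM2l ?sqr_ge0.
  have := integrable_conv x iG mM0 bM0; apply: eq_integrable => // y _ /=.
  by congr ((_ * _)%:E); exact/esym/(osc_multiplier_dil k (x - y)).
apply: eq_Rintegral => y _.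
have -> : \int[leb2]_xi (cos (dot (x - (xi, y).2) (xi, y).1) * multiplier chi (dil (dyadic k)^-1 xi)) = dyadic k ^+ 2 * osc (multiplier chi) (dil (dyadic k) (x - y)).
  exact: (osc_multiplier_dil k (x - y)).
by rewrite /dilated_kern /kern; ring.
Qed.

Lemma integral_dilated_weight k :
  (\int[leb2]_z (dyadic k ^+ 2 * weight (dil (dyadic k) z))%:E = (pi ^+ 2)%:E)%E.
Proof.
have l0 := dyadic_gt0 k; have ln0 : dyadic k != 0 by rewrite gt_eqF.
have mw : measurable_fun setT (fun z : X => (weight z)%:E).
  by apply/measurable_EFinP; apply: measurable_continuous2; exact: continuous_weight.
have wn (z : X) : (0 <= (weight z)%:E)%E by rewrite lee_fin; exact: (ltW (weight_gt0 z)).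
have := @integral_affine2 R (0, 0) (dyadic k, dyadic k) _ ln0 ln0 mw wn.
rewrite integral_weight /= => <-.
rewrite (@integral_EFinZl _ _ R leb2 (dyadic k ^+ 2) (fun z => weight (dil (dyadic k) z))).
- rewrite -expr2 ger0_norm ?sqr_ge0//; congr (_ * _)%E; apply: eq_integral => z _.
  by rewrite /affine2 /affine /dil /= !add0r.
- apply: measurable_continuous2.
  exact: (continuous_compose (@continuous_dil _) (@continuous_weight R)).
- exact: sqr_ge0.
- by move=> z; exact: (ltW (weight_gt0 _)).
Qed.

Lemma integral_total_diff_norm k F (a : R) : leb2.-integrable setT (EFin \o F) ->
  (\int[leb2]_y `|F y|%:E <= a%:E)%E ->
  (\int[leb2]_y `|total_diff k F y|%:E <= (8 * a)%:E)%E.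
Proof.
move=> iF Fa; have mF : measurable_fun setT F.
  by have /integrableP[/measurable_EFinP] := iF.
have mT : measurable_fun setT (total_diff k F).
  by have /integrableP[/measurable_EFinP] := integrable_total_diff k iF.
have msh (v : X) : measurable_fun setT (fun y : X => `|F (y + v)|).
  have /integrableP[/measurable_EFinP m _] := integrable_shift v iF.
  exact: measurableT_comp.
have ish (v : X) : (\int[leb2]_y `|F (y + v)%R|%:E = \int[leb2]_y `|F y|%:E)%E.
  by rewrite -[RHS](integral_shift v (f := fun y : X => `|F y|%:E))//;
    exact: measurable_EFin_norm.
pose v1 : X := ((dyadic k)^-1, 0); pose v2 : X := (0, (dyadic k)^-1).
pose S (y : X) := (4 * `|F y|) + (`|F (y + v1)| + (`|F (y - v1)| +
  (`|F (y + v2)| + `|F (y - v2)|))).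
have m0 : measurable_fun setT (fun y : X => 4 * `|F y|).
  by apply: measurable_funM => //; exact: measurableT_comp.
have m4 : measurable_fun setT (fun y : X => `|F (y + v2)| + `|F (y - v2)|).
  exact: measurable_funD.
have m3 : measurable_fun setT (fun y : X => `|F (y - v1)| + (`|F (y + v2)| + `|F (y - v2)|)).
  exact: measurable_funD.
have m2 : measurable_fun setT (fun y : X => `|F (y + v1)| + (`|F (y - v1)| + (`|F (y + v2)| + `|F (y - v2)|))).
  exact: measurable_funD.
apply: (@le_trans _ _ (\int[leb2]_y (S y)%:E)%E).
  apply: (@le_integral_EFin _ _ R leb2 (fun y => `|total_diff k F y|)).
  - exact: measurableT_comp.
  - exact: measurable_funD.
  - by move=> y; exact: normr_ge0.
  move=> y; rewrite /total_diff /second_diff -/v1 -/v2 /S.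
  have -> : 2 * F y - F (y + v1) - F (y - v1) + (2 * F y - F (y + v2) - F (y - v2)) =
    4 * F y + (- F (y + v1) + (- F (y - v1) + (- F (y + v2) + - F (y - v2)))) by ring.
  apply: (le_trans (ler_normD _ _)); apply: lerD; first by rewrite normrM ger0_norm.
  do 3 (apply: (le_trans (ler_normD _ _)); apply: lerD; first by rewrite normrN).
  by rewrite normrN.
have Fs v : (\int[leb2]_y `|F (y + v)%R|%:E <= a%:E)%E by rewrite ish.
have n0 (y : X) : 0 <= 4 * `|F y| by rewrite mulr_ge0.
rewrite (@integral_EFinD _ _ R leb2 (fun y => 4 * `|F y|))//; try by move=> y; rewrite !addr_ge0.
rewrite (@integral_EFinD _ _ R leb2 (fun y => `|F (y + v1)|))//; try by move=> y; rewrite !addr_ge0.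
rewrite (@integral_EFinD _ _ R leb2 (fun y => `|F (y - v1)|))//; try by move=> y; rewrite !addr_ge0.
rewrite (@integral_EFinD _ _ R leb2 (fun y => `|F (y + v2)|))//.
rewrite (@integral_EFinZl _ _ R leb2 4 (fun y => `|F y|))//; last exact: measurableT_comp.
have -> : 8 * a = 4 * a + (a + (a + (a + a))) by ring.
rewrite !EFinD EFinM; apply: leeD; first by apply: lee_wpmul2l; [rewrite lee_fin|exact: Fa].
apply: leeD; first exact: (Fs v1).
apply: leeD; first exact: (Fs (- v1)).
apply: leeD; first exact: (Fs v2).
exact: (Fs (- v2)).
all: first [exact: (msh v1)|exact: (msh (- v1))|exact: (msh v2)|exact: (msh (- v2))].
Qed.

(** The two second differences consist of four first differences. Their squared sum costs a factor
    4, and each axis occurs twice, once as [d] and once as its translate [e] with the same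
    integral. *)
Lemma integral_total_diff_sqr k F (a1 a2 : R) : leb2.-integrable setT (EFin \o F) ->
  (\int[leb2]_y ((F (y + ((dyadic k)^-1, 0))%R - F y) ^+ 2)%:E <= a1%:E)%E ->
  (\int[leb2]_y ((F (y + (0, (dyadic k)^-1))%R - F y) ^+ 2)%:E <= a2%:E)%E ->
  (\int[leb2]_y (total_diff k F y ^+ 2)%:E <= (8 * (a1 + a2))%:E)%E.
Proof.
move=> iF Fa1 Fa2.
have msh (v : X) : measurable_fun setT (fun y : X => F (y + v)).
  by have /integrableP[/measurable_EFinP m _] := integrable_shift v iF.
have mF : measurable_fun setT F by have /integrableP[/measurable_EFinP] := iF.
have mT : measurable_fun setT (total_diff k F).
  by have /integrableP[/measurable_EFinP] := integrable_total_diff k iF.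
pose v1 : X := ((dyadic k)^-1, 0); pose v2 : X := (0, (dyadic k)^-1).
pose d v (y : X) := (F (y + v) - F y) ^+ 2.
have md v : measurable_fun setT (d v) by apply: measurable_funX; exact: measurable_funB.
pose e v (y : X) := d v (y - v).
have mdv v : measurable_fun setT (e v).
  have -> : e v = (fun y : X => (F y - F (y - v)) ^+ 2).
    by apply/funext => y; rewrite /e /d subrK.
  by apply: measurable_funX; exact: measurable_funB.
have d0 v y : 0 <= d v y by exact: sqr_ge0.
have e0 v y : 0 <= e v y by exact: sqr_ge0.
have shd v : (\int[leb2]_y (e v y)%:E = \int[leb2]_y (d v y)%:E)%E.
  have mde : measurable_fun setT (EFin \o d v) by exact/measurable_EFinP.
  have de0 y : (0 <= (EFin \o d v) y)%E by rewrite lee_fin.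
  exact: (integral_shift (- v) mde de0).
pose S (y : X) := 4 * (d v1 y + (e v1 y + (d v2 y + e v2 y))).
have m4 : measurable_fun setT (fun y => d v2 y + e v2 y) by exact: measurable_funD.
have m3 : measurable_fun setT (fun y => e v1 y + (d v2 y + e v2 y)) by exact: measurable_funD.
have m2 : measurable_fun setT (fun y => d v1 y + (e v1 y + (d v2 y + e v2 y))).
  exact: measurable_funD.
apply: (@le_trans _ _ (\int[leb2]_y (S y)%:E)%E).
  apply: (@le_integral_EFin _ _ R leb2 (fun y => total_diff k F y ^+ 2)).
  - exact: measurable_funX.
  - by apply: measurable_funM.
  - by move=> y; exact: sqr_ge0.
  move=> y; rewrite /total_diff /second_diff -/v1 -/v2 /S /e /d !subrK.
  move: (F y) (F (y + v1)) (F (y - v1)) (F (y + v2)) (F (y - v2)) => f a b c g.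
  have := sqr_ge0 ((a - f) + (f - b)); have := sqr_ge0 ((a - f) - (c - f)).
  have := sqr_ge0 ((a - f) + (f - g)); have := sqr_ge0 ((f - b) + (c - f)).
  have := sqr_ge0 ((f - b) - (f - g)); have := sqr_ge0 ((c - f) + (f - g)).
  nra.
rewrite (@integral_EFinZl _ _ R leb2 4 (fun y => d v1 y + (e v1 y + (d v2 y + e v2 y))))//; last first.
  by move=> y; rewrite !addr_ge0.
rewrite (@integral_EFinD _ _ R leb2 (d v1))//; last by move=> y; rewrite !addr_ge0.
rewrite (@integral_EFinD _ _ R leb2 (e v1))//; last by move=> y; rewrite !addr_ge0.
rewrite (@integral_EFinD _ _ R leb2 (d v2))//.
have -> : 8 * (a1 + a2) = 4 * (a1 + (a1 + (a2 + a2))) by ring.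
have es1 : (\int[leb2]_y (e v1 y)%:E <= a1%:E)%E by rewrite shd.
have es2 : (\int[leb2]_y (e v2 y)%:E <= a2%:E)%E by rewrite shd.
rewrite EFinM !EFinD; apply: lee_wpmul2l; first by rewrite lee_fin.
apply: leeD; first exact: Fa1.
apply: leeD; first exact: es1.
by apply: leeD; [exact: Fa2|exact: es2].
all: first [exact: (md v1)|exact: (md v2)|exact: (mdv v1)|exact: (mdv v2)].
Qed.

(** Each L^2 bound is a Young inequality applied to [total_diff k F], taken in L^1 or in L^2. The
    pointwise bound is for the convergence of the low-frequency series. *)
Lemma LPre_bounds : exists2 C : R, 0 <= C & forall k F,
  leb2.-integrable setT (EFin \o F) ->
  [/\ measurable_fun setT (LPre k F),
    forall a : R, 0 < a -> (\int[leb2]_y `|F y|%:E <= a%:E)%E ->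
      (\int[leb2]_x (LPre k F x ^+ 2)%:E <= (C * dyadic k ^+ 2 * a ^+ 2)%:E)%E /\
      (forall x, `|LPre k F x| <= C * dyadic k ^+ 2 * a)
  & forall a1 a2 : R,
    (\int[leb2]_y ((F (y + ((dyadic k)^-1, 0))%R - F y) ^+ 2)%:E <= a1%:E)%E ->
    (\int[leb2]_y ((F (y + (0, (dyadic k)^-1))%R - F y) ^+ 2)%:E <= a2%:E)%E ->
    (\int[leb2]_x (LPre k F x ^+ 2)%:E <= (C * (a1 + a2))%:E)%E].
Proof.
have [K' K'0 HK'] := kern_decay.
(* The Young inequalities ask for strictly positive bounds. *)
pose K := K' + 1.
have K0 : 0 < K by rewrite /K; lra.
have HK z : `|kern z| <= K * weight z.
  apply: le_trans (HK' z) _; rewrite ler_wpM2r ?ltW ?weight_gt0// /K; lra.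
have pi0 : 0 < (pi : R) := pi_gt0 R.
pose C1 := 64 * K ^+ 2 * pi ^+ 2; pose C2 := 8 * K; pose C3 := (K * pi ^+ 2) ^+ 2 * 8.
have C10 : 0 <= C1.
  by rewrite /C1; apply: mulr_ge0; [apply: mulr_ge0 => //|]; exact: sqr_ge0.
have C20 : 0 <= C2 by apply: mulr_ge0 => //; exact: ltW.
have C30 : 0 <= C3 by rewrite /C3; apply: mulr_ge0 => //; exact: sqr_ge0.
exists (C1 + C2 + C3); first by rewrite !addr_ge0.
move=> k F iF; have l0 := dyadic_gt0 k.
have iG := integrable_total_diff k iF.
have mG : measurable_fun setT (total_diff k F) by have /integrableP[/measurable_EFinP] := iG.
have mM := measurable_dilated_kern k.
pose W (z : X) := K * (dyadic k ^+ 2 * weight (dil (dyadic k) z)).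
have cW : continuous W.
  have cw := @continuous_weight R; have cd := @continuous_dil (dyadic k).
  by rewrite /W; cont.
have mW : measurable_fun setT W by exact: measurable_continuous2.
have MW z : `|dilated_kern k z| <= W z.
  rewrite /dilated_kern normrM ger0_norm ?sqr_ge0// /W mulrCA.
  by rewrite ler_wpM2l ?sqr_ge0.
have mw : measurable_fun setT (fun z => dyadic k ^+ 2 * weight (dil (dyadic k) z)).
  apply: measurable_funM => //; apply: measurable_continuous2.
  exact: (continuous_compose (@continuous_dil _) (@continuous_weight R)).
have w0 (z : X) : 0 <= dyadic k ^+ 2 * weight (dil (dyadic k) z).
  by rewrite mulr_ge0 ?sqr_ge0// ltW// weight_gt0.
have IW : (\int[leb2]_z (W z)%:E = (K * pi ^+ 2)%:E)%E.
  rewrite (@integral_EFinZl _ _ R leb2 K _ mw)//; last exact: ltW.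
  by rewrite integral_dilated_weight EFinM.
(* One of the two factors [weight] is replaced by 1, which leaves the scale-invariant integral and
   one factor [dyadic k ^+ 2]. *)
have IW2 : (\int[leb2]_z (W z ^+ 2)%:E <= (K ^+ 2 * dyadic k ^+ 2 * pi ^+ 2)%:E)%E.
  apply: (@le_trans _ _ (\int[leb2]_z (K ^+ 2 * dyadic k ^+ 2 *
      (dyadic k ^+ 2 * weight (dil (dyadic k) z)))%:E)%E).
    apply: (@le_integral_EFin _ _ R leb2 (fun z => W z ^+ 2)).
    - exact: measurable_funX.
    - exact: measurable_funM.
    - by move=> z; exact: sqr_ge0.
    move=> z; have := weight_le1 (dil (dyadic k) z).
    have := weight_gt0 (dil (dyadic k) z); rewrite /W.
    move: (weight _) => w wp w1.
    have -> : (K * (dyadic k ^+ 2 * w)) ^+ 2 =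
      (K * dyadic k ^+ 2) ^+ 2 * (w * w) by ring.
    have -> : K ^+ 2 * dyadic k ^+ 2 * (dyadic k ^+ 2 * w) =
      (K * dyadic k ^+ 2) ^+ 2 * w by ring.
    by rewrite ler_wpM2l ?sqr_ge0// ler_piMr// ltW.
  rewrite (@integral_EFinZl _ _ R leb2 _ _ mw)//; last by rewrite mulr_ge0 ?sqr_ge0.
  by rewrite integral_dilated_weight EFinM.
split; first exact: (measurable_convolution mG mM).
- move=> a a0 Fa.
  have Ga := integral_total_diff_norm k iF Fa.
  have a8 : 0 < 8 * a by rewrite mulr_gt0.
  have L2 := young_L2_kernel mG mM mW MW a8 Ga IW2.
  split.
    apply: (le_trans L2); rewrite lee_fin.
    have -> : (8 * a) ^+ 2 * (K ^+ 2 * dyadic k ^+ 2 * pi ^+ 2) =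
       C1 * dyadic k ^+ 2 * a ^+ 2 by rewrite /C1; ring.
    by rewrite ler_wpM2r ?sqr_ge0// ler_wpM2r ?sqr_ge0//; lra.
  move=> x; rewrite -lee_fin.
  apply: (le_trans (conv_norm_le x mG mM mW MW)).
  apply: (@le_trans _ _ (\int[leb2]_y (K * dyadic k ^+ 2 * `|total_diff k F y|)%:E)%E).
    apply: (@le_integral_EFin _ _ R leb2 (fun y => `|total_diff k F y * W (x - y)|)).
    - apply: measurableT_comp => //; apply: measurable_funM => //.
      exact: measurable_sub_left.
    - by apply: measurable_funM => //; exact: measurableT_comp.
    - by move=> y; exact: normr_ge0.
    move=> y; rewrite normrM mulrC ler_wpM2r// ger0_norm; last first.
      by apply: le_trans (MW _); exact: normr_ge0.
    rewrite /W mulrA ler_piMr//; last exact: weight_le1.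
    by rewrite mulr_ge0 ?sqr_ge0// ltW.
  rewrite (@integral_EFinZl _ _ R leb2 _ (fun y => `|total_diff k F y|))//; last 2 first.
  - exact: measurableT_comp.
  - by rewrite mulr_ge0 ?sqr_ge0// ltW.
  have -> : (C1 + C2 + C3) * dyadic k ^+ 2 * a =
     (K * dyadic k ^+ 2) * (8 * a) + (C1 + C3) * dyadic k ^+ 2 * a by rewrite /C2; ring.
  rewrite EFinD -[leLHS]adde0; apply: leeD; last first.
    by rewrite lee_fin !mulr_ge0 ?sqr_ge0 ?addr_ge0// ltW.
  rewrite [leRHS]EFinM; apply: lee_wpmul2l; last exact: Ga.
  by rewrite lee_fin mulr_ge0 ?sqr_ge0// ltW.
move=> a1 a2 Fa1 Fa2.
have GA := integral_total_diff_sqr iF Fa1 Fa2.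
have Kp : 0 < K * pi ^+ 2 by rewrite mulr_gt0// exprn_gt0.
have := young_L1_kernel mG mM mW MW Kp _ GA.
rewrite IW lexx => /(_ isT) L1; apply: (le_trans L1); rewrite lee_fin.
have a10 : 0 <= a1.
  rewrite -lee_fin; apply: le_trans Fa1; apply: integral_EFin_ge0 => y; exact: sqr_ge0.
have a20 : 0 <= a2.
  rewrite -lee_fin; apply: le_trans Fa2; apply: integral_EFin_ge0 => y; exact: sqr_ge0.
have -> : (K * pi ^+ 2) ^+ 2 * (8 * (a1 + a2)) = C3 * (a1 + a2) by rewrite /C3; ring.
by rewrite ler_wpM2r ?addr_ge0//; lra.
Qed.

Lemma LPreD k F G x : leb2.-integrable setT (EFin \o F) ->
  leb2.-integrable setT (EFin \o G) ->
  LPre k (fun y => F y + G y) x = LPre k F x + LPre k G x.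
Proof.
move=> iF iG; have [K K0 HK] := kern_decay.
have mM := measurable_dilated_kern k.
have c1 := integrable_conv x (integrable_total_diff k iF) mM (dilated_kern_bounded HK K0 k).
have c2 := integrable_conv x (integrable_total_diff k iG) mM (dilated_kern_bounded HK K0 k).
rewrite /LPre /conv -RintegralD//; apply: eq_Rintegral => y _.
by rewrite /total_diff /second_diff; ring.
Qed.

End LPFormula.

(** * Averaging operators and dyadic pieces *)

Section Averages.
Context {R : realType}.
Local Notation leb := (@lebesgue_measure R).
Local Notation leb2 := (@plane_measure R).
Local Notation X := (R * R)%type.
Local Notation Y := (R * (R * R))%type.
Implicit Types (f g w : Y -> R) (u v : X) (p : Y) (x : X).

Definition tr v f p : R := f (p.1, (p.2.1 + v.1, p.2.2 + v.2)).

(** Average over the segment from [x] to [x + v] at fixed time; the parametrisation by [0,1] covers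
    [v = 0] and all orientations alike. *)
Definition avg v f p : R :=
  itvint 0 1 (fun s => f (p.1, (p.2.1 + s * v.1, p.2.2 + s * v.2))).

Definition hsum v f p : R := 2^-1 * (f p + tr v f p).
Definition hdiff v f p : R := 2^-1 * (f p - tr v f p).

Lemma continuous_tr v f : continuous f -> continuous (tr v f).
Proof. by move=> cf; rewrite /tr; cont. Qed.

Lemma continuous_avg v f : continuous f -> continuous (avg v f).
Proof.
move=> cf.
have cF : continuous (fun q : Y * R =>
  f (q.1.1, (q.1.2.1 + q.2 * v.1, q.1.2.2 + q.2 * v.2))) by cont.
exact: (continuous_itvint ler01 cF).
Qed.

Lemma continuous_hsum v f : continuous f -> continuous (hsum v f).
Proof. by move=> cf; have ct := @continuous_tr v _ cf; rewrite /hsum; cont. Qed.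

Lemma continuous_hdiff v f : continuous f -> continuous (hdiff v f).
Proof. by move=> cf; have ct := @continuous_tr v _ cf; rewrite /hdiff; cont. Qed.

Lemma continuous_avg_line v f p : continuous f ->
  continuous (fun s : R => f (p.1, (p.2.1 + s * v.1, p.2.2 + s * v.2))).
Proof. by move=> cf; cont. Qed.

Lemma avg_tr v u f : avg v (tr u f) = tr u (avg v f).
Proof.
apply/funext => p; apply: eq_itvint => s _; rewrite /tr /=.
by congr f; congr (_, (_, _)); ring.
Qed.

Lemma avgD v f g : continuous f -> continuous g ->
  avg v (fun p => f p + g p) = (fun p => avg v f p + avg v g p).
Proof.
by move=> cf cg; apply/funext => p; rewrite /avg itvintD//; exact: continuous_avg_line.
Qed.

Lemma avgZ (c : R) v f : continuous f ->
  avg v (fun p => c * f p) = (fun p => c * avg v f p).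
Proof. by move=> cf; apply/funext => p; rewrite /avg itvintZ//; exact: continuous_avg_line. Qed.

Lemma avgB v f g : continuous f -> continuous g ->
  avg v (fun p => f p - g p) = (fun p => avg v f p - avg v g p).
Proof.
by move=> cf cg; apply/funext => p; rewrite /avg itvintB//; exact: continuous_avg_line.
Qed.

Lemma avg_hsum v u f : continuous f -> avg v (hsum u f) = hsum u (avg v f).
Proof.
move=> cf; have ct := @continuous_tr u _ cf.
rewrite /hsum avgZ; last by cont.
by rewrite avgD// avg_tr.
Qed.

Lemma avg_hdiff v u f : continuous f -> avg v (hdiff u f) = hdiff u (avg v f).
Proof.
move=> cf; have ct := @continuous_tr u _ cf.
rewrite /hdiff avgZ; last by cont.
by rewrite avgB// avg_tr.
Qed.

Lemma avg_comm v u f : continuous f -> avg v (avg u f) = avg u (avg v f).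
Proof.
move=> cf; apply/funext => p; rewrite /avg /=.
have cF : continuous (fun q : R * R => f (p.1, (p.2.1 + q.1 * v.1 + q.2 * u.1,
  p.2.2 + q.1 * v.2 + q.2 * u.2))) by cont.
rewrite (itvint_swap ler01 ler01 cF).
apply: eq_itvint => r _; apply: eq_itvint => s _ /=.
by congr f; congr (_, (_, _)); ring.
Qed.

Lemma avg_double v f : continuous f ->
  avg (2 * v.1, 2 * v.2) f = hsum v (avg v f).
Proof.
move=> cf; apply/funext => p; rewrite /hsum /tr /avg /=.
have := itvint_double (@continuous_avg_line v _ p cf).
have -> : itvint 0 1 (fun s => f (p.1, (p.2.1 + s * (2 * v.1), p.2.2 + s * (2 * v.2)))) =
  itvint 0 1 (fun s => f (p.1, (p.2.1 + 2 * s * v.1, p.2.2 + 2 * s * v.2))).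
  by apply: eq_itvint => s _; congr f; congr (_, (_, _)); ring.
move=> ->; congr (_ * (_ + _)); apply: eq_itvint => s _.
by congr f; congr (_, (_, _)); ring.
Qed.

(** The operators for the opposite vector are the adjoints, so this is the parallelogram identity in
    operator form. *)
Lemma hdiff_hsumK v f p :
  hdiff (- v.1, - v.2) (hdiff v f) p + hsum (- v.1, - v.2) (hsum v f) p = f p.
Proof.
rewrite /hdiff /hsum /tr /= !subrK -!surjective_pairing.
by field.
Qed.

Lemma hsumC v u f : hsum v (hsum u f) = hsum u (hsum v f).
Proof.
apply/funext => p; rewrite /hsum /tr /=.
by rewrite (addrAC p.2.1) (addrAC p.2.2); ring.
Qed.

Lemma hsum_hdiffC v u f : hsum v (hdiff u f) = hdiff u (hsum v f).
Proof.
apply/funext => p; rewrite /hsum /hdiff /tr /=.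
by rewrite (addrAC p.2.1) (addrAC p.2.2); ring.
Qed.

Definition tint f x : R := itvint 0 1 (fun t => f (t, x) ^+ 2).

Definition nrm2 f : \bar R := (\int[leb2]_x (tint f x)%:E)%E.

Lemma continuous_tint f : continuous f -> continuous (tint f).
Proof.
move=> cf.
have cF : continuous (fun q : X * R => f (q.2, q.1) ^+ 2) by cont.
exact: (continuous_itvint ler01 cF).
Qed.

Lemma measurable_tint f : continuous f -> measurable_fun setT (tint f).
Proof. by move=> cf; apply: measurable_continuous2; exact: continuous_tint. Qed.

Lemma tint_ge0 f x : 0 <= tint f x.
Proof. by apply: itvint_ge0 => t _; exact: sqr_ge0. Qed.

Lemma nrm2_ge0 f : (0 <= nrm2 f)%E.
Proof. by apply: integral_EFin_ge0 => x; exact: tint_ge0. Qed.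

Lemma continuous_time f x : continuous f -> continuous (fun t : R => f (t, x)).
Proof. by move=> cf; cont. Qed.

Lemma nrm2_tr v f : continuous f -> nrm2 (tr v f) = nrm2 f.
Proof.
move=> cf.
have mf : measurable_fun setT (EFin \o tint f) by apply/measurable_EFinP; exact: measurable_tint.
have f0 x : (0 <= (EFin \o tint f) x)%E by rewrite lee_fin tint_ge0.
exact: (integral_shift v mf f0).
Qed.

Lemma tintD_le f g x : continuous f -> continuous g ->
  tint (fun p => f p + g p) x <= 2 * tint f x + 2 * tint g x.
Proof.
move=> cf cg; have cfx := @continuous_time _ x cf; have cgx := @continuous_time _ x cg.
rewrite /tint -itvintZ; [|by cont]; rewrite -itvintZ; [|by cont].
rewrite -itvintD; [|by cont|by cont].
apply: le_itvint; [by cont|by cont|] => t _.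
by have := sqr_ge0 (f (t, x) - g (t, x)); nra.
Qed.

Lemma tintZ (c : R) f x : continuous f -> tint (fun p => c * f p) x = c ^+ 2 * tint f x.
Proof.
move=> cf; have cfx := @continuous_time _ x cf; rewrite /tint -itvintZ; last by cont.
by apply: eq_itvint => t _; rewrite exprMn.
Qed.

Lemma nrm2Z (c : R) f : continuous f ->
  nrm2 (fun p => c * f p)%R = ((c ^+ 2)%:E * nrm2 f)%E.
Proof.
move=> cf; rewrite /nrm2; under eq_integral do rewrite tintZ//.
apply: (@integral_EFinZl _ _ R leb2); [exact: measurable_tint|exact: sqr_ge0|exact: tint_ge0].
Qed.

Lemma nrm2D_le f g : continuous f -> continuous g ->
  (nrm2 (fun p => f p + g p)%R <= 2%:E * nrm2 f + 2%:E * nrm2 g)%E.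
Proof.
move=> cf cg.
have mf := measurable_tint cf; have mg := measurable_tint cg.
have cfg : continuous (fun p => f p + g p) by cont.
have -> : (2%:E * nrm2 f + 2%:E * nrm2 g = \int[leb2]_x (2 * tint f x + 2 * tint g x)%:E)%E.
  rewrite (@integral_EFinD _ _ R leb2 (fun x => 2 * tint f x) (fun x => 2 * tint g x)).
  - rewrite !(@integral_EFinZl _ _ R leb2)//; exact: tint_ge0.
  - exact: measurable_funM.
  - exact: measurable_funM.
  - by move=> x; rewrite mulr_ge0// tint_ge0.
  - by move=> x; rewrite mulr_ge0// tint_ge0.
apply: (@le_integral_EFin _ _ R leb2 (tint (fun p => f p + g p))).
- exact: measurable_tint.
- by apply: measurable_funD; exact: measurable_funM.
- exact: tint_ge0.
- by move=> x; exact: tintD_le.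
Qed.

(** The identity holds pointwise with [f] and its translate on the right, and the two have the same
    norm. *)
Lemma nrm2_parallelogram v f : continuous f ->
  (nrm2 (hsum v f) + nrm2 (hdiff v f) = nrm2 f)%E.
Proof.
move=> cf; have ct := @continuous_tr v _ cf.
have cs := @continuous_hsum v _ cf; have cd := @continuous_hdiff v _ cf.
have mf := measurable_tint cf; have mt := measurable_tint ct.
rewrite /nrm2 -(@integral_EFinD _ _ R leb2); last 4 first.
- exact: measurable_tint.
- exact: measurable_tint.
- exact: tint_ge0.
- exact: tint_ge0.
transitivity (\int[leb2]_x (2^-1 * tint f x + 2^-1 * tint (tr v f) x)%:E)%E.
  apply: eq_integral => x _; congr (_%:E).
  have cfx := @continuous_time _ x cf; have ctx := @continuous_time _ x ct.
  have csx := @continuous_time _ x cs; have cdx := @continuous_time _ x cd.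
  rewrite /tint -itvintD; [|by cont|by cont].
  rewrite -itvintZ; [|by cont]; rewrite -itvintZ; [|by cont].
  rewrite -itvintD; [|by cont|by cont].
  by apply: eq_itvint => t _; rewrite /hsum /hdiff; field.
have mZ (h : X -> R) : measurable_fun setT h -> measurable_fun setT (fun x => 2^-1 * h x).
  by move=> mh; exact: measurable_funM.
have p0 (h : Y -> R) x : 0 <= 2^-1 * tint h x by rewrite mulr_ge0 ?invr_ge0// tint_ge0.
rewrite (@integral_EFinD _ _ R leb2 _ _ (mZ _ mf) (mZ _ mt) (p0 _) (p0 _)).
have i2 : 0 <= 2^-1 :> R by rewrite invr_ge0.
rewrite (@integral_EFinZl _ _ R leb2 _ _ mf i2 (tint_ge0 f)).
rewrite (@integral_EFinZl _ _ R leb2 _ _ mt i2 (tint_ge0 _)).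
have E := nrm2_tr v cf; rewrite /nrm2 in E; rewrite E.
rewrite -ge0_muleDl ?lee_fin// -EFinD.
have -> : 2^-1 + 2^-1 = 1 :> R by lra.
by rewrite mul1e.
Qed.

Lemma nrm2_hsum_le v f : continuous f -> (nrm2 (hsum v f) <= nrm2 f)%E.
Proof. by move=> cf; rewrite -(nrm2_parallelogram v cf) leeDl// nrm2_ge0. Qed.

Lemma nrm2_hdiff_le v f : continuous f -> (nrm2 (hdiff v f) <= nrm2 f)%E.
Proof. by move=> cf; rewrite -(nrm2_parallelogram v cf) leeDr// nrm2_ge0. Qed.

Definition mean (G : R * Y -> R) p : R := itvint 0 1 (fun s => G (s, p)).

Lemma continuous_mean (G : R * Y -> R) : continuous G -> continuous (mean G).
Proof.
move=> cG; have cG' : continuous (fun q : Y * R => G (q.2, q.1)) by cont.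
exact: (continuous_itvint ler01 cG').
Qed.

(** Jensen's inequality for the square, obtained as Cauchy-Schwarz against the constant 1. *)
Lemma tint_mean_le (G : R * Y -> R) x : continuous G ->
  tint (mean G) x <= itvint 0 1 (fun s => tint (fun p => G (s, p)) x).
Proof.
move=> cG.
have cF : continuous (fun q : R * R => G (q.1, (q.2, x)) ^+ 2) by cont.
rewrite /tint (itvint_swap ler01 ler01 cF).
have cF' : continuous (fun q : R * R => G (q.2, (q.1, x)) ^+ 2) by cont.
have ca := continuous_mean cG; have cax := @continuous_time _ x ca.
apply: le_itvint; [by cont|exact: (continuous_itvint ler01 cF')|] => t _.
have c1 : continuous (fun _ : R => 1 : R) by cont.
have cl : continuous (fun s : R => G (s, (t, x))) by cont.
have := itvint_cauchy_schwarz 0 1 cl c1.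
rewrite (@eq_itvint _ _ _ (fun s => 1 ^+ 2) (fun=> 1)); last by move=> s _; rewrite expr1n.
rewrite itvint_cst// subr0 mulr1 mulr1; apply: le_trans.
rewrite le_eqVlt; apply/orP; left; apply/eqP; congr (_ ^+ 2).
by apply: eq_itvint => s _; rewrite mulr1.
Qed.

Lemma nrm2_mean_le (G : R * Y -> R) (B : \bar R) : continuous G ->
  (forall s, 0 <= s <= 1 -> (nrm2 (fun p => G (s, p)) <= B)%E) ->
  (nrm2 (mean G) <= B)%E.
Proof.
move=> cG GB.
pose T (q : R * X) := tint (fun p => G (q.1, p)) q.2.
have cF : continuous (fun q : (R * X) * R => G (q.1.1, (q.2, q.1.2)) ^+ 2) by cont.
have cT : continuous T by exact: (continuous_itvint ler01 cF).
have cT' : continuous (fun q : X * R => T (q.2, q.1)).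
  by apply: (continuous_compose _ cT); cont.
have cTx x : continuous (fun s => T (s, x)) by apply: (continuous_compose _ cT); cont.
have cm := continuous_mean cG.
apply: (@le_trans _ _ (\int[leb2]_x (itvint 0 1 (fun s => T (s, x)))%:E)%E).
  apply: (@le_integral_EFin _ _ R leb2 (tint (mean G))).
  - exact: measurable_tint.
  - by apply: measurable_continuous2; exact: (continuous_itvint ler01 cT').
  - exact: tint_ge0.
  - by move=> x; exact: tint_mean_le.
have mT : measurable_fun setT (EFin \o T) by apply/measurable_EFinP; exact: measurable_continuous3.
have T0 q : (0 <= (EFin \o T) q)%E by rewrite lee_fin tint_ge0.
under eq_integral do rewrite itvint_EFin//.
rewrite -(tonelli_itv leb2 0 1 mT T0).
apply: (@le_trans _ _ (\int[leb]_(s in `[0%R, 1%R]) B)%E); last first.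
  rewrite integral_cst//= lebesgue_measure_itv/= lte_fin ltr01 oppr0 adde0.
  by rewrite mule1.
apply: ge0_le_integral => //.
- by move=> s _; apply: integral_EFin_ge0 => x; exact: tint_ge0.
- apply: measurable_funTS.
  exact: (measurable_fun_fubini_tonelli_F (m2 := leb2) _ mT T0).
Qed.

Lemma avg_mean v f :
  avg v f = mean (fun q => f (q.2.1, (q.2.2.1 + q.1 * v.1, q.2.2.2 + q.1 * v.2))).
Proof. by []. Qed.

Lemma tint_avg_le v f x : continuous f ->
  tint (avg v f) x <= itvint 0 1 (fun s => tint f (x.1 + s * v.1, x.2 + s * v.2)).
Proof.
move=> cf; rewrite avg_mean; apply: tint_mean_le; cont.
Qed.

Lemma nrm2_avg_le v f : continuous f -> (nrm2 (avg v f) <= nrm2 f)%E.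
Proof.
move=> cf; rewrite avg_mean; apply: nrm2_mean_le; first by cont.
by move=> s _; rewrite -(nrm2_tr (s * v.1, s * v.2) cf).
Qed.

Lemma nrm2_sub_avg_le v f (B : \bar R) : continuous f ->
  (forall s, 0 <= s <= 1 -> (nrm2 (fun p => f p - tr (s * v.1, s * v.2) f p)%R <= B)%E) ->
  (nrm2 (fun p => f p - avg v f p)%R <= B)%E.
Proof.
move=> cf H.
have -> : (fun p => f p - avg v f p) = mean (fun q =>
    f q.2 - f (q.2.1, (q.2.2.1 + q.1 * v.1, q.2.2.2 + q.1 * v.2))).
  apply/funext => p; rewrite /mean /avg /= itvintB; [|by cont|by cont].
  by rewrite itvint_cst// subr0 mul1r.
by apply: nrm2_mean_le; first by cont.
Qed.

(** By Jensen the left side is at most the integral of [tint w] over the [a] by [b] rectangle with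
    corner [x], which is then enlarged to the plane. *)
Lemma bernstein (a b : R) w x : 0 < a -> 0 < b -> continuous w ->
  ((a * b * tint (avg (a, 0%R) (avg (0%R, b) w)) x)%:E <= nrm2 w)%E.
Proof.
move=> a0 b0 cw; have ct := continuous_tint cw.
pose T (q : X) := tint w (x.1 + a * q.1, x.2 + b * q.2).
have cT : continuous T by rewrite /T; cont.
have mT : measurable_fun setT (EFin \o tint w) by apply/measurable_EFinP; exact: measurable_tint.
have T0 q : (0 <= (EFin \o tint w) q)%E by rewrite lee_fin tint_ge0.
have an0 : a != 0 by rewrite gt_eqF.
have bn0 : b != 0 by rewrite gt_eqF.
rewrite /nrm2 -(@integral_affine2 R x (a, b) _ an0 bn0 mT T0) /=.
have ab0 : 0 <= a * b by rewrite mulr_ge0 ?ltW.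
rewrite (ger0_norm ab0) [leLHS]EFinM; apply: lee_wpmul2l; first by rewrite lee_fin.
have mTe : measurable_fun setT (EFin \o T) by apply/measurable_EFinP; exact: measurable_continuous2.
have Te0 q : (0 <= (EFin \o T) q)%E by rewrite lee_fin tint_ge0.
rewrite [leRHS](plane_tonelli mTe Te0).
have ciT : continuous (fun r => itvint 0 1 (fun q => T (r, q))).
  exact: (continuous_itvint ler01 cT).
apply: (@le_trans _ _ (itvint 0 1 (fun r => itvint 0 1 (fun q => T (r, q))))%:E).
  rewrite lee_fin.
  apply: le_trans (tint_avg_le _ _ (continuous_avg cw)) _ => /=.
  have cta : continuous (tint (avg (0, b) w)) by apply: continuous_tint; exact: continuous_avg.
  apply: le_itvint => //; first by cont.
  move=> r _; apply: le_trans (tint_avg_le _ _ cw) _ => /=.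
  rewrite le_eqVlt; apply/orP; left; apply/eqP; apply: eq_itvint => q _.
  by rewrite /T /=; congr tint; congr (_, _); ring.
rewrite itvint_EFin//.
have mF : measurable_fun setT (fun r => \int[leb]_q (T (r, q))%:E)%E.
  exact: (measurable_fun_fubini_tonelli_F (m2 := leb) _ mTe Te0).
have F0 r : (0 <= \int[leb]_q (T (r, q))%:E)%E.
  by apply: integral_EFin_ge0 => q; exact: tint_ge0.
apply: (@le_trans _ _ (\int[leb]_(r in `[0%R, 1%R]) \int[leb]_q (T (r, q))%:E)%E).
  apply: ge0_le_integral => //.
  - by move=> r _; rewrite lee_fin; apply: itvint_ge0 => q _; exact: tint_ge0.
  - apply: measurable_funTS; apply/measurable_EFinP; exact: measurable_continuous.
  - exact: measurable_funTS.
  move=> r _; rewrite itvint_EFin; last by cont.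
  apply: ge0_subset_integral => //.
  - by apply/measurable_EFinP; apply: measurable_continuous; cont.
  - by move=> q _; rewrite lee_fin tint_ge0.
by apply: ge0_subset_integral.
Qed.

End Averages.

(** * Decomposition by averages over dyadic squares *)

Section DyadicDecomposition.
Context {R : realType}.
Local Notation leb2 := (@plane_measure R).
Local Notation X := (R * R)%type.
Local Notation Y := (R * (R * R))%type.
Implicit Types (f g w : Y -> R) (u v : X) (p : Y) (x : X) (m n : nat).

Definition step m : R := 2^-1 ^+ m.

Lemma step_gt0 m : 0 < step m.
Proof. by rewrite exprn_gt0// invr_gt0. Qed.

Lemma stepS m : 2 * step m.+1 = step m.
Proof. by rewrite /step exprS mulrA divff ?mul1r// pnatr_eq0. Qed.

Definition ax (j : bool) (s : R) : X := if j then (0, s) else (s, 0).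

Definition opp2 v : X := (- v.1, - v.2).

Lemma opp2_ax j s : opp2 (ax j (- s)) = ax j s.
Proof. by case: j; rewrite /opp2 /= opprK oppr0. Qed.

Lemma ax_double j s : (2 * (ax j s).1, 2 * (ax j s).2) = ax j (2 * s).
Proof. by case: j; rewrite /= mulr0. Qed.

Definition avg2 (s : R) f := avg (ax false s) (avg (ax true s) f).
(** [analysis] and [synthesis] average over squares on opposite sides of the point, which makes each
    the adjoint of the other. *)
Definition analysis m f := avg2 (- step m) f.
Definition synthesis m f := avg2 (step m) f.

Local Ltac cts :=
  lazymatch goal with
  | |- continuous (avg _ _) => apply: continuous_avg; cts
  | |- continuous (hsum _ _) => apply: continuous_hsum; cts
  | |- continuous (hdiff _ _) => apply: continuous_hdiff; cts
  | |- continuous (tr _ _) => apply: continuous_tr; cts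
  | |- continuous _ => assumption
  end.

Lemma continuous_avg2 s f : continuous f -> continuous (avg2 s f).
Proof. by move=> cf; do 2 apply: continuous_avg. Qed.

Lemma avg2_hsum s u f : continuous f -> avg2 s (hsum u f) = hsum u (avg2 s f).
Proof. by move=> cf; rewrite /avg2 !avg_hsum//; exact: continuous_avg. Qed.

Lemma avg2_hdiff s u f : continuous f -> avg2 s (hdiff u f) = hdiff u (avg2 s f).
Proof. by move=> cf; rewrite /avg2 !avg_hdiff//; exact: continuous_avg. Qed.

Lemma avg2B s f g : continuous f -> continuous g ->
  avg2 s (fun p => f p - g p) = (fun p => avg2 s f p - avg2 s g p).
Proof. by move=> cf cg; rewrite /avg2 !avgB//; exact: continuous_avg. Qed.

Lemma avg2_avg s v f : continuous f -> avg2 s (avg v f) = avg v (avg2 s f).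
Proof.
move=> cf; rewrite /avg2 (avg_comm (ax true s) v cf) (@avg_comm _ _ v)//.
by cts.
Qed.

Lemma avg2_double s f : continuous f ->
  avg2 (2 * s) f = hsum (ax false s) (hsum (ax true s) (avg2 s f)).
Proof.
move=> cf; rewrite /avg2 -!ax_double avg_double; last exact: continuous_avg.
by rewrite avg_double// avg_hsum//; exact: continuous_avg.
Qed.

Lemma nrm2_avg2_le s f : continuous f -> (nrm2 (avg2 s f) <= nrm2 f)%E.
Proof.
move=> cf; apply: le_trans (nrm2_avg_le _ cf); apply: nrm2_avg_le.
exact: continuous_avg.
Qed.

Lemma analysisS m f : continuous f -> analysis m f =
  hsum (ax false (- step m.+1)) (hsum (ax true (- step m.+1)) (analysis m.+1 f)).
Proof. by move=> cf; rewrite /analysis -(avg2_double _ cf) mulrN stepS. Qed.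

Lemma synthesisS m f : continuous f -> synthesis m f =
  hsum (ax false (step m.+1)) (hsum (ax true (step m.+1)) (synthesis m.+1 f)).
Proof. by move=> cf; rewrite /synthesis -(avg2_double _ cf) stepS. Qed.

Definition detail (j : bool) m f := hdiff (ax j (- step m)) (analysis m f).

Lemma continuous_analysis m f : continuous f -> continuous (analysis m f).
Proof. exact: continuous_avg2. Qed.

Lemma continuous_synthesis m f : continuous f -> continuous (synthesis m f).
Proof. exact: continuous_avg2. Qed.

Lemma continuous_detail j m f : continuous f -> continuous (detail j m f).
Proof. by move=> cf; apply: continuous_hdiff; exact: continuous_analysis. Qed.

(** The next coarser average is obtained by a half-sum along each axis. The two commute, so the one
    along [j] may be kept for the parallelogram identity while the other only decreases the norm. *)
Lemma detail_step j m f : continuous f ->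
  (nrm2 (detail j m.+1 f) + nrm2 (analysis m f) <= nrm2 (analysis m.+1 f))%E.
Proof.
move=> cf; have ca := @continuous_analysis m.+1 _ cf.
have H : (nrm2 (analysis m f) <= nrm2 (hsum (ax j (- step m.+1)) (analysis m.+1 f)))%E.
  rewrite (analysisS _ cf); case: j; last rewrite hsumC.
    by apply: nrm2_hsum_le; cts.
  by apply: nrm2_hsum_le; cts.
have E := nrm2_parallelogram (ax j (- step m.+1)) ca.
move: H E; rewrite /detail.
generalize (nrm2 (analysis m f)) (nrm2 (analysis m.+1 f)).
move=> a b; generalize (nrm2 (hdiff (ax j (- step m.+1)) (analysis m.+1 f))) => d H <-.
by rewrite addeC; exact: (leeD H (lexx d)).
Qed.

(* By the parallelogram identity each detail is paid for by the increase of
   [nrm2 (analysis m f)], so the sum telescopes. *)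
Lemma detail_square_sum j M f : continuous f ->
  (\sum_(m < M) nrm2 (detail j m.+1 f) <= nrm2 f)%E.
Proof.
move=> cf; apply: (@le_trans _ _ (nrm2 (analysis M f))); last exact: nrm2_avg2_le.
apply: (@le_trans _ _ (\sum_(m < M) nrm2 (detail j m.+1 f) + nrm2 (analysis 0 f))%E).
  by rewrite leeDl// nrm2_ge0.
elim: M => [|M IH]; first by rewrite big_ord0 add0e.
rewrite big_ord_recr /= addeAC; apply: le_trans (detail_step j M cf).
rewrite (addeC (nrm2 _)).
exact: (leeD IH (lexx (nrm2 (detail j M.+1 f)))).
Qed.

Definition backdiff (j : bool) m f := hdiff (ax j (step m)) (detail j m f).

Definition backsum (j : bool) m f :=
  hsum (ax j (step m)) (hsum (ax j (- step m)) f).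

(* Chosen so that [synthesis m (piece m f)] is the increment of
   [lowpass m f = synthesis m (analysis m f)]; see [lowpassS]. *)
Definition piece m f : Y -> R :=
  if m is m'.+1 then
    (fun p => backdiff false m f p + backsum false m (backdiff true m f) p)
  else analysis 0 f.

Lemma continuous_backdiff j m f : continuous f -> continuous (backdiff j m f).
Proof. by move=> cf; apply: continuous_hdiff; exact: continuous_detail. Qed.

Lemma continuous_backsum j m f : continuous f -> continuous (backsum j m f).
Proof. by move=> cf; do 2 apply: continuous_hsum. Qed.

Lemma continuous_piece m f : continuous f -> continuous (piece m f).
Proof.
case: m => [|m] cf; first exact: continuous_analysis.
have c1 := @continuous_backdiff false m.+1 _ cf.
have c2 := @continuous_backsum false m.+1 _ (@continuous_backdiff true m.+1 _ cf).
rewrite /piece; cont.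
Qed.

Definition lowpass m f := synthesis m (analysis m f).

Lemma hsumB v f g : hsum v (fun p => f p - g p) = (fun p => hsum v f p - hsum v g p).
Proof. by apply/funext => p; rewrite /hsum /tr; ring. Qed.

Lemma backsum_diffK j m f p : backsum j m f p = f p -
  hdiff (ax j (step m)) (hdiff (ax j (- step m)) f) p.
Proof.
have := hdiff_hsumK (ax j (- step m)) f p.
rewrite -/(opp2 _) opp2_ax -/(backsum j m f p) => E.
by rewrite -[in RHS]E /backsum addrC addKr.
Qed.

(** With [A_j] for [backsum j], the increment is [1 - A_false A_true] placed between analysis and
    synthesis. It splits as [(1 - A_false) + A_false (1 - A_true)], and each [1 - A_j] is a product
    of two opposite differences by [backsum_diffK]. *)
Lemma lowpassS m f : continuous f ->
  lowpass m.+1 f = (fun p => lowpass m f p + synthesis m.+1 (piece m.+1 f) p).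
Proof.
move=> cf; set F := analysis m.+1 f.
have cF : continuous F := @continuous_analysis m.+1 _ cf.
have E : lowpass m f = synthesis m.+1 (backsum false m.+1 (backsum true m.+1 F)).
  rewrite /lowpass (synthesisS _ (@continuous_analysis m _ cf)) (analysisS _ cf).
  rewrite -/F /synthesis /backsum.
  rewrite avg2_hsum; last by cts.
  rewrite (avg2_hsum _ _ cF).
  rewrite avg2_hsum; last by cts.
  rewrite avg2_hsum; last by cts.
  rewrite avg2_hsum; last by cts.
  rewrite (avg2_hsum _ _ cF).
  by rewrite (hsumC (ax true (step m.+1)) (ax false (- step m.+1))).
have cp := @continuous_piece m.+1 _ cf.
have cb : continuous (backsum false m.+1 (backsum true m.+1 F)).
  by do 2 apply: continuous_backsum.
have P : piece m.+1 f = (fun p => F p - backsum false m.+1 (backsum true m.+1 F) p).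
  apply/funext => p; rewrite /piece.
  have -> : backsum true m.+1 F = (fun q => F q - backdiff true m.+1 f q).
    by apply/funext => q; rewrite backsum_diffK.
  have -> : backsum false m.+1 (fun q => F q - backdiff true m.+1 f q) p =
      backsum false m.+1 F p - backsum false m.+1 (backdiff true m.+1 f) p.
    by rewrite /backsum !hsumB.
  by rewrite (backsum_diffK false m.+1 F) /backdiff /detail -/F; ring.
apply/funext => p; rewrite E P /synthesis avg2B// -/(synthesis m.+1 F).
by rewrite addrC subrK.
Qed.

Lemma lowpass_sum M f : continuous f ->
  lowpass M f = (fun p => \sum_(m < M.+1) synthesis m (piece m f) p).
Proof.
move=> cf; elim: M => [|M IH].
  by apply/funext => p; rewrite big_ord_recl big_ord0 addr0.
by rewrite lowpassS// IH; apply/funext => p; rewrite [RHS]big_ord_recr.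
Qed.

Lemma nrm2_piece_le m f : continuous f ->
  (nrm2 (piece m.+1 f) <= 2%:E * nrm2 (backdiff false m.+1 f) +
     2%:E * nrm2 (backdiff true m.+1 f))%E.
Proof.
move=> cf; have c1 := @continuous_backdiff false m.+1 _ cf.
have c0 := @continuous_backdiff true m.+1 _ cf.
have c2 := @continuous_backsum false m.+1 _ c0.
apply: le_trans (nrm2D_le c1 c2) _; apply: leeD; first exact: lexx.
apply: lee_wpmul2l; first by rewrite lee_fin.
have ch := @continuous_hsum _ (ax false (- step m.+1)) _ c0.
exact: le_trans (nrm2_hsum_le _ ch) (nrm2_hsum_le _ c0).
Qed.

Lemma nrm2_backdiff_le j m f : continuous f ->
  (nrm2 (backdiff j m f) <= nrm2 (detail j m f))%E.
Proof. by move=> cf; apply: nrm2_hdiff_le; exact: continuous_detail. Qed.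

(** Integrated form of [g] being the derivative of [f] along axis [j], the spatial companion of
    [primitive]. Steps go backwards, as the averages in [analysis] do. *)
Definition slope (j : bool) f g := forall s : R, 0 <= s ->
  forall p, f p - tr (ax j (- s)) f p = s * avg (ax j (- s)) g p.

Lemma hdiffZ v (c : R) f :
  hdiff v (fun p => c * f p) = (fun p => c * hdiff v f p).
Proof. by apply/funext => p; rewrite /hdiff /tr; ring. Qed.

Lemma hdiff_opp v f : hdiff (opp2 v) f = (fun p => -1 * tr (opp2 v) (hdiff v f) p).
Proof.
apply/funext => p; rewrite /hdiff /tr /opp2 /= !subrK -!surjective_pairing.
by ring.
Qed.

Lemma nrm2_hdiff_opp v f : continuous f -> nrm2 (hdiff (opp2 v) f) = nrm2 (hdiff v f).
Proof.
move=> cf; have cd := @continuous_hdiff _ v _ cf.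
rewrite hdiff_opp nrm2Z; last exact: continuous_tr.
by rewrite sqrrN expr1n mul1e nrm2_tr.
Qed.

(** Two differences along the same axis are available. One is traded for the derivative and gains
    [step m]; the other is kept, so that a detail of [g] remains and the bound stays square summable
    in [m]. *)
Lemma nrm2_backdiff_slope j m f g : continuous f -> continuous g -> slope j f g ->
  (nrm2 (backdiff j m f) <= ((step m / 2) ^+ 2)%:E * nrm2 (detail j m g))%E.
Proof.
move=> cf cg fg; set v := ax j (- step m).
have cag : continuous (avg v (analysis m g)).
  by apply: continuous_avg; exact: continuous_analysis.
have E : detail j m f = (fun p => step m / 2 * avg v (analysis m g) p).
  rewrite /detail /analysis -(avg2_hdiff _ _ cf).
  have -> : hdiff v f = (fun p => step m / 2 * avg v g p).
    by apply/funext => p; rewrite /hdiff fg ?ltW ?step_gt0//; field.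
  rewrite /avg2 avgZ; last by cts.
  rewrite avgZ; last by cts.
  have := avg2_avg (- step m) v cg; rewrite /analysis /avg2 => ->; reflexivity.
rewrite /backdiff E.
have -> : hdiff (ax j (step m)) (fun p => step m / 2 * avg v (analysis m g) p) =
    (fun p => step m / 2 * avg v (hdiff (ax j (step m)) (analysis m g)) p).
  by rewrite (avg_hdiff v (ax j (step m)) (@continuous_analysis m _ cg)) hdiffZ.
rewrite nrm2Z; last first.
  by apply: continuous_avg; apply: continuous_hdiff; exact: continuous_analysis.
apply: lee_wpmul2l; first by rewrite lee_fin sqr_ge0.
apply: le_trans (nrm2_avg_le _ _) _.
  by apply: continuous_hdiff; exact: continuous_analysis.
have E2 := nrm2_hdiff_opp (ax j (- step m)) (@continuous_analysis m _ cg).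
rewrite opp2_ax in E2.
by rewrite le_eqVlt; apply/orP; left; apply/eqP; exact: E2.
Qed.

(** A short difference of an average over a long segment cancels in the middle: what remains are two
    short averages at the ends, a long distance apart. *)
Lemma hdiff_avg_pow n v f : continuous f ->
  hdiff v (avg (2 ^+ n * v.1, 2 ^+ n * v.2) f) =
  (fun p => step n * hdiff (2 ^+ n * v.1, 2 ^+ n * v.2) (avg v f) p).
Proof.
move=> cf; elim: n => [|n IH].
  by rewrite /step !expr0 !mul1r -surjective_pairing; apply/funext => p; rewrite mul1r.
set u : X := (2 ^+ n * v.1, 2 ^+ n * v.2).
have -> : (2 ^+ n.+1 * v.1, 2 ^+ n.+1 * v.2) = (2 * u.1, 2 * u.2) :> X.
  by rewrite /u /= !exprS !mulrA.
rewrite (avg_double _ cf) -hsum_hdiffC IH -/u; apply/funext => p.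
rewrite -(stepS n) /hsum /hdiff /tr /=.
have -> : p.2.1 + u.1 + u.1 = p.2.1 + 2 * u.1 by ring.
have -> : p.2.2 + u.2 + u.2 = p.2.2 + 2 * u.2 by ring.
by field.
Qed.

Lemma ax_pow j m n : (2 ^+ n * (ax j (step (m + n))).1, 2 ^+ n * (ax j (step (m + n))).2) =
  ax j (step m).
Proof.
have E : 2 ^+ n * step (m + n) = step m.
  by rewrite /step exprD mulrCA -exprMn divff ?pnatr_eq0// expr1n mulr1.
by case: j; rewrite /= E mulr0.
Qed.

(** The gain [step n] is paid for by the box, whose side along [j] shrinks to [step (m + n)]. *)
Lemma hdiff_synthesis j m n w : continuous w ->
  hdiff (ax j (step (m + n))) (synthesis m w) =
  (fun p => step n * hdiff (ax j (step m))
     (avg (ax false (step (if j then m else m + n)))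
     (avg (ax true (step (if j then m + n else m))) w)) p).
Proof.
move=> cw; rewrite /synthesis /avg2; case: j.
  rewrite -avg_hdiff; last by cts.
  have -> : avg (ax true (step m)) w = avg (2 ^+ n * (ax true (step (m + n))).1,
    2 ^+ n * (ax true (step (m + n))).2) w by rewrite ax_pow.
  rewrite (hdiff_avg_pow _ _ cw) ax_pow avgZ; last by cts.
  by rewrite avg_hdiff//; cts.
have -> : avg (ax false (step m)) (avg (ax true (step m)) w) =
  avg (2 ^+ n * (ax false (step (m + n))).1, 2 ^+ n * (ax false (step (m + n))).2)
    (avg (ax true (step m)) w) by rewrite ax_pow.
by rewrite hdiff_avg_pow ?ax_pow//; cts.
Qed.

Lemma tint_hdiff_le v f x (B : \bar R) : continuous f ->
  (forall y, (tint f y)%:E <= B)%E -> ((tint (hdiff v f) x)%:E <= B)%E.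
Proof.
move=> cf fB; have ct := @continuous_tr _ v _ cf.
have : tint (hdiff v f) x <= Num.max (tint f x) (tint (tr v f) x).
  apply: (@le_trans _ _ (2^-1 * tint f x + 2^-1 * tint (tr v f) x)).
    have cd := @continuous_hdiff _ v _ cf.
    have cfx := @continuous_time _ _ x cf; have ctx := @continuous_time _ _ x ct.
    have cdx := @continuous_time _ _ x cd.
    rewrite /tint -itvintZ; [|by cont]; rewrite -itvintZ; [|by cont].
    rewrite -itvintD; [|by cont|by cont].
    apply: le_itvint; [by cont|by cont|] => t _; rewrite /hdiff.
    by have := sqr_ge0 (f (t, x) + tr v f (t, x)); nra.
  by case: (leP (tint f x) (tint (tr v f) x)) => h; lra.
rewrite -lee_fin => /le_trans; apply.
case: (leP (tint f x) (tint (tr v f) x)) => _; last exact: fB.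
have := fB (x.1 + v.1, x.2 + v.2); rewrite /tint /tr /=. exact.
Qed.

Lemma tint_rect_le m n w x : continuous w ->
  ((tint (avg (ax false (step m)) (avg (ax true (step n)) w)) x)%:E <=
   ((step m * step n)^-1)%:E * nrm2 w)%E.
Proof.
move=> cw; have m0 := step_gt0 m; have n0 := step_gt0 n.
have mn0 : 0 < step m * step n by exact: mulr_gt0.
have := bernstein x m0 n0 cw; rewrite EFinM => H.
have := lee_wpmul2l (_ : 0 <= ((step m * step n)^-1)%:E)%E H.
rewrite lee_fin invr_ge0 ltW// => /(_ isT).
rewrite muleA -EFinM mulVf; last by rewrite gt_eqF.
by rewrite mul1r.
Qed.

Lemma synthesis_sup m w x : continuous w ->
  ((tint (synthesis m w) x)%:E <= ((step m * step m)^-1)%:E * nrm2 w)%E.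
Proof. exact: tint_rect_le. Qed.

Lemma hdiff_synthesis_nrm2 j m n w : continuous w ->
  (nrm2 (hdiff (ax j (step (m + n))) (synthesis m w)) <= (step n ^+ 2)%:E * nrm2 w)%E.
Proof.
move=> cw; rewrite hdiff_synthesis// nrm2Z; last first.
  by apply: continuous_hdiff; do 2 apply: continuous_avg.
apply: lee_wpmul2l; first by rewrite lee_fin sqr_ge0.
apply: le_trans (nrm2_hdiff_le _ _) _; first by do 2 apply: continuous_avg.
by apply: le_trans (nrm2_avg_le _ _) _; [exact: continuous_avg|exact: nrm2_avg_le].
Qed.

(** The Bernstein bound on the thin box is worse by the inverse of [step n], so one of the two
    factors [step n] gained in the square survives. *)
Lemma hdiff_synthesis_sup j m n w x : continuous w ->
  ((tint (hdiff (ax j (step (m + n))) (synthesis m w)) x)%:E <=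
   (step n * (step m * step m)^-1)%:E * nrm2 w)%E.
Proof.
move=> cw; rewrite hdiff_synthesis// tintZ; last first.
  by apply: continuous_hdiff; do 2 apply: continuous_avg.
have H : ((tint (hdiff (ax j (step m))
     (avg (ax false (step (if j then m else m + n)))
     (avg (ax true (step (if j then m + n else m))) w))) x)%:E <=
     ((step m * step (m + n))^-1)%:E * nrm2 w)%E.
  apply: tint_hdiff_le; first by do 2 apply: continuous_avg.
  by move=> y; case: (j); [exact: tint_rect_le|rewrite mulrC; exact: tint_rect_le].
rewrite EFinM; apply: le_trans (lee_wpmul2l _ H) _; first by rewrite lee_fin sqr_ge0.
rewrite muleA -EFinM; apply: lee_wpmul2r; first exact: nrm2_ge0.
rewrite lee_fin /step exprD -!/(step _).
have n0 := step_gt0 n; have m0 := step_gt0 m.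
rewrite le_eqVlt; apply/orP; left; apply/eqP; field.
by rewrite !gt_eqF.
Qed.

End DyadicDecomposition.

(** * Estimates for pairs of dyadic pieces *)

Section PairEstimates.
Context {R : realType}.
Local Notation leb2 := (@plane_measure R).
Local Notation X := (R * R)%type.
Local Notation Y := (R * (R * R))%type.
Implicit Types (a b f g w : Y -> R) (u v : X) (p : Y) (x : X) (m n k l : nat).

Definition tprimitive f g :=
  forall x, primitive (fun t => f (t, x)) (fun t => g (t, x)).

Lemma tprimitive_tr v f g : tprimitive f g -> tprimitive (tr v f) (tr v g).
Proof. by move=> fg x; exact: (fg (x.1 + v.1, x.2 + v.2)). Qed.

Lemma tprimitiveD f g a b : continuous g -> continuous b ->
  tprimitive f g -> tprimitive a b ->
  tprimitive (fun p => f p + a p) (fun p => g p + b p).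
Proof.
move=> cg cb fg ab x t t01.
rewrite (fg x t t01) (ab x t t01) itvintD; first by ring.
  exact: (@continuous_time _ _ x cg).
exact: (@continuous_time _ _ x cb).
Qed.

Lemma tprimitiveZ (c : R) f g : continuous g -> tprimitive f g ->
  tprimitive (fun p => c * f p) (fun p => c * g p).
Proof.
move=> cg fg x t t01; rewrite (fg x t t01) itvintZ; first by ring.
exact: (@continuous_time _ _ x cg).
Qed.

Lemma tprimitiveB f g a b : continuous g -> continuous b ->
  tprimitive f g -> tprimitive a b ->
  tprimitive (fun p => f p - a p) (fun p => g p - b p).
Proof.
move=> cg cb fg ab x t t01.
rewrite (fg x t t01) (ab x t t01) itvintB; first by ring.
  exact: (@continuous_time _ _ x cg).
exact: (@continuous_time _ _ x cb).
Qed.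

Lemma tprimitive_hdiff v f g : continuous g -> tprimitive f g ->
  tprimitive (hdiff v f) (hdiff v g).
Proof.
move=> cg fg; have ct := @continuous_tr _ v _ cg.
apply: tprimitiveZ; first by cont.
by apply: tprimitiveB => //; exact: tprimitive_tr.
Qed.

Lemma tprimitive_hsum v f g : continuous g -> tprimitive f g ->
  tprimitive (hsum v f) (hsum v g).
Proof.
move=> cg fg; have ct := @continuous_tr _ v _ cg.
apply: tprimitiveZ; first by cont.
by apply: tprimitiveD => //; exact: tprimitive_tr.
Qed.

Lemma tprimitive_avg v f g : continuous f -> continuous g -> tprimitive f g ->
  tprimitive (avg v f) (avg v g).
Proof.
move=> cf cg fg x t /andP[t0 t1]; rewrite /avg /=.
have cG : continuous (fun q : R * R => g (q.1, (x.1 + q.2 * v.1, x.2 + q.2 * v.2))) by cont.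
have cF (r : R) : continuous (fun s : R => f (r, (x.1 + s * v.1, x.2 + s * v.2))) by cont.
have -> : itvint 0 t (fun r => itvint 0 1 (fun s => g (r, (x.1 + s * v.1, x.2 + s * v.2)))) =
  itvint 0 1 (fun s => itvint 0 t (fun r => g (r, (x.1 + s * v.1, x.2 + s * v.2)))).
  exact: (itvint_swap t0 ler01 cG).
rewrite -itvintD; [|exact: cF|].
  apply: eq_itvint => s _.
  by rewrite (fg (x.1 + s * v.1, x.2 + s * v.2) t)// t0.
have cG' : continuous (fun q : R * R => g (q.2, (x.1 + q.1 * v.1, x.2 + q.1 * v.2))) by cont.
exact: (continuous_itvint t0 cG').
Qed.

Definition slice_energy m f f' x : R := (2 ^+ m) ^+ 2 * tint f x + tint f' x.

Lemma slice_energyE m f f' x :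
  slice_energy m f f' x = energy (2 ^+ m) (fun t => f (t, x)) (fun t => f' (t, x)).
Proof. by []. Qed.

Lemma slice_energy_ge0 m f f' x : 0 <= slice_energy m f f' x.
Proof. exact: energy_ge0. Qed.

Lemma measurable_slice_energy m f f' : continuous f -> continuous f' ->
  measurable_fun setT (slice_energy m f f').
Proof.
move=> cf cf'; have c1 := continuous_tint cf; have c2 := continuous_tint cf'.
by apply: measurable_continuous2; rewrite /slice_energy; cont.
Qed.

Lemma integral_slice_energy m f f' : continuous f -> continuous f' ->
  (\int[leb2]_x (slice_energy m f f' x)%:E =
   ((2 ^+ m) ^+ 2)%:E * nrm2 f + nrm2 f')%E.
Proof.
move=> cf cf'; have m1 := measurable_tint cf; have m2 := measurable_tint cf'.
have p0 : 0 <= (2 ^+ m) ^+ 2 :> R by exact: sqr_ge0.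
rewrite /slice_energy (@integral_EFinD _ _ R leb2 (fun x => (2 ^+ m) ^+ 2 * tint f x)); last 4 first.
- exact: measurable_funM.
- exact: m2.
- by move=> x; rewrite mulr_ge0// tint_ge0.
- exact: tint_ge0.
by rewrite (@integral_EFinZl _ _ R leb2 _ (tint f) m1 p0 (@tint_ge0 _ f)).
Qed.

(* A function at frequency [2 ^ m] whose energy at that scale, including the
   Bernstein gain in the supremum, is at most [c]; [f'] is its time derivative. *)
Definition band m (c : R) f f' :=
  [/\ [/\ continuous f, continuous f' & tprimitive f f'],
      (\int[leb2]_x (slice_energy m f f' x)%:E <= c%:E)%E
    & forall x, slice_energy m f f' x <= (2 ^+ m) ^+ 2 * c].

Lemma band_ge0 m c f f' : band m c f f' -> 0 <= c.
Proof.
case=> _ H _; rewrite -lee_fin; apply: le_trans H.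
by apply: integral_EFin_ge0 => x; exact: slice_energy_ge0.
Qed.

Lemma slice_energy_tr v m f f' x :
  slice_energy m (tr v f) (tr v f') x = slice_energy m f f' (x + v).
Proof. by []. Qed.

Lemma band_tr v m c f f' : band m c f f' -> band m c (tr v f) (tr v f').
Proof.
move=> [[cf cf' ff'] H1 H2]; split.
- by split; [exact: continuous_tr|exact: continuous_tr|exact: tprimitive_tr].
- rewrite (integral_slice_energy m (@continuous_tr _ v _ cf) (@continuous_tr _ v _ cf')).
  by rewrite (nrm2_tr v cf) (nrm2_tr v cf') -(integral_slice_energy m cf cf').
- by move=> x; rewrite slice_energy_tr; exact: H2.
Qed.

Lemma stepK m : step m * 2 ^+ m = 1 :> R.
Proof. by rewrite /step -exprMn mulVf ?pnatr_eq0// expr1n. Qed.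

Lemma stepE m : step m = (2 ^+ m)^-1 :> R.
Proof. by rewrite /step exprVn. Qed.

Lemma step_le1 m : step m <= 1 :> R.
Proof. by rewrite /step exprn_ile1// ?invr_ge0// invf_le1 ?ler1n. Qed.

Lemma stepD m n : step (m + n) = step m * step n :> R.
Proof. exact: exprD. Qed.

(** Bernstein on a square of side [step m] loses exactly the factor [(2 ^+ m) ^+ 2] allowed in the
    supremum by [band]; the gain [s] is carried through both bounds. *)
Lemma band_of_bounds m (c s : R) f f' w w' : 0 <= s ->
  continuous f -> continuous f' -> tprimitive f f' ->
  (((2 ^+ m) ^+ 2)%:E * nrm2 w + nrm2 w' <= c%:E)%E ->
  (nrm2 f <= s%:E * nrm2 w)%E -> (nrm2 f' <= s%:E * nrm2 w')%E ->
  (forall x, (tint f x)%:E <= (s * (step m * step m)^-1)%:E * nrm2 w)%E ->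
  (forall x, (tint f' x)%:E <= (s * (step m * step m)^-1)%:E * nrm2 w')%E ->
  band m (s * c) f f'.
Proof.
move=> s0 cf cf' ff' H h1 h2 h3 h4.
have p0 : (0 <= ((2 ^+ m) ^+ 2 : R)%:E)%E by rewrite lee_fin sqr_ge0.
have s0' : (0 <= s%:E)%E by rewrite lee_fin.
have N1 : (0 <= ((2 ^+ m) ^+ 2)%:E * nrm2 w)%E by apply: mule_ge0 => //; exact: nrm2_ge0.
have N2 := nrm2_ge0 w'.
split; first by [].
  rewrite (integral_slice_energy m cf cf').
  apply: (@le_trans _ _ (s%:E * (((2 ^+ m) ^+ 2)%:E * nrm2 w + nrm2 w'))%E); last first.
    by rewrite [leRHS]EFinM; apply: lee_wpmul2l.
  rewrite (ge0_muleDr s%:E N1 N2).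
  apply: leeD; last exact: h2.
  by rewrite (muleCA s%:E); exact: (lee_wpmul2l p0 h1).
move=> x; rewrite -lee_fin /slice_energy EFinD EFinM.
pose q : R := s * (step m * step m)^-1.
have q0 : (0 <= q%:E)%E.
  by rewrite lee_fin mulr_ge0// invr_ge0 mulr_ge0// ltW// step_gt0.
apply: (@le_trans _ _ (q%:E * (((2 ^+ m) ^+ 2)%:E * nrm2 w + nrm2 w'))%E).
  rewrite (ge0_muleDr q%:E N1 N2).
  apply: leeD; last exact: h4.
  by rewrite (muleCA q%:E); exact: (lee_wpmul2l p0 (h3 x)).
apply: (@le_trans _ _ (q%:E * c%:E)%E); first exact: lee_wpmul2l.
rewrite -EFinM lee_fin /q stepE -invfM invrK.
by rewrite expr2 mulrAC mulrC mulrA.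
Qed.

Section SynthesisBand.
Variables (m : nat) (c : R) (w w' : Y -> R).
Hypothesis cw : continuous w.
Hypothesis cw' : continuous w'.
Hypothesis ww' : tprimitive w w'.
Hypothesis wc : (((2 ^+ m) ^+ 2)%:E * nrm2 w + nrm2 w' <= c%:E)%E.

Lemma tprimitive_synthesis : tprimitive (synthesis m w) (synthesis m w').
Proof.
rewrite /synthesis /avg2; apply: tprimitive_avg; last exact: tprimitive_avg.
  exact: continuous_avg.
exact: continuous_avg.
Qed.

Lemma band_synthesis : band m c (synthesis m w) (synthesis m w').
Proof.
rewrite -[c]mul1r.
have c1 := @continuous_synthesis _ m _ cw; have c2 := @continuous_synthesis _ m _ cw'.
apply: (band_of_bounds ler01 c1 c2 tprimitive_synthesis wc).
- by rewrite mul1e; exact: nrm2_avg2_le.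
- by rewrite mul1e; exact: nrm2_avg2_le.
- by move=> x; rewrite mul1r; exact: synthesis_sup.
- by move=> x; rewrite mul1r; exact: synthesis_sup.
Qed.

(** The L^2 bound would give [step n ^+ 2]; it is weakened to [step n] because the supremum gains no
    more. *)
Lemma band_hdiff_synthesis j n : band m (step n * c)
  (hdiff (ax j (step (m + n))) (synthesis m w))
  (hdiff (ax j (step (m + n))) (synthesis m w')).
Proof.
have c1 := @continuous_synthesis _ m _ cw; have c2 := @continuous_synthesis _ m _ cw'.
have s0 := ltW (@step_gt0 R n).
have ss : step n ^+ 2 <= step n :> R by rewrite expr2 ler_piMr// step_le1.
apply: (band_of_bounds s0 _ _ _ wc).
- exact: continuous_hdiff.
- exact: continuous_hdiff.
- exact: (tprimitive_hdiff _ c2 tprimitive_synthesis).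
- apply: le_trans (hdiff_synthesis_nrm2 j m n cw) _.
  by apply: lee_wpmul2r; [exact: nrm2_ge0|rewrite lee_fin].
- apply: le_trans (hdiff_synthesis_nrm2 j m n cw') _.
  by apply: lee_wpmul2r; [exact: nrm2_ge0|rewrite lee_fin].
- by move=> x; exact: hdiff_synthesis_sup.
- by move=> x; exact: hdiff_synthesis_sup.
Qed.

End SynthesisBand.

Definition pairing a' b x : R := itvint 0 1 (fun t => a' (t, x) * b (t, x)).

Lemma continuous_pairing a' b : continuous a' -> continuous b ->
  continuous (pairing a' b).
Proof.
move=> ca cb.
have cF : continuous (fun q : X * R => a' (q.2, q.1) * b (q.2, q.1)) by cont.
exact: (continuous_itvint ler01 cF).
Qed.

Lemma measurable_pairing a' b : continuous a' -> continuous b ->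
  measurable_fun setT (pairing a' b).
Proof.
by move=> ca cb; apply: measurable_continuous2; exact: continuous_pairing.
Qed.

Lemma pairing_sqr_le m l a a' b b' x : continuous a -> continuous a' ->
  continuous b -> continuous b' -> tprimitive a a' -> tprimitive b b' ->
  pairing a' b x ^+ 2 <=
    57 * step (m + l) * (slice_energy m a a' x * slice_energy l b b' x).
Proof.
move=> ca ca' cb cb' aa' bb'; rewrite !slice_energyE stepE exprD.
apply: itvint_energy; rewrite ?exprn_ege1 ?ler1n//.
- exact: (@continuous_time _ _ x ca).
- exact: (@continuous_time _ _ x ca').
- exact: (@continuous_time _ _ x cb).
- exact: (@continuous_time _ _ x cb').
Qed.

Lemma pairing_L1 m l (c d : R) a a' b b' : continuous a -> continuous a' ->
  continuous b -> continuous b' -> tprimitive a a' -> tprimitive b b' ->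
  0 <= c -> 0 <= d ->
  (\int[leb2]_x (slice_energy m a a' x)%:E <= c%:E)%E ->
  (\int[leb2]_x (slice_energy l b b' x)%:E <= d%:E)%E ->
  (\int[leb2]_x `|pairing a' b x|%:E <= (Num.sqrt (57 * step (m + l) * (c * d)))%:E)%E.
Proof.
move=> ca ca' cb cb' aa' bb' c0 d0 Ba1 Bb1.
have ma := measurable_slice_energy m ca ca'; have mb := measurable_slice_energy l cb cb'.
have q0 : 0 <= 57 * step (m + l) :> R by rewrite mulr_ge0// ltW// step_gt0.
pose F x := Num.sqrt (57 * step (m + l) * slice_energy m a a' x).
pose G x := Num.sqrt (slice_energy l b b' x).
have F2 x : F x ^+ 2 = 57 * step (m + l) * slice_energy m a a' x.
  by rewrite sqr_sqrtr// mulr_ge0// slice_energy_ge0.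
have G2 x : G x ^+ 2 = slice_energy l b b' x by rewrite sqr_sqrtr// slice_energy_ge0.
have mF : measurable_fun setT F.
  apply: measurable_continuous2; have := continuous_tint ca; have := continuous_tint ca'.
  by move=> ? ?; rewrite /F /slice_energy; cont.
have mG : measurable_fun setT G.
  apply: measurable_continuous2; have := continuous_tint cb; have := continuous_tint cb'.
  by move=> ? ?; rewrite /G /slice_energy; cont.
apply: (@le_trans _ _ (\int[leb2]_x `|F x * G x|%:E)%E).
  apply: (@le_integral_EFin _ _ R leb2 (fun x => `|pairing a' b x|)) => //.
  - by apply: measurableT_comp => //; exact: measurable_pairing.
  - by apply: measurableT_comp => //; exact: measurable_funM.
  move=> x; rewrite -(@ler_pXn2r _ 2)// ?nnegrE//.
  rewrite !real_normK ?num_real// exprMn F2 G2 -[leRHS]mulrA.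
  exact: (@pairing_sqr_le m l a a' b b' x ca ca' cb cb' aa' bb').
rewrite mulrA; apply: (@integral_cauchy_schwarz _ _ R leb2) => //.
- by rewrite mulr_ge0.
- under eq_integral do rewrite F2.
  rewrite (@integral_EFinZl _ _ R leb2 _ _ ma q0 (@slice_energy_ge0 m a a')).
  by rewrite [leRHS]EFinM; apply: lee_wpmul2l; rewrite ?lee_fin.
- by under eq_integral do rewrite G2.
Qed.

Lemma pairing_band_L1 m l (c d : R) a a' b b' : band m c a a' -> band l d b b' ->
  (\int[leb2]_x `|pairing a' b x|%:E <= (Num.sqrt (57 * step (m + l) * (c * d)))%:E)%E.
Proof.
move=> Ba Bb; have c0 := band_ge0 Ba; have d0 := band_ge0 Bb.
case: Ba => [[ca ca' aa'] Ba1 _]; case: Bb => [[cb cb' bb'] Bb1 _].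
exact: (pairing_L1 ca ca' cb cb' aa' bb' c0 d0 Ba1 Bb1).
Qed.

(** The factor of lower frequency is taken in the supremum, at the cost of 4 to the smaller index.
    Against [step (m + l)] this leaves a decay in the distance of [m] and [l]. *)
Lemma pairing_L2 m l (c d : R) a a' b b' : band m c a a' -> band l d b b' ->
  (\int[leb2]_x (pairing a' b x ^+ 2)%:E <=
    (57 * step ((m - l) + (l - m)) * (c * d))%:E)%E.
Proof.
move=> Ba Bb; have c0 := band_ge0 Ba; have d0 := band_ge0 Bb.
case: Ba => [[ca ca' aa'] Ba1 Ba2]; case: Bb => [[cb cb' bb'] Bb1 Bb2].
have ma := measurable_slice_energy m ca ca'; have mb := measurable_slice_energy l cb cb'.
have q0 : 0 <= 57 * step (m + l) :> R by rewrite mulr_ge0// ltW// step_gt0.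
have mp : measurable_fun setT (fun x => pairing a' b x ^+ 2).
  by apply: measurable_funX; exact: measurable_pairing.
have P x := @pairing_sqr_le m l a a' b b' x ca ca' cb cb' aa' bb'.
have [ml|/ltnW lm] := leqP m l.
  have e0 : 0 <= 57 * step (m + l) * ((2 ^+ m) ^+ 2 * c).
    by rewrite mulr_ge0// mulr_ge0// sqr_ge0.
  apply: (@le_trans _ _ (\int[leb2]_x (57 * step (m + l) * ((2 ^+ m) ^+ 2 * c) *
      slice_energy l b b' x)%:E)%E).
    apply: (@le_integral_EFin _ _ R leb2 (fun x => pairing a' b x ^+ 2)) => //.
    - exact: measurable_funM.
    - by move=> x; exact: sqr_ge0.
    move=> x; apply: le_trans (P x) _; rewrite -[leRHS]mulrA ler_wpM2l//.
    by rewrite ler_wpM2r// slice_energy_ge0.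
  rewrite (@integral_EFinZl _ _ R leb2 _ _ mb e0 (@slice_energy_ge0 l b b')).
  apply: le_trans (lee_wpmul2l _ Bb1) _; first by rewrite lee_fin.
  rewrite -EFinM lee_fin (eqP (_ : (m - l == 0)%N)) ?subn_eq0// add0n.
  have -> : step (m + l) = step m * step m * step (l - m) :> R.
    by rewrite -!stepD -addnA subnKC.
  have k1 := stepK m.
  have -> : 57 * (step m * step m * step (l - m)) * ((2 ^+ m) ^+ 2 * c) * d =
    57 * step (l - m) * (c * d) * (step m * 2 ^+ m) ^+ 2 by ring.
  by rewrite k1 expr1n mulr1.
have e0 : 0 <= 57 * step (m + l) * ((2 ^+ l) ^+ 2 * d).
  by rewrite mulr_ge0// mulr_ge0// sqr_ge0.
apply: (@le_trans _ _ (\int[leb2]_x (57 * step (m + l) * ((2 ^+ l) ^+ 2 * d) *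
    slice_energy m a a' x)%:E)%E).
  apply: (@le_integral_EFin _ _ R leb2 (fun x => pairing a' b x ^+ 2)) => //.
  - exact: measurable_funM.
  - by move=> x; exact: sqr_ge0.
  move=> x; apply: le_trans (P x) _; rewrite -[leRHS]mulrA ler_wpM2l//.
  by rewrite mulrC ler_wpM2r// slice_energy_ge0.
rewrite (@integral_EFinZl _ _ R leb2 _ _ ma e0 (@slice_energy_ge0 m a a')).
apply: le_trans (lee_wpmul2l _ Ba1) _; first by rewrite lee_fin.
rewrite -EFinM lee_fin (eqP (_ : (l - m == 0)%N)) ?subn_eq0// addn0.
have -> : step (m + l) = step l * step l * step (m - l) :> R.
  by rewrite -!stepD -addnA subnKC// addnC.
have k1 := stepK l.
have -> : 57 * (step l * step l * step (m - l)) * ((2 ^+ l) ^+ 2 * d) * c =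
  57 * step (m - l) * (c * d) * (step l * 2 ^+ l) ^+ 2 by ring.
by rewrite k1 expr1n mulr1.
Qed.

(** Discrete Leibniz rule; the factor -2 undoes the normalisation and the sign of [hdiff]. *)
Lemma pairing_diff v a' b x : continuous a' -> continuous b ->
  pairing a' b (x + v) - pairing a' b x =
  - 2 * (pairing (hdiff v a') (tr v b) x + pairing a' (hdiff v b) x).
Proof.
move=> ca cb; have cta := @continuous_tr _ v _ ca; have ctb := @continuous_tr _ v _ cb.
have cda := @continuous_hdiff _ v _ ca; have cdb := @continuous_hdiff _ v _ cb.
have -> : pairing a' b (x + v) = pairing (tr v a') (tr v b) x by [].
have C f g : continuous f -> continuous g -> continuous (fun t : R => f (t, x) * g (t, x)).
  by move=> cf cg; cont.
rewrite /pairing -itvintB; [|exact: C|exact: C].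
rewrite -itvintD; [|exact: C|exact: C].
rewrite -itvintZ.
  by apply: eq_itvint => t _; rewrite /hdiff; field.
have := C _ _ cda ctb; have := C _ _ ca cdb => ? ?; exact: continuous_funD.
Qed.

Lemma pairing_diff_L2 v a' b (A B : R) : continuous a' -> continuous b ->
  (\int[leb2]_x (pairing (hdiff v a') (tr v b) x ^+ 2)%:E <= A%:E)%E ->
  (\int[leb2]_x (pairing a' (hdiff v b) x ^+ 2)%:E <= B%:E)%E ->
  (\int[leb2]_x ((pairing a' b (x + v)%R - pairing a' b x) ^+ 2)%:E <=
   (8 * (A + B))%:E)%E.
Proof.
move=> ca cb HA HB; have ctb := @continuous_tr _ v _ cb.
have cda := @continuous_hdiff _ v _ ca; have cdb := @continuous_hdiff _ v _ cb.
pose F x := pairing (hdiff v a') (tr v b) x ^+ 2.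
pose G x := pairing a' (hdiff v b) x ^+ 2.
have mF : measurable_fun setT F by apply: measurable_funX; exact: measurable_pairing.
have mG : measurable_fun setT G by apply: measurable_funX; exact: measurable_pairing.
have F0 x : 0 <= F x by exact: sqr_ge0.
have G0 x : 0 <= G x by exact: sqr_ge0.
apply: (@le_trans _ _ (\int[leb2]_x (8 * (F x + G x))%:E)%E).
  apply: (@le_integral_EFin _ _ R leb2 (fun x => (pairing a' b (x + v) - pairing a' b x) ^+ 2)).
  - apply: measurable_funX.
    under eq_fun do rewrite (pairing_diff v _ ca cb).
    by apply: measurable_funM => //; apply: measurable_funD; exact: measurable_pairing.
  - by apply: measurable_funM => //; exact: measurable_funD.
  - by move=> x; exact: sqr_ge0.
  move=> x; rewrite (pairing_diff v x ca cb) /F /G.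
  set s := pairing _ _ _; set r := pairing _ _ _.
  by have := sqr_ge0 (s - r); nra.
have H0 : (0 : R) <= 8 by [].
rewrite (@integral_EFinZl _ _ R leb2 8 (fun x => F x + G x)) //; last 2 first.
- exact: measurable_funD.
- by move=> x; rewrite addr_ge0.
rewrite (@integral_EFinD _ _ R leb2 F G)// EFinM.
by apply: lee_wpmul2l; rewrite ?lee_fin// EFinD; apply: leeD.
Qed.

End PairEstimates.

(** * Frequency projections of a pair of pieces *)

Section PairProjection.
Context {R : realType} (chi : plane R -> R).
Hypothesis hchi : LP_cutoff chi.
Local Notation leb2 := (@plane_measure R).
Local Notation X := (R * R)%type.
Local Notation Y := (R * (R * R))%type.
Implicit Types (F : X -> R) (x v : X) (k m l n : nat).

(** Removes by a limit the strict positivity of the L^1 bound demanded in [LPre_bounds]. *)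
Lemma le_EFin_of_gt (x : \bar R) (p a : R) : 0 <= p -> 0 <= a ->
  (forall e, 0 < e -> (x <= (p * (a + e) ^+ 2)%:E)%E) -> (x <= (p * a ^+ 2)%:E)%E.
Proof.
move=> p0 a0 H; apply/lee_addgt0Pr => e e0.
(* For [0 < h <= 1] the increase of [p * (a + h) ^+ 2] over [p * a ^+ 2] is at most [h * q]. *)
pose q := p * (2 * a + 1) + 1.
have q0 : 0 < q by rewrite /q ltr_wpDl// mulr_ge0// addr_ge0// mulr_ge0.
have h0 : 0 < Num.min 1 (e / q) by rewrite lt_min ltr01 divr_gt0.
apply: le_trans (H _ h0) _; rewrite -EFinD lee_fin.
set h := Num.min _ _ in h0 *.
have h1 : h <= 1 by rewrite /h ge_min lexx.
have h2 : h * q <= e by rewrite -ler_pdivlMr// /h ge_min lexx orbT.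
have : p * (h * h) <= p * h by rewrite ler_wpM2l// ler_piMr// ltW.
by rewrite /q in h2; nra.
Qed.

Lemma LPre_estimates : exists2 C : R, 0 <= C & forall (k : int) F,
  leb2.-integrable setT (EFin \o F) ->
  [/\ measurable_fun setT (LPre chi k F),
    forall a : R, 0 <= a -> (\int[leb2]_y `|F y|%:E <= a%:E)%E ->
      (\int[leb2]_x (LPre chi k F x ^+ 2)%:E <= (C * dyadic k ^+ 2 * a ^+ 2)%:E)%E /\
      (forall x, `|LPre chi k F x| <= C * dyadic k ^+ 2 * (a + 1))
  & forall a : R,
    (forall j, (\int[leb2]_y ((F (y + ax j (dyadic k)^-1)%R - F y) ^+ 2)%:E <= a%:E)%E) ->
    (\int[leb2]_x (LPre chi k F x ^+ 2)%:E <= (2 * C * a)%:E)%E].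
Proof.
have [C C0 H] := LPre_bounds hchi; exists C => // k F iF.
have [mF H1 H2] := H k F iF; split => //.
- move=> a a0 Fa.
  have Fe e : 0 < e -> (\int[leb2]_y `|F y|%:E <= (a + e)%:E)%E.
    by move=> e0; apply: le_trans Fa _; rewrite lee_fin lerDl ltW.
  have pe e : 0 < e -> 0 < a + e by move=> e0; rewrite ltr_wpDl.
  split; last by have [_] := H1 _ (pe _ ltr01) (Fe _ ltr01).
  apply: le_EFin_of_gt => //; first by rewrite mulr_ge0// sqr_ge0.
  by move=> e e0; have [] := H1 _ (pe _ e0) (Fe _ e0).
move=> a Ha; have -> : 2 * C * a = C * (a + a) by ring.
by apply: H2; [exact: (Ha false)|exact: (Ha true)].
Qed.

Lemma shift_diff_L2 F v (A : R) : measurable_fun setT F ->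
  (\int[leb2]_x (F x ^+ 2)%:E <= A%:E)%E ->
  (\int[leb2]_x ((F (x + v)%R - F x) ^+ 2)%:E <= (4 * A)%:E)%E.
Proof.
move=> mF FA.
have mF2 : measurable_fun setT (fun x => F x ^+ 2) by exact: measurable_funX.
have mS : measurable_fun setT (fun x => F (x + v)).
  have := measurableT_comp mF (measurable_affine2 v (1, 1)).
  apply: eq_measurable_fun => -[x1 x2] _ /=; congr F.
  by rewrite /affine2 /affine /= !mul1r (addrC v.1) (addrC v.2).
have mS2 : measurable_fun setT (fun x => F (x + v) ^+ 2) by exact: measurable_funX.
have S2 : (\int[leb2]_x (F (x + v)%R ^+ 2)%:E <= A%:E)%E.
  have m2 : measurable_fun setT (EFin \o (fun x => F x ^+ 2)) by exact/measurable_EFinP.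
  have n2 x : (0 <= (EFin \o (fun x => (F x ^+ 2)%R)) x)%E by rewrite lee_fin sqr_ge0.
  by apply: le_trans FA; rewrite le_eqVlt; apply/orP; left; apply/eqP; exact: (integral_shift v m2 n2).
apply: (@le_trans _ _ (\int[leb2]_x (2 * (F (x + v)%R ^+ 2 + F x ^+ 2))%:E)%E).
  apply: (@le_integral_EFin _ _ R leb2 (fun x => (F (x + v) - F x) ^+ 2)).
  - by apply: measurable_funX; exact: measurable_funB.
  - by apply: measurable_funM => //; exact: measurable_funD.
  - by move=> x; exact: sqr_ge0.
  by move=> x; have := sqr_ge0 (F (x + v) + F x); nra.
have H0 : (0 : R) <= 2 by [].
rewrite (@integral_EFinZl _ _ R leb2 2 (fun x => F (x + v) ^+ 2 + F x ^+ 2)) //; last 2 first.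
- exact: measurable_funD.
- by move=> x; rewrite addr_ge0// sqr_ge0.
rewrite (@integral_EFinD _ _ R leb2 (fun x => F (x + v) ^+ 2) (fun x => F x ^+ 2)) //; last 2 first.
- by move=> x; exact: sqr_ge0.
- by move=> x; exact: sqr_ge0.
have -> : 4 * A = 2 * (A + A) by ring.
by rewrite [leRHS]EFinM; apply: lee_wpmul2l; rewrite ?lee_fin// [leRHS]EFinD; apply: leeD.
Qed.

Lemma integrable_of_L1 F (A : R) : measurable_fun setT F ->
  (\int[leb2]_x `|F x|%:E <= A%:E)%E -> leb2.-integrable setT (EFin \o F).
Proof.
move=> mF FA; apply/integrableP; split; first exact/measurable_EFinP.
by apply: le_lt_trans FA _; exact: ltry.
Qed.

(** The square of the ratio [decay] of the final sums, so that square roots of its powers are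
    explicit. It is close enough to 1 that [rho ^+ 2] exceeds 1/2, as [step_rho] requires. *)
Definition rho : R := 81 / 100.

Lemma rho_ge0 : 0 <= rho.
Proof. by rewrite /rho; lra. Qed.

Lemma rho_le1 : rho <= 1.
Proof. by rewrite /rho; lra. Qed.

Lemma step_le m n : (m <= n)%N -> step n <= step m :> R.
Proof. by move=> mn; rewrite /step ler_wiXn2l ?invr_ge0// invf_le1 ?ler1n. Qed.

Lemma step_rho n : step n <= rho ^+ (2 * n).
Proof. by rewrite exprM /step lerXn2r// ?nnegrE ?invr_ge0 ?sqr_ge0// /rho expr2; lra. Qed.

Lemma step_le_rho n m : (m <= 2 * n)%N -> step n <= rho ^+ m.
Proof.
move=> mn; apply: le_trans (step_rho n) _.
by rewrite ler_wiXn2l// ?rho_ge0 ?rho_le1.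
Qed.

Definition dist k m : nat := (k - m) + (m - k).

Lemma distC k m : dist k m = dist m k.
Proof. exact: addnC. Qed.

Lemma dyadic_nat k : (dyadic k%:Z)^-1 = step k :> R.
Proof. by rewrite stepE. Qed.

(** Every case produces some [step n] with [dist k m + dist k l <= 2 n]. The factor 2 is forced by
    the case of [k] above both indices, where the difference gains only the distance to the larger
    index while both distances have to be paid. *)
Lemma LPre_pairing : exists2 K : R, 0 <= K &
  forall k m l (c d : R) (w w' z z' : Y -> R),
  continuous w -> continuous w' -> continuous z -> continuous z' ->
  tprimitive w w' -> tprimitive z z' ->
  (((2 ^+ m) ^+ 2)%:E * nrm2 w + nrm2 w' <= c%:E)%E ->
  (((2 ^+ l) ^+ 2)%:E * nrm2 z + nrm2 z' <= d%:E)%E ->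
  (\int[leb2]_x (LPre chi k%:Z (pairing (synthesis m w') (synthesis l z)) x ^+ 2)%:E <=
   (K * rho ^+ (dist k m + dist k l) * (c * d))%:E)%E.
Proof.
have [C C0 HC] := LPre_estimates.
(* The case of [k] above both indices needs 32: 2 for the two axes, 8 from [pairing_diff_L2] and 2
   for its two Leibniz terms. *)
pose K := C * 57 * 32; exists K; first by rewrite /K !mulr_ge0.
move=> k m l c d w w' z z' cw cw' cz cz' ww' zz' wc zd.
have Ba := band_synthesis cw cw' ww' wc; have Bb := band_synthesis cz cz' zz' zd.
have c0 := band_ge0 Ba; have d0 := band_ge0 Bb.
have cd0 : 0 <= c * d by exact: mulr_ge0.
have ca' := @continuous_synthesis _ m _ cw'; have cb := @continuous_synthesis _ l _ cz.
set F := pairing _ _.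
have mF : measurable_fun setT F by exact: measurable_pairing.
have L1 := pairing_band_L1 Ba Bb; have L2 := pairing_L2 Ba Bb; rewrite -/F in L1 L2.
have [_ H1 H2] := HC k%:Z F (integrable_of_L1 mF L1).
have fin (q : R) n : (q <= K * (step n * (c * d))) -> (dist k m + dist k l <= 2 * n)%N ->
    (q%:E <= (K * rho ^+ (dist k m + dist k l) * (c * d))%:E)%E.
  move=> qn dn; rewrite lee_fin; apply: le_trans qn _.
  rewrite -mulrA; apply: ler_wpM2l; first by rewrite /K !mulr_ge0.
  by apply: ler_wpM2r => //; exact: step_le_rho.
have [km|/ltnW mk] := leqP k m; have [kl|/ltnW lk] := leqP k l.
(* Here [k] is below both indices: the factor [dyadic k%:Z ^+ 2] is absorbed by [step (m + l)], and
   the excess of [m] and [l] over [k] remains. *)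
- have [H _] := H1 _ (sqrtr_ge0 _) L1.
  apply: le_trans H _; apply: (fin _ ((m - k) + (l - k))%N); last by move: km kl; rewrite /dist; clear; lia.
  rewrite sqr_sqrtr; last by rewrite mulr_ge0// mulr_ge0// ltW// step_gt0.
  have -> : step (m + l) = step k * step k * step ((m - k) + (l - k)) :> R.
    by rewrite -!stepD; congr step; move: km kl; clear; lia.
  have kk := @stepK R k.
  have -> : C * dyadic k%:Z ^+ 2 * (57 * (step k * step k * step (m - k + (l - k))) * (c * d)) =
     C * 57 * (step (m - k + (l - k)) * (c * d)) * (step k * 2 ^+ k) ^+ 2.
    by rewrite /dyadic -exprnP; ring.
  rewrite kk expr1n mulr1 /K; apply: ler_wpM2r; first by rewrite mulr_ge0// ltW// step_gt0.
  by rewrite ler_peMr ?mulr_ge0// ler1n.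
(* Here [k] lies between the indices, as also in the next case. The difference of [F] is bounded
   trivially, since the distance of [m] and [l] is already the sum of their distances to [k]. *)
- have H := H2 (4 * (57 * step ((m - l) + (l - m)) * (c * d)))
    (fun j => shift_diff_L2 _ mF L2).
  apply: le_trans H _; apply: (fin _ ((m - l) + (l - m))%N); last by move: km lk; rewrite /dist; clear; lia.
  rewrite /K; set s := step _ * (c * d).
  have s0 : 0 <= s by rewrite mulr_ge0// ltW// step_gt0.
  by rewrite -(mulrA 57) -/s; have := mulr_ge0 C0 s0; lra.
- have H := H2 (4 * (57 * step ((m - l) + (l - m)) * (c * d)))
    (fun j => shift_diff_L2 _ mF L2).
  apply: le_trans H _; apply: (fin _ ((m - l) + (l - m))%N); last by move: mk kl; rewrite /dist; clear; lia.
  rewrite /K; set s := step _ * (c * d).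
  have s0 : 0 <= s by rewrite mulr_ge0// ltW// step_gt0.
  by rewrite -(mulrA 57) -/s; have := mulr_ge0 C0 s0; lra.
(* Now [k] is above both indices, and whichever factor carries the difference, the gain is at least
   [step n]. *)
pose n := (k - maxn m l)%N.
pose s : R := step (((m - l) + (l - m)) + n).
have s0 : 0 <= s by rewrite ltW// step_gt0.
have H j : (\int[leb2]_y ((F (y + ax j (dyadic k%:Z)^-1)%R - F y) ^+ 2)%:E <=
    (8 * (57 * s * (c * d) + 57 * s * (c * d)))%:E)%E.
  rewrite dyadic_nat; apply: pairing_diff_L2 => //.
    have Bh := band_hdiff_synthesis cw cw' ww' wc j (k - m); rewrite subnKC// in Bh.
    have Bt := band_tr (ax j (step k)) Bb.
    apply: le_trans (pairing_L2 Bh Bt) _; rewrite lee_fin -!mulrA ler_wpM2l//.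
    rewrite mulrA; apply: ler_wpM2r => //.
    by rewrite -stepD; apply: step_le; rewrite leq_add2l; exact: (leq_sub2l k (leq_maxl m l)).
  have Bh := band_hdiff_synthesis cz cz' zz' zd j (k - l); rewrite subnKC// in Bh.
  apply: le_trans (pairing_L2 Ba Bh) _; rewrite lee_fin -!mulrA ler_wpM2l//.
  rewrite [leLHS](_ : _ = step (m - l + (l - m)) * step (k - l) * (c * d)); last by ring.
  apply: ler_wpM2r => //.
  by rewrite -stepD; apply: step_le; rewrite leq_add2l; exact: (leq_sub2l k (leq_maxr m l)).
have H' := H2 (8 * (57 * s * (c * d) + 57 * s * (c * d))) H.
apply: le_trans H' _.
apply: (fin (2 * C * (8 * (57 * s * (c * d) + 57 * s * (c * d)))) (((m - l) + (l - m)) + n)%N); last first.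
  by move: mk lk; rewrite /dist /n; clear; lia.
rewrite /K -/s -!(mulrA 57); clearbody s.
by have := mulr_ge0 C0 (mulr_ge0 s0 cd0); lra.
Qed.

End PairProjection.

(** * Summation over the pieces *)

Section Approximation.
Context {R : realType}.
Local Notation leb2 := (@plane_measure R).
Local Notation X := (R * R)%type.
Local Notation Y := (R * (R * R))%type.
Implicit Types (a b f g w h z : Y -> R) (u : X) (p : Y) (x : X) (m n k l M : nat).

Lemma continuous_subf f g : continuous f -> continuous g ->
  continuous (fun p => f p - g p).
Proof. by move=> cf cg; cont. Qed.

(** [slope] covers backward steps only; forward ones have the same norm by [nrm2_hdiff_opp]. *)
Lemma nrm2_hdiff_slope j r f w : continuous f -> continuous w -> slope j f w ->
  (nrm2 (hdiff (ax j r) f) <= ((r / 2) ^+ 2)%:E * nrm2 w)%E.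
Proof.
move=> cf cw fw.
have H (s : R) : 0 <= s -> (nrm2 (hdiff (ax j (- s)) f) <= ((s / 2) ^+ 2)%:E * nrm2 w)%E.
  move=> s0; have ca := @continuous_avg _ (ax j (- s)) _ cw.
  have -> : hdiff (ax j (- s)) f = (fun p => s / 2 * avg (ax j (- s)) w p).
    by apply/funext => p; rewrite /hdiff (fw s s0); field.
  rewrite (nrm2Z _ ca); apply: lee_wpmul2l; first by rewrite lee_fin sqr_ge0.
  exact: nrm2_avg_le.
have [r0|/ltW r0] := leP 0 r; last first.
  have := H (- r); rewrite oppr_ge0 opprK => /(_ r0).
  by rewrite mulNr sqrrN.
have E := nrm2_hdiff_opp (ax j (- r)) cf; rewrite opp2_ax in E.
by apply: le_trans (H r r0); rewrite le_eqVlt; apply/orP; left; apply/eqP; exact: E.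
Qed.

Lemma nrm2_sub_avg_slope j r f w : continuous f -> continuous w -> slope j f w ->
  (nrm2 (fun p => f p - avg (ax j r) f p)%R <= (r ^+ 2)%:E * nrm2 w)%E.
Proof.
move=> cf cw fw; apply: nrm2_sub_avg_le => // s /andP[s0 s1].
have -> : (s * (ax j r).1, s * (ax j r).2) = ax j (s * r).
  by case: (j); rewrite /= mulr0.
have cd := @continuous_hdiff _ (ax j (s * r)) _ cf.
have -> : (fun p => f p - tr (ax j (s * r)) f p) = (fun p => 2 * hdiff (ax j (s * r)) f p).
  by apply/funext => p; rewrite /hdiff; field.
rewrite (nrm2Z _ cd).
have H4 : (0 <= (2 ^+ 2 : R)%:E)%E by rewrite lee_fin.
apply: le_trans (lee_wpmul2l H4 (nrm2_hdiff_slope (s * r) cf cw fw)) _.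
rewrite muleA -EFinM; apply: lee_wpmul2r; first exact: nrm2_ge0.
rewrite lee_fin; have -> : 2 ^+ 2 * (s * r / 2) ^+ 2 = s ^+ 2 * r ^+ 2 by field.
by rewrite ler_piMl ?sqr_ge0// expr_le1.
Qed.

Definition gradient2 (v : bool -> Y -> R) : \bar R := (nrm2 (v false) + nrm2 (v true))%E.

Lemma gradient2_ge0 (v : bool -> Y -> R) : (0 <= gradient2 v)%E.
Proof. by apply: adde_ge0; exact: nrm2_ge0. Qed.

Lemma nrm2_sub_avg2_slope r f (v : bool -> Y -> R) : continuous f ->
  (forall j, continuous (v j)) -> (forall j, slope j f (v j)) ->
  (nrm2 (fun p => f p - avg2 r f p)%R <= (2 * r ^+ 2)%:E * gradient2 v)%E.
Proof.
move=> cf cv fv.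
have ct := @continuous_avg _ (ax true r) _ cf.
have cft := @continuous_avg _ (ax false r) _ ct.
have cff := @continuous_avg _ (ax false r) _ cf.
have c1 := continuous_subf cf ct.
have c2 := continuous_subf cf cff.
have c3 := @continuous_avg _ (ax false r) _ c1.
have -> : (fun p => f p - avg2 r f p) = (fun p => (f p - avg (ax false r) f p) +
    avg (ax false r) (fun p => f p - avg (ax true r) f p) p).
  by rewrite (avgB _ cf ct); apply/funext => p; rewrite /avg2; ring.
apply: le_trans (nrm2D_le c2 c3) _.
rewrite (EFinM 2 (r ^+ 2)) -muleA /gradient2.
rewrite (ge0_muleDr _ (nrm2_ge0 _) (nrm2_ge0 _)).
have r0 : (0 <= (r ^+ 2)%:E)%E by rewrite lee_fin sqr_ge0.
rewrite (ge0_muleDr _ (mule_ge0 r0 (nrm2_ge0 _)) (mule_ge0 r0 (nrm2_ge0 _))).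
apply: leeD; apply: lee_wpmul2l; rewrite ?lee_fin//.
  exact: (nrm2_sub_avg_slope r cf (cv false) (fv false)).
apply: le_trans (nrm2_avg_le _ c1) _.
exact: (nrm2_sub_avg_slope r cf (cv true) (fv true)).
Qed.

Lemma nrm2_lowpass_le M f : continuous f -> (nrm2 (lowpass M f) <= nrm2 f)%E.
Proof.
move=> cf; have ca := @continuous_analysis _ M _ cf.
exact: le_trans (nrm2_avg2_le _ ca) (nrm2_avg2_le _ cf).
Qed.

Lemma continuous_lowpass M f : continuous f -> continuous (lowpass M f).
Proof. by move=> cf; do 2 apply: continuous_avg2. Qed.

(** The error is that of [synthesis] on [f] plus [synthesis] of the error of [analysis]. Each is at
    most twice [step M ^+ 2] times the gradient, and adding them doubles the sum. *)
Lemma nrm2_sub_lowpass_slope M f (v : bool -> Y -> R) : continuous f ->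
  (forall j, continuous (v j)) -> (forall j, slope j f (v j)) ->
  (nrm2 (fun p => f p - lowpass M f p)%R <= (8 * step M ^+ 2)%:E * gradient2 v)%E.
Proof.
move=> cf cv fv.
have ca := @continuous_analysis _ M _ cf; have cs := @continuous_synthesis _ M _ cf.
have c1 := continuous_subf cf cs.
have c2 := continuous_subf cf ca.
have c3 := @continuous_synthesis _ M _ c2.
have -> : (fun p => f p - lowpass M f p) = (fun p => (f p - synthesis M f p) +
    synthesis M (fun p => f p - analysis M f p) p).
  by rewrite /lowpass /synthesis (avg2B _ cf ca); apply/funext => p; rewrite addrA subrK.
apply: le_trans (nrm2D_le c1 c3) _.
have H (e : R) : e ^+ 2 = step M ^+ 2 ->
    (nrm2 (fun p => f p - avg2 e f p)%R <= (2 * step M ^+ 2)%:E * gradient2 v)%E.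
  by move=> <-; exact: nrm2_sub_avg2_slope.
have H1 := H (step M) erefl; have H2 := H (- step M) (sqrrN _).
have H3 := le_trans (nrm2_avg2_le (step M) c2) H2.
have t0 : (0 <= 2%:E :> \bar R)%E by rewrite lee_fin.
apply: le_trans (leeD (lee_wpmul2l t0 H1) (lee_wpmul2l t0 H3)) _.
rewrite muleA -EFinM -ge0_muleDl ?gradient2_ge0//.
  apply: lee_wpmul2r; first exact: gradient2_ge0.
  by rewrite -EFinD lee_fin; lra.
all: by rewrite lee_fin; have := sqr_ge0 (step M : R); lra.
Qed.

Lemma nrm2_sub_lowpass M f : continuous f ->
  (nrm2 (fun p => f p - lowpass M f p)%R <= 4%:E * nrm2 f)%E.
Proof.
move=> cf; have cl := @continuous_lowpass M _ cf.
have cl' : continuous (fun p => -1 * lowpass M f p) by cont.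
have -> : (fun p => f p - lowpass M f p) = (fun p => f p + -1 * lowpass M f p).
  by apply/funext => p; rewrite mulN1r.
apply: le_trans (nrm2D_le cf cl') _.
rewrite (nrm2Z _ cl) sqrrN expr1n mul1e.
have t0 : (0 <= 2%:E :> \bar R)%E by rewrite lee_fin.
apply: le_trans (leeD (lexx _) (lee_wpmul2l t0 (nrm2_lowpass_le M cf))) _.
rewrite -ge0_muleDl ?lee_fin//.
by apply: lee_wpmul2r; [exact: nrm2_ge0|rewrite lee_fin; lra].
Qed.

Definition sobolev2 f w (v : bool -> Y -> R) : \bar R := (nrm2 f + nrm2 w + gradient2 v)%E.

(* [w] plays the role of the time derivative and [v j] of the space derivatives. *)
Record sobolev_data f w (v : bool -> Y -> R) : Prop := SobolevData {
  data_cf : continuous f;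
  data_cw : continuous w;
  data_cv : forall j, continuous (v j);
  data_prim : tprimitive f w;
  data_slope : forall j, slope j f (v j) }.

Lemma tprimitive_lowpass M f w : continuous f -> continuous w ->
  tprimitive f w -> tprimitive (lowpass M f) (lowpass M w).
Proof.
move=> cf cw fw.
have ca := @continuous_analysis _ M _ cf; have cb := @continuous_analysis _ M _ cw.
apply: tprimitive_synthesis => //.
rewrite /analysis /avg2; apply: tprimitive_avg; last exact: tprimitive_avg.
  exact: continuous_avg.
exact: continuous_avg.
Qed.

Lemma leeD3 (a b c d : \bar R) : (0 <= a)%E -> (0 <= b)%E -> (0 <= c)%E ->
  (a + b + c <= d)%E -> [/\ (a <= d)%E, (b <= d)%E & (c <= d)%E].
Proof.
move=> a0 b0 c0 H; split; apply: le_trans H.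
- by rewrite -addeA leeDl// adde_ge0.
- by rewrite (addeC a) -addeA leeDl// adde_ge0.
- by rewrite leeDr// adde_ge0.
Qed.

Lemma pairing_sub a b a1 b1 x : continuous a -> continuous b ->
  continuous a1 -> continuous b1 ->
  pairing a b x - pairing a1 b1 x =
  pairing (fun p => a p - a1 p) b x + pairing a1 (fun p => b p - b1 p) x.
Proof.
move=> ca cb ca1 cb1.
have C f g : continuous f -> continuous g -> continuous (fun t : R => f (t, x) * g (t, x)).
  by move=> cf cg; cont.
have c1 := continuous_subf ca ca1; have c2 := continuous_subf cb cb1.
rewrite /pairing -itvintB; [|exact: C|exact: C].
rewrite -(itvintD _ _ (C _ _ c1 cb) (C _ _ ca1 c2)).
by apply: eq_itvint => t _ /=; ring.
Qed.

(** After telescoping, one factor is a high-frequency remainder with bounded energy at scale [M] and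
    the other is taken at scale 0; the time integral gains the square root of [step M]. *)
Lemma pairing_lowpass_L1 M f w (v : bool -> Y -> R) h z (v' : bool -> Y -> R) (A B : R) :
  sobolev_data f w v -> sobolev_data h z v' ->
  (sobolev2 f w v <= A%:E)%E -> (sobolev2 h z v' <= B%:E)%E ->
  (\int[leb2]_x `|pairing w h x - pairing (lowpass M w) (lowpass M h) x|%:E <=
    (2 * Num.sqrt (57 * step M * (12 * A * (12 * B))))%:E)%E.
Proof.
move=> [cf cw cv fw fv] [ch cz cv' hz hv'] HA HB.
have [A1 A2 A3] := leeD3 (nrm2_ge0 _) (nrm2_ge0 _) (gradient2_ge0 _) HA.
have [B1 B2 B3] := leeD3 (nrm2_ge0 _) (nrm2_ge0 _) (gradient2_ge0 _) HB.
have A0 : 0 <= A by rewrite -lee_fin; exact: le_trans (nrm2_ge0 f) A1.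
have B0 : 0 <= B by rewrite -lee_fin; exact: le_trans (nrm2_ge0 h) B1.
(* The remainder of [f0] contributes [8 * D], its factor [(2 ^+ M) ^+ 2] being cancelled by the
   approximation error, and that of [w0] contributes [4 * D]. *)
have high f0 w0 (v0 : bool -> Y -> R) (D : R) : continuous f0 -> continuous w0 ->
    (forall j, continuous (v0 j)) -> (forall j, slope j f0 (v0 j)) -> 0 <= D ->
    (nrm2 w0 <= D%:E)%E -> (gradient2 v0 <= D%:E)%E ->
    (\int[leb2]_x (slice_energy M (fun p => f0 p - lowpass M f0 p)%R
       (fun p => w0 p - lowpass M w0 p)%R x)%:E <= (12 * D)%:E)%E.
  move=> cf0 cw0 cv0 fv0 D0 D1 D2.
  have c1 := @continuous_lowpass M _ cf0; have c2 := @continuous_lowpass M _ cw0.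
  have c3 := continuous_subf cf0 c1.
  have c4 := continuous_subf cw0 c2.
  rewrite (integral_slice_energy M c3 c4).
  have p0 : (0 <= ((2 ^+ M) ^+ 2 : R)%:E)%E by rewrite lee_fin sqr_ge0.
  have q0 : (0 <= (8 * step M ^+ 2 : R)%:E)%E by rewrite lee_fin mulr_ge0// sqr_ge0.
  have r0 : (0 <= 4%:E :> \bar R)%E by rewrite lee_fin.
  have H1 := le_trans (nrm2_sub_lowpass_slope M cf0 cv0 fv0) (lee_wpmul2l q0 D2).
  have H2 := le_trans (nrm2_sub_lowpass M cw0) (lee_wpmul2l r0 D1).
  apply: le_trans (leeD (lee_wpmul2l p0 H1) H2) _.
  rewrite -!EFinM -EFinD lee_fin.
  have -> : (2 ^+ M) ^+ 2 * (8 * step M ^+ 2 * D) = 8 * D * (step M * 2 ^+ M) ^+ 2 by ring.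
  by rewrite stepK expr1n; lra.
have low f0 w0 (D : R) : continuous f0 -> continuous w0 -> 0 <= D ->
    (nrm2 f0 <= D%:E)%E -> (nrm2 w0 <= D%:E)%E ->
    (\int[leb2]_x (slice_energy 0 f0 w0 x)%:E <= (12 * D)%:E)%E.
  move=> cf0 cw0 D0 D1 D2.
  rewrite (integral_slice_energy 0 cf0 cw0) expr0 expr1n mul1e.
  by apply: le_trans (leeD D1 D2) _; rewrite -EFinD lee_fin; lra.
have cfl := @continuous_lowpass M _ cf; have cwl := @continuous_lowpass M _ cw.
have chl := @continuous_lowpass M _ ch; have czl := @continuous_lowpass M _ cz.
have cfd := continuous_subf cf cfl.
have cwd := continuous_subf cw cwl.
have chd := continuous_subf ch chl.
have czd := continuous_subf cz czl.
have Pl := @tprimitive_lowpass M _ _ cf cw fw; have Ql := @tprimitive_lowpass M _ _ ch cz hz.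
have Pd := tprimitiveB cw cwl fw Pl; have Qd := tprimitiveB cz czl hz Ql.
have A12 : 0 <= 12 * A by rewrite mulr_ge0.
have B12 : 0 <= 12 * B by rewrite mulr_ge0.
have L1 := @pairing_L1 _ M 0 _ _ _ _ _ _ cfd cwd ch cz Pd hz A12 B12
  (high _ _ _ _ cf cw cv fv A0 A2 A3) (low _ _ _ ch cz B0 B1 B2).
have L2 := @pairing_L1 _ 0 M _ _ _ _ _ _ cfl cwl chd czd Pl Qd A12 B12
  (low _ _ _ cfl cwl A0 (le_trans (nrm2_lowpass_le M cf) A1) (le_trans (nrm2_lowpass_le M cw) A2))
  (high _ _ _ _ ch cz cv' hv' B0 B2 B3).
rewrite addn0 in L1; rewrite add0n in L2.
have mp a b : continuous a -> continuous b -> measurable_fun setT (fun x => `|pairing a b x|).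
  by move=> ca cb; apply: measurableT_comp => //; exact: measurable_pairing.
rewrite mulr2n mulrDl mul1r EFinD; apply: le_trans (leeD L1 L2).
rewrite -(@integral_EFinD _ _ R leb2 _ _ (mp _ _ cwd ch) (mp _ _ cwl chd)) //.
apply: (@le_integral_EFin _ _ R leb2
  (fun x => `|pairing w h x - pairing (lowpass M w) (lowpass M h) x|)) => //.
- apply: measurableT_comp => //.
  exact: (measurable_funB (measurable_pairing cw ch) (measurable_pairing cwl chl)).
- exact: (measurable_funD (mp _ _ cwd ch) (mp _ _ cwl chd)).
move=> x; apply: le_trans (ler_normD _ _); rewrite le_eqVlt; apply/orP; left; apply/eqP.
by congr `|_|; exact: pairing_sub.
Qed.

End Approximation.

(** * Square-summable masses and geometric sums *)

Section Masses.
Context {R : realType}.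
Local Notation leb2 := (@plane_measure R).
Local Notation X := (R * R)%type.
Local Notation Y := (R * (R * R))%type.
Implicit Types (a b f g w h z : Y -> R) (u : X) (p : Y) (x : X) (m n k l M : nat).

Lemma tprimitive_avg2 s f w : continuous f -> continuous w -> tprimitive f w ->
  tprimitive (avg2 s f) (avg2 s w).
Proof.
move=> cf cw fw; rewrite /avg2; apply: tprimitive_avg; last exact: tprimitive_avg.
  exact: continuous_avg.
exact: continuous_avg.
Qed.

Lemma tprimitive_backdiff j m f w : continuous f -> continuous w -> tprimitive f w ->
  tprimitive (backdiff j m f) (backdiff j m w).
Proof.
move=> cf cw fw; have cd := @continuous_detail _ j m _ cw; have ca := @continuous_analysis _ m _ cw.
apply: (tprimitive_hdiff _ cd); apply: (tprimitive_hdiff _ ca).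
exact: tprimitive_avg2.
Qed.

Lemma tprimitive_backsum j m f w : continuous w -> tprimitive f w ->
  tprimitive (backsum j m f) (backsum j m w).
Proof.
move=> cw fw; have cs := @continuous_hsum _ (ax j (- step m)) _ cw.
by apply: (tprimitive_hsum _ cs); exact: (tprimitive_hsum _ cw).
Qed.

Lemma tprimitive_piece m f w : continuous f -> continuous w -> tprimitive f w ->
  tprimitive (piece m f) (piece m w).
Proof.
move=> cf cw fw; case: m => [|m]; first exact: tprimitive_avg2.
have c1 := @continuous_backdiff _ false m.+1 _ cw; have c2 := @continuous_backdiff _ true m.+1 _ cw.
have c3 := @continuous_backsum _ false m.+1 _ c2.
apply: (tprimitiveD c1 c3); first exact: tprimitive_backdiff.
by apply: (tprimitive_backsum _ _ c2); exact: tprimitive_backdiff.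
Qed.

(** With [w] the time derivative of [f], this is the quantity written gamma_m^2 or delta_l^2 in the
    overview. *)
Definition mass m f w : \bar R :=
  (((2 ^+ m) ^+ 2)%:E * nrm2 (piece m f) + nrm2 (piece m w))%E.

Lemma mass_ge0 m f w : (0 <= mass m f w)%E.
Proof.
by apply: adde_ge0; [apply: mule_ge0; [by rewrite lee_fin sqr_ge0|]|]; exact: nrm2_ge0.
Qed.

(** The factor [(2 ^+ m.+1) ^+ 2] is consumed by the gain in [nrm2_backdiff_slope], so only details
    of the derivatives remain, and these telescope. *)
Lemma massS_le m f w (v : bool -> Y -> R) : sobolev_data f w v ->
  (mass m.+1 f w <=
    nrm2 (detail false m.+1 (v false)) + nrm2 (detail true m.+1 (v true)) +
    2%:E * (nrm2 (detail false m.+1 w) + nrm2 (detail true m.+1 w)))%E.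
Proof.
move=> [cf cw cv fw fv]; apply: leeD.
  have H j := nrm2_backdiff_slope m.+1 cf (cv j) (fv j).
  have t0 : (0 <= 2%:E :> \bar R)%E by rewrite lee_fin.
  have p0 : (0 <= ((2 ^+ m.+1) ^+ 2 : R)%:E)%E by rewrite lee_fin sqr_ge0.
  apply: le_trans (lee_wpmul2l p0 (le_trans (nrm2_piece_le m cf)
    (leeD (lee_wpmul2l t0 (H false)) (lee_wpmul2l t0 (H true))))) _.
  move: (nrm2_ge0 (detail false m.+1 (v false))) (nrm2_ge0 (detail true m.+1 (v true))).
  generalize (nrm2 (detail false m.+1 (v false))) (nrm2 (detail true m.+1 (v true))).
  move=> A B A0 B0.
  have s2 : (2 ^+ m.+1) ^+ 2 * (2 * (step m.+1 / 2) ^+ 2) = 2^-1 :> R.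
    have -> : (2 ^+ m.+1) ^+ 2 * (2 * (step m.+1 / 2) ^+ 2) =
      2^-1 * (step m.+1 * 2 ^+ m.+1) ^+ 2 :> R by field.
    by rewrite stepK expr1n mulr1.
  have q0 : (0 <= ((step m.+1 / 2) ^+ 2 : R)%:E)%E by rewrite lee_fin sqr_ge0.
  have D0 : (0 <= 2%:E * (((step m.+1 / 2) ^+ 2)%:E * A))%E by do 2 apply: mule_ge0 => //.
  have E0 : (0 <= 2%:E * (((step m.+1 / 2) ^+ 2)%:E * B))%E by do 2 apply: mule_ge0 => //.
  rewrite (ge0_muleDr _ D0 E0) !muleA -!EFinM -mulrA s2.
  apply: leeD; rewrite -[leRHS]mul1e; apply: lee_wpmul2r => //; rewrite lee_fin; lra.
apply: le_trans (nrm2_piece_le m cw) _.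
have t0 : (0 <= 2%:E :> \bar R)%E by rewrite lee_fin.
rewrite (ge0_muleDr _ (nrm2_ge0 _) (nrm2_ge0 _)).
exact: (leeD (lee_wpmul2l t0 (@nrm2_backdiff_le _ false m.+1 _ cw))
  (lee_wpmul2l t0 (@nrm2_backdiff_le _ true m.+1 _ cw))).
Qed.

Lemma sum4_le M (a b c d : nat -> \bar R) (A B C D : \bar R) :
  (forall m, 0 <= c m)%E -> (forall m, 0 <= d m)%E ->
  (\sum_(m < M) a m <= A)%E -> (\sum_(m < M) b m <= B)%E ->
  (\sum_(m < M) c m <= C)%E -> (\sum_(m < M) d m <= D)%E ->
  (\sum_(m < M) (a m + b m + 2%:E * (c m + d m)) <= A + B + 2%:E * (C + D))%E.
Proof.
move=> c0 d0 aA bB cC dD; rewrite big_split /= big_split /=.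
rewrite -ge0_sume_distrr; last by move=> m _; exact: adde_ge0.
rewrite big_split /=; apply: leeD; first exact: leeD.
by apply: lee_wpmul2l; [rewrite lee_fin|exact: leeD].
Qed.

(** The largest coefficient is that of [nrm2 w]: 1 from level 0 and 2 along each axis from the later
    levels. *)
Lemma mass_sum_le M f w (v : bool -> Y -> R) : sobolev_data f w v ->
  (\sum_(m < M.+1) mass m f w <= 5%:E * sobolev2 f w v)%E.
Proof.
move=> D; have [cf cw cv fw fv] := D.
rewrite big_ord_recl.
have H0 : (mass 0 f w <= nrm2 f + nrm2 w)%E.
  rewrite /mass expr0 expr1n mul1e; apply: leeD; exact: nrm2_avg2_le.
have N (g : Y -> R) := nrm2_ge0 g.
have t0 : (0 <= 2%:E :> \bar R)%E by rewrite lee_fin.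
have -> : (\sum_(m < M) mass (lift ord0 m) f w = \sum_(m < M) mass m.+1 f w)%E.
  by apply: eq_bigr => m _; rewrite lift0.
have H1 : (\sum_(m < M) mass m.+1 f w <= gradient2 v + 2%:E * (nrm2 w + nrm2 w))%E.
  pose d j (g : Y -> R) m := nrm2 (detail j m.+1 g).
  have := @sum4_le M (d false (v false)) (d true (v true)) (d false w) (d true w) _ _ _ _
    (fun m => N _) (fun m => N _)
    (detail_square_sum false M (cv false)) (detail_square_sum true M (cv true))
    (detail_square_sum false M cw) (detail_square_sum true M cw).
  by apply: le_trans; apply: lee_sum => m _; exact: (massS_le m D).
apply: le_trans (leeD H0 H1) _; rewrite /sobolev2.
move: (N f) (N w) (gradient2_ge0 v).
move: (nrm2 f) (nrm2 w) (gradient2 v) => A B G A0 B0 G0.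
rewrite (ge0_muleDr _ (adde_ge0 A0 B0) G0) (ge0_muleDr _ A0 B0).
rewrite (ge0_muleDr _ B0 B0).
have five (c : \bar R) : (0 <= c)%E -> (5%:E * c = c + (2%:E * c + 2%:E * c))%E.
  move=> c0; rewrite -(ge0_muleDl _ t0 t0) -[X in (X + _)%E]mul1e -ge0_muleDl ?lee_fin//.
  by congr (_ * _)%E; rewrite -!EFinD; congr EFin; lra.
rewrite (five B B0).
have AA : (A <= 5%:E * A)%E by rewrite -[leLHS]mul1e; apply: lee_wpmul2r => //; rewrite lee_fin; lra.
have GG : (G <= 5%:E * G)%E by rewrite -[leLHS]mul1e; apply: lee_wpmul2r => //; rewrite lee_fin; lra.
rewrite (addeC G) addeA -(addeA A); apply: leeD => //.
exact: leeD.
Qed.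

(** Finiteness of the sum allows the masses up to [M] to be replaced by reals; nothing is said about
    later ones, which might be infinite. *)
Lemma real_mass M f w (v : bool -> Y -> R) (A : R) : sobolev_data f w v ->
  (sobolev2 f w v <= A%:E)%E ->
  exists c : nat -> R, [/\ forall m, 0 <= c m,
    forall m, (m < M.+1)%N -> (mass m f w <= (c m)%:E)%E &
    \sum_(m < M.+1) c m <= 5 * A].
Proof.
move=> D HA; have t0 : (0 <= 5%:E :> \bar R)%E by rewrite lee_fin.
have H := le_trans (mass_sum_le M D) (lee_wpmul2l t0 HA).
have F m : (m < M.+1)%N -> (mass m f w)%E \is a fin_num.
  move=> mM; rewrite ge0_fin_numE ?mass_ge0//; apply: le_lt_trans (ltry (5 * A)).
  apply: le_trans H; rewrite (bigD1 (Ordinal mM))//= leeDl//.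
  by apply: sume_ge0 => i _; exact: mass_ge0.
exists (fun m => fine (mass m f w)); split.
- by move=> m; apply: fine_ge0; exact: mass_ge0.
- by move=> m mM; rewrite fineK// F.
rewrite -lee_fin -sumEFin; apply: le_trans H.
by apply: lee_sum => i _; rewrite fineK// F.
Qed.

Lemma continuous_sumf n (a : nat -> Y -> R) : (forall i, continuous (a i)) ->
  continuous (fun p => \sum_(i < n) a i p).
Proof.
move=> ca; elim: n => [|n IH].
  by under eq_fun do rewrite big_ord0; exact: continuous_cst.
by under eq_fun do rewrite big_ord_recr; exact: (continuous_funD IH (ca n)).
Qed.

Lemma pairing_suml n (a : nat -> Y -> R) b x : (forall i, continuous (a i)) ->
  continuous b ->
  pairing (fun p => \sum_(i < n) a i p) b x = \sum_(i < n) pairing (a i) b x.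
Proof.
move=> ca cb; have C f g : continuous f -> continuous g ->
    continuous (fun t : R => f (t, x) * g (t, x)) by move=> cf cg; cont.
elim: n => [|n IH].
  rewrite big_ord0 /pairing (@eq_itvint _ _ _ _ (fun=> 0)); last first.
    by move=> t _; rewrite big_ord0 mul0r.
  by rewrite itvint_cst ?ler01// mulr0.
rewrite big_ord_recr /= -IH /pairing.
rewrite -(itvintD _ _ (C _ _ (@continuous_sumf n _ ca) cb) (C _ _ (ca n) cb)).
by apply: eq_itvint => t _; rewrite big_ord_recr /= mulrDl.
Qed.

Lemma pairing_sumr n a (b : nat -> Y -> R) x : (forall i, continuous (b i)) ->
  continuous a ->
  pairing a (fun p => \sum_(i < n) b i p) x = \sum_(i < n) pairing a (b i) x.
Proof.
move=> cb ca; have E f g : pairing f g x = pairing g f x.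
  by apply: eq_itvint => t _; rewrite mulrC.
by rewrite E (pairing_suml _ _ cb ca); apply: eq_bigr => i _; exact: E.
Qed.

Lemma pairing_lowpassE M w h x : continuous w -> continuous h ->
  pairing (lowpass M w) (lowpass M h) x = \sum_(m < M.+1) \sum_(l < M.+1)
    pairing (synthesis m (piece m w)) (synthesis l (piece l h)) x.
Proof.
move=> cw ch; rewrite (lowpass_sum M cw) (lowpass_sum M ch).
have c1 m : continuous (synthesis m (piece m w)).
  by apply: continuous_synthesis; exact: continuous_piece.
have c2 m : continuous (synthesis m (piece m h)).
  by apply: continuous_synthesis; exact: continuous_piece.
have c3 := @continuous_sumf M.+1 _ c2.
rewrite (pairing_suml M.+1 x c1 c3); apply: eq_bigr => m _.
exact: (pairing_sumr M.+1 x c2 (c1 m)).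
Qed.

Definition L2le (F : X -> R) (a : R) :=
  [/\ measurable_fun setT F, 0 <= a & (\int[leb2]_x (F x ^+ 2)%:E <= (a ^+ 2)%:E)%E].

Lemma L2leD (F G : X -> R) (a b : R) : L2le F a -> L2le G b ->
  L2le (fun x => F x + G x) (a + b).
Proof.
move=> [mF a0 HF] [mG b0 HG].
have mFG := measurable_funM mF mG.
have mN : measurable_fun setT (fun x => `|F x * G x|) by exact: measurableT_comp.
have mF2 : measurable_fun setT (fun x => F x ^+ 2) by exact: measurable_funX.
have mG2 : measurable_fun setT (fun x => G x ^+ 2) by exact: measurable_funX.
split; [exact: measurable_funD|exact: addr_ge0|].
have HN := @integral_cauchy_schwarz _ _ R leb2 F G _ _ mF mG (sqr_ge0 a) (sqr_ge0 b) HF HG.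
rewrite sqrtrM ?sqr_ge0// !sqrtr_sqr (ger0_norm a0) (ger0_norm b0) in HN.
apply: (@le_trans _ _ (\int[leb2]_x (F x ^+ 2 + (G x ^+ 2 + 2 * `|F x * G x|))%:E)%E).
  apply: (@le_integral_EFin _ _ R leb2 (fun x => (F x + G x) ^+ 2)).
  - by apply: measurable_funX; exact: measurable_funD.
  - apply: (measurable_funD mF2); apply: (measurable_funD mG2).
    exact: measurable_funM.
  - by move=> x; exact: sqr_ge0.
  by move=> x; have := ler_norm (F x * G x); rewrite !expr2; lra.
have N0 x : 0 <= 2 * `|F x * G x| by rewrite mulr_ge0.
have mN2 : measurable_fun setT (fun x => 2 * `|F x * G x|) by exact: measurable_funM.
rewrite (@integral_EFinD _ _ R leb2 (fun x => F x ^+ 2)) //; last 3 first.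
- exact: measurable_funD.
- by move=> x; exact: sqr_ge0.
- by move=> x; rewrite addr_ge0// sqr_ge0.
rewrite (@integral_EFinD _ _ R leb2 (fun x => G x ^+ 2)) //; last first.
- by move=> x; exact: sqr_ge0.
have two0 : 0 <= 2 :> R by [].
rewrite (@integral_EFinZl _ _ R leb2 2 (fun x => `|F x * G x|) mN two0) //.
have -> : (a + b) ^+ 2 = a ^+ 2 + (b ^+ 2 + 2 * (a * b)) by ring.
rewrite !EFinD; apply: leeD => //; apply: leeD => //.
by rewrite EFinM; apply: lee_wpmul2l; rewrite ?lee_fin.
Qed.

Lemma L2le0 : L2le (fun=> 0) 0.
Proof.
split => //; under eq_integral do rewrite expr0n /=.
by rewrite integral0 expr0n.
Qed.

Lemma L2le_sum n (F : nat -> X -> R) (a : nat -> R) :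
  (forall i, (i < n)%N -> L2le (F i) (a i)) ->
  L2le (fun x => \sum_(i < n) F i x) (\sum_(i < n) a i).
Proof.
elim: n => [|n IH] H.
  rewrite big_ord0; have -> : (fun x => \sum_(i < 0) F i x) = (fun=> 0).
    by apply/funext => x; rewrite big_ord0.
  exact: L2le0.
rewrite big_ord_recr /=.
have -> : (fun x => \sum_(i < n.+1) F i x) = (fun x => \sum_(i < n) F i x + F n x).
  by apply/funext => x; rewrite big_ord_recr.
apply: L2leD; last exact: H.
by apply: IH => i ni; apply: H; exact: leqW.
Qed.

Lemma L2norm_le (F : X -> R) (a : R) : 0 <= a ->
  (\int[leb2]_x (F x ^+ 2)%:E <= (a ^+ 2)%:E)%E ->
  (L2norm (fun x => (F x)%:C) <= a%:E)%E.
Proof.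
move=> a0 H; rewrite /L2norm unlock.
have E : (\int[leb2]_x (`|(ComplexField.Normc.normc (F x)%:C)%:E| `^ 2)%E =
  \int[leb2]_x (F x ^+ 2)%:E)%E.
  apply: eq_integral => x _; rewrite /= expr0n /= addr0 sqrtr_sqr normr_id.
  by rewrite -[2]/(2%:R) powR_mulrn// -normrX (ger0_norm (sqr_ge0 _)).
rewrite [X in (X `^ _)%E]E poweR12_sqrt; last by apply: integral_EFin_ge0 => x; exact: sqr_ge0.
have -> : a%:E = sqrte (a ^+ 2)%:E by rewrite /= sqrtr_sqr ger0_norm.
by rewrite lee_sqrt// lee_fin sqr_ge0.
Qed.

Definition decay : R := 9 / 10.

Lemma decay_sum k n : \sum_(i < n) decay ^+ (dist k i) <= 19.
Proof.
have r0 m : 0 <= decay ^+ m by rewrite exprn_ge0// /decay; lra.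
have low m : (m <= k.+1)%N -> \sum_(i < m) decay ^+ (dist k i) <= 10 * decay ^+ (k.+1 - m).
  elim: m => [|m IH] mk; first by rewrite big_ord0 mulr_ge0.
  rewrite big_ord_recr /=; have := IH (ltnW mk).
  rewrite (_ : k.+1 - m = (k.+1 - m.+1).+1)%N; last by lia.
  rewrite (_ : dist k m = k.+1 - m.+1)%N; last by rewrite /dist; lia.
  by rewrite exprS /decay; have := r0 (k.+1 - m.+1)%N; rewrite /decay; lra.
have high j : \sum_(i < k.+1 + j) decay ^+ (dist k i) <= 19 - 9 * decay ^+ j.
  elim: j => [|j IH].
    by rewrite addn0; have := low k.+1 (leqnn _); rewrite subnn expr0; lra.
  rewrite addnS big_ord_recr /=; have := IH.
  rewrite (_ : dist k (k.+1 + j) = j.+1)%N; last by rewrite /dist; lia.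
  by rewrite exprS /decay; have := r0 j; rewrite /decay; lra.
have [nk|kn] := leqP n k.+1.
  apply: le_trans (low n nk) _.
  have : decay ^+ (k.+1 - n) <= 1 by rewrite exprn_ile1// /decay; lra.
  by lra.
rewrite -(subnKC (ltnW kn)); apply: le_trans (high _) _.
by have := r0 (n - k.+1)%N; lra.
Qed.

(** 361 is the square of 19, one factor for the sum over [l] and one for that over [k]. *)
Lemma decay_triple_sum N n1 n2 (c : nat -> R) : (forall m, 0 <= c m) ->
  \sum_(k < N) \sum_(m < n1) \sum_(l < n2) decay ^+ (dist k m + dist k l) * c m <=
  361 * \sum_(m < n1) c m.
Proof.
move=> c0; have r0 m : 0 <= decay ^+ m by rewrite exprn_ge0// /decay; lra.
apply: (@le_trans _ _ (\sum_(k < N) \sum_(m < n1) 19 * (decay ^+ dist k m * c m))).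
  apply: ler_sum => k _; apply: ler_sum => m _.
  under eq_bigr do rewrite exprD mulrAC.
  rewrite -mulr_sumr mulrC; apply: ler_wpM2r; first by rewrite mulr_ge0.
  exact: decay_sum.
rewrite exchange_big /= mulr_sumr; apply: ler_sum => m _.
rewrite -mulr_sumr -mulr_suml.
have : \sum_(k < N) decay ^+ dist k m <= 19.
  by under eq_bigr do rewrite distC; exact: decay_sum.
by move=> H; have := ler_wpM2r (c0 m) H; lra.
Qed.

End Masses.

(** * Projections of the low-pass pairing *)

Section BesovBound.
Context {R : realType} (chi : plane R -> R).
Hypothesis hchi : LP_cutoff chi.
Local Notation leb2 := (@plane_measure R).
Local Notation X := (R * R)%type.
Local Notation Y := (R * (R * R))%type.
Implicit Types (f w h z : Y -> R) (v : bool -> Y -> R) (F : X -> R) (x : X).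
Implicit Types (m n k l M N : nat).

Lemma integrable_sumf n (G : nat -> X -> R) :
  (forall i, leb2.-integrable setT (EFin \o G i)) ->
  leb2.-integrable setT (EFin \o (fun y => \sum_(i < n) G i y)).
Proof.
move=> iG; elim: n => [|n IH].
  have -> : (fun y => \sum_(i < 0) G i y) = (fun=> 0) by apply/funext => y; rewrite big_ord0.
  exact: integrable0.
have -> : EFin \o (fun y => \sum_(i < n.+1) G i y) =
  ((EFin \o (fun y => (\sum_(i < n) G i y)%R)) \+ (EFin \o G n))%E.
  by apply/funext => y; rewrite /= big_ord_recr.
exact: integrableD.
Qed.

Lemma LPre0 (k : int) x : LPre chi k (fun=> 0) x = 0.
Proof.
have i0 : leb2.-integrable setT (EFin \o (fun _ : X => 0 : R)) by exact: integrable0.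
have := LPreD hchi k x i0 i0; under eq_fun do rewrite addr0.
by move=> H; apply/eqP; rewrite -(inj_eq (addrI (LPre chi k (fun=> 0) x))) addr0 -H.
Qed.

Lemma LPre_sum (k : int) n (G : nat -> X -> R) x :
  (forall i, leb2.-integrable setT (EFin \o G i)) ->
  LPre chi k (fun y => \sum_(i < n) G i y) x = \sum_(i < n) LPre chi k (G i) x.
Proof.
move=> iG; elim: n => [|n IH].
  rewrite (_ : (fun y => _) = (fun=> 0)); first by rewrite big_ord0 LPre0.
  by apply/funext => y; rewrite big_ord0.
rewrite big_ord_recr /= -IH -(LPreD hchi k x (integrable_sumf n iG) (iG n)).
rewrite (_ : (fun y => \sum_(i < n.+1) G i y) = (fun y => \sum_(i < n) G i y + G n y)) //.
by apply/funext => y; rewrite big_ord_recr.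
Qed.

(** AM-GM separates [c] from [d], after which each part is a geometric sum in the other two indices.
    The weight [L] stays free so that a product of norms can be recovered once everything is
    summed. *)
Lemma weighted_sum_le (K L : R) (c d : nat -> R) N n : 0 <= K -> 0 < L ->
  (forall m, 0 <= c m) -> (forall m, 0 <= d m) ->
  \sum_(k < N) \sum_(m < n) \sum_(l < n)
    Num.sqrt (K * rho ^+ (dist k m + dist k l) * (c m * d l)) <=
  Num.sqrt K * (361 * (2^-1 * (L * \sum_(m < n) c m + L^-1 * \sum_(m < n) d m))).
Proof.
move=> K0 L0 c0 d0; have sK := sqrtr_ge0 K.
have r0 m : 0 <= decay ^+ m :> R by rewrite exprn_ge0// /decay; lra.
have rhoE m : Num.sqrt (rho ^+ m) = decay ^+ m :> R.
  rewrite (_ : rho = decay ^+ 2); last by rewrite /rho /decay expr2; lra.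
  by rewrite exprAC sqrtr_sqr ger0_norm.
have H k m l : Num.sqrt (K * rho ^+ (dist k m + dist k l) * (c m * d l)) <=
    Num.sqrt K * (2^-1 * (L * (decay ^+ (dist k m + dist k l) * c m) +
                          L^-1 * (decay ^+ (dist k l + dist k m) * d l))).
  have p0 : 0 <= rho ^+ (dist k m + dist k l) :> R by rewrite exprn_ge0// rho_ge0.
  rewrite sqrtrM; last by rewrite mulr_ge0.
  rewrite sqrtrM// rhoE -mulrA; apply: ler_wpM2l => //.
  rewrite (addnC (dist k l)) sqrtrM//.
  have := weighted_am_gm (Num.sqrt (c m)) (Num.sqrt (d l)) L0.
  rewrite !sqr_sqrtr// => A; have := ler_wpM2l (r0 (dist k m + dist k l)%N) A.
  by move=> /le_trans; apply; rewrite le_eqVlt; apply/orP; left; apply/eqP; ring.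
apply: (@le_trans _ _ (\sum_(k < N) \sum_(m < n) \sum_(l < n)
   Num.sqrt K * (2^-1 * (L * (decay ^+ (dist k m + dist k l) * c m) +
                          L^-1 * (decay ^+ (dist k l + dist k m) * d l))))).
  by do 3 (apply: ler_sum => ? _); exact: H.
under eq_bigr do under eq_bigr do (rewrite -mulr_sumr -mulr_sumr big_split /= -!mulr_sumr).
under eq_bigr do (rewrite -!mulr_sumr big_split /= -!mulr_sumr).
rewrite -!mulr_sumr big_split /= -!mulr_sumr; apply: ler_wpM2l => //.
have E1 := decay_triple_sum N n n c0; have E2 := decay_triple_sum N n n d0.
have X2 : \sum_(k < N) \sum_(m < n) \sum_(l < n) decay ^+ (dist k l + dist k m) * d l =
   \sum_(k < N) \sum_(m < n) \sum_(l < n) decay ^+ (dist k m + dist k l) * d m.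
  by apply: eq_bigr => k _; rewrite exchange_big.
rewrite X2; have Li : 0 < L^-1 by rewrite invr_gt0.
have F1 := ler_wpM2l (ltW L0) E1; have F2 := ler_wpM2l (ltW Li) E2.
lra.
Qed.

Lemma step_small (T e : R) : 0 <= T -> 0 < e -> exists n, T * step n <= e.
Proof.
move=> T0 e0; exists (Num.truncn (T / e)).+1; set n := _.+1.
have H : T / e < n%:R by exact: truncnS_gt.
have n2 : n%:R <= 2 ^+ n :> R by rewrite -natrX ler_nat ltnW// ltn_expl.
rewrite stepE ler_pdivrMr ?exprn_gt0//.
by move: H; rewrite ltr_pdivrMr// => /ltW /le_trans; apply; rewrite mulrC ler_wpM2l// ltW.
Qed.

(** The low-pass pairing is a finite double sum of pairings of pieces, so linearity of the
    projection and Minkowski reduce it to [LPre_pairing]. *)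
Lemma LPre_smooth_part : exists2 K : R, 0 <= K & forall k M f w v h z v' (c d : nat -> R),
  sobolev_data f w v -> sobolev_data h z v' ->
  (forall m, 0 <= c m) -> (forall m, 0 <= d m) ->
  (forall m, (m < M.+1)%N -> (mass m f w <= (c m)%:E)%E) ->
  (forall m, (m < M.+1)%N -> (mass m h z <= (d m)%:E)%E) ->
  leb2.-integrable setT (EFin \o pairing (lowpass M w) (lowpass M h)) /\
  L2le (LPre chi k%:Z (pairing (lowpass M w) (lowpass M h)))
    (\sum_(m < M.+1) \sum_(l < M.+1)
      Num.sqrt (K * rho ^+ (dist k m + dist k l) * (c m * d l))).
Proof.
have [K K0 HK] := LPre_pairing hchi; exists K => //.
move=> k M f w v h z v' c d [cf cw _ fw _] [ch cz _ hz _] c0 d0 Hc Hd.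
(* [Hc] and [Hd] only control the indices below [M.+1], whereas [LPre_sum] asks
   for integrability at all indices; hence the zeros. *)
pose P m l x : R := if (m < M.+1)%N && (l < M.+1)%N then
  pairing (synthesis m (piece m w)) (synthesis l (piece l h)) x else 0.
have cp m (g : Y -> R) : continuous g -> continuous (piece m g) := @continuous_piece _ m g.
have cs m (g : Y -> R) : continuous g -> continuous (synthesis m (piece m g)).
  by move=> cg; exact: (@continuous_synthesis _ m _ (cp m g cg)).
have iP m l : leb2.-integrable setT (EFin \o P m l).
  have [mlM|mlM] := boolP ((m < M.+1)%N && (l < M.+1)%N); last first.
    have -> : P m l = fun=> 0 by apply/funext => x; rewrite /P (negbTE mlM).
    exact: integrable0.
  have -> : P m l = pairing (synthesis m (piece m w)) (synthesis l (piece l h)).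
    by apply/funext => x; rewrite /P mlM.
  have /andP[mM lM] := mlM.
  have Ba := band_synthesis (cp m _ cf) (cp m _ cw) (tprimitive_piece m cf cw fw) (Hc m mM).
  have Bb := band_synthesis (cp l _ ch) (cp l _ cz) (tprimitive_piece l ch cz hz) (Hd l lM).
  exact: (integrable_of_L1 (measurable_pairing (cs m _ cw) (cs l _ ch)) (pairing_band_L1 Ba Bb)).
have E : pairing (lowpass M w) (lowpass M h) =
    (fun x => \sum_(m < M.+1) \sum_(l < M.+1) P m l x).
  apply/funext => x; rewrite (pairing_lowpassE M x cw ch).
  by apply: eq_bigr => m _; apply: eq_bigr => l _; rewrite /P !ltn_ord.
have iS m := integrable_sumf M.+1 (iP m).
rewrite E; split; first exact: (integrable_sumf M.+1 iS).
have -> : LPre chi k (fun x => \sum_(m < M.+1) \sum_(l < M.+1) P m l x) =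
    (fun x => \sum_(m < M.+1) \sum_(l < M.+1) LPre chi k (P m l) x).
  apply/funext => x; rewrite (LPre_sum k M.+1 x iS); apply: eq_bigr => m _.
  exact: (LPre_sum k M.+1 x (iP m)).
have [C _ HC] := LPre_bounds hchi.
apply: (@L2le_sum _ M.+1 (fun m x => \sum_(l < M.+1) LPre chi k (P m l) x)
  (fun m => \sum_(l < M.+1) Num.sqrt (K * rho ^+ (dist k m + dist k l) * (c m * d l)))) => m mM.
apply: (@L2le_sum _ M.+1 (fun l x => LPre chi k (P m l) x)
  (fun l => Num.sqrt (K * rho ^+ (dist k m + dist k l) * (c m * d l)))) => l lM.
have q0 : 0 <= K * rho ^+ (dist k m + dist k l) * (c m * d l).
  by rewrite mulr_ge0 ?(mulr_ge0 (c0 m))// mulr_ge0// exprn_ge0// rho_ge0.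
split; [by have [] := HC k%:Z _ (iP m l)|exact: sqrtr_ge0|].
rewrite (sqr_sqrtr q0).
have -> : P m l = pairing (synthesis m (piece m w)) (synthesis l (piece l h)).
  by apply/funext => x; rewrite /P mM lM.
exact: (HK k m l _ _ _ _ _ _ (cp m _ cf) (cp m _ cw) (cp l _ ch) (cp l _ cz)
  (tprimitive_piece m cf cw fw) (tprimitive_piece l ch cz hz) (Hc m mM) (Hd l lM)).
Qed.

End BesovBound.

(** * Low frequencies, remainder and the full Besov norm *)

Section BesovPairing.
Context {R : realType} (chi : plane R -> R).
Hypothesis hchi : LP_cutoff chi.
Local Notation leb2 := (@plane_measure R).
Local Notation X := (R * R)%type.
Local Notation Y := (R * (R * R))%type.
Implicit Types (f w h z : Y -> R) (v : bool -> Y -> R) (F : X -> R) (x : X).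
Implicit Types (m n k l M N : nat).

Lemma dyadic_sqr_L2 (C a : R) (k : int) : 0 <= C ->
  C * dyadic k ^+ 2 * a ^+ 2 = (Num.sqrt C * dyadic k * a) ^+ 2.
Proof. by move=> C0; rewrite !exprMn sqr_sqrtr. Qed.

Lemma sum_step_le n : \sum_(i < n) step i.+1 <= 1 :> R.
Proof.
have -> : \sum_(i < n) step i.+1 = 1 - step n :> R.
  elim: n => [|n IH]; first by rewrite big_ord0 /step expr0 subrr.
  by rewrite big_ord_recr /= IH -(stepS n); ring.
by rewrite gerBl ltW// step_gt0.
Qed.

(** The factor 2^k lost from L^1 to L^2 is summable over negative [k]. Since [LP_neg] is a pointwise
    limit, absolute convergence at each point is proved first, and Fatou then carries the L^2 bound
    over from the partial sums. *)
Lemma LP_neg_bound : exists2 C : R, 0 <= C & forall F (a : R), 0 <= a ->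
  measurable_fun setT F -> (\int[leb2]_x `|F x|%:E <= a%:E)%E ->
  (L2norm (LP_neg chi (fun x => (F x)%:C)) <= (C * a)%:E)%E.
Proof.
have [C C0 HC] := LPre_estimates hchi; exists (Num.sqrt C) => // F a a0 mF Fa.
have iF := integrable_of_L1 mF Fa.
pose u n x := LPre chi (- n.+1%:Z) F x.
have dyE n : dyadic (- n.+1%:Z) = step n.+1 :> R.
  by rewrite /dyadic -exprz_inv -exprnP.
have ub n x : `|u n x| <= C * (a + 1) * step n.
  have [_ H _] := HC (- n.+1%:Z) F iF; have [_ H2] := H a a0 Fa.
  apply: le_trans (H2 x) _; rewrite dyE mulrAC; apply: ler_wpM2l.
    by rewrite mulr_ge0// addr_ge0.
  have s0 := @step_gt0 R n.+1.
  rewrite expr2; apply: (@le_trans _ _ (step n.+1)).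
    by rewrite ler_piMr ?step_le1// ltW.
  by rewrite -(stepS n); lra.
have cu x : cvgn (series (fun n => u n x)).
  apply: normed_cvg; apply: (series_le_cvg (v_ := geometric (C * (a + 1)) 2^-1)).
  - by move=> n /=.
  - by move=> n; rewrite /geometric /= mulr_ge0 ?exprn_ge0 ?invr_ge0// mulr_ge0// addr_ge0.
  - by move=> n; exact: ub.
  by apply: is_cvg_geometric_series; rewrite ger0_norm ?invr_ge0// invf_lt1// ltr1n.
pose S n x := \sum_(i < n) u i x.
have SE x : (fun n => S n x) = series (fun n => u n x).
  by apply/funext => n; rewrite /series /= big_mkord.
have L2S n : L2le (S n) (Num.sqrt C * a).
  have H : L2le (S n) (\sum_(i < n) Num.sqrt C * dyadic (- i.+1%:Z) * a).
    apply: (@L2le_sum _ n u (fun i => Num.sqrt C * dyadic (- i.+1%:Z) * a)) => i _.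
    have [m1 H _] := HC (- i.+1%:Z) F iF; have [H1 _] := H a a0 Fa.
    split => //; first by rewrite !mulr_ge0// ?sqrtr_ge0// ltW// dyadic_gt0.
    by rewrite -dyadic_sqr_L2.
  case: H => m1 H1 H2; split => //; first by rewrite mulr_ge0// sqrtr_ge0.
  apply: le_trans H2 _; rewrite lee_fin lerXn2r// ?nnegrE// ?mulr_ge0 ?sqrtr_ge0//.
  have -> : \sum_(i < n) Num.sqrt C * dyadic (- i.+1%:Z) * a =
      Num.sqrt C * a * \sum_(i < n) step i.+1.
    by rewrite mulr_sumr; apply: eq_bigr => i _; rewrite dyE mulrAC.
  by rewrite ler_piMr ?sum_step_le// mulr_ge0// sqrtr_ge0.
pose L x := limn (series (fun n => u n x)).
have -> : LP_neg chi (fun x => (F x)%:C) = (fun x => (L x)%:C).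
  apply/funext => x; rewrite /LP_neg.
  have E n : LP chi (- n.+1%:Z) (fun y => (F y)%:C) x = (u n x)%:C by exact: LP_formula.
  have -> : (fun n => complex.Re (LP chi (- n.+1%:Z) (fun y => (F y)%:C) x)) = (fun n => u n x).
    by apply/funext => n; rewrite E.
  have -> : (fun n => complex.Im (LP chi (- n.+1%:Z) (fun y => (F y)%:C) x)) = (fun n => 0).
    by apply/funext => n; rewrite E.
  have -> : series (fun _ : nat => 0 : R) = fun=> 0.
    by apply/funext => n; rewrite /series /= big1.
  by rewrite lim_cst.
apply: L2norm_le; first by rewrite mulr_ge0// sqrtr_ge0.
have mS n : measurable_fun setT (fun x => (S n x ^+ 2)%:E).
  by apply/measurable_EFinP; apply: measurable_funX; case: (L2S n).
have p0 n x : setT x -> (0 <= (S n x ^+ 2)%:E)%E by rewrite lee_fin sqr_ge0.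
have H := @fatou _ _ R leb2 setT measurableT (fun n x => (S n x ^+ 2)%:E) mS p0.
apply: (@le_trans _ _ (\int[leb2]_x limn_einf (fun n => (S n x ^+ 2)%:E))%E).
  rewrite le_eqVlt; apply/orP; left; apply/eqP; apply: eq_integral => x _.
  have c : (fun n => (S n x ^+ 2)%:E) @ \oo --> (L x ^+ 2)%:E.
    apply/fine_cvgP; split; first exact: nearW.
    rewrite /comp /=; have cS : (fun n => S n x) @ \oo --> L x by rewrite SE; exact: cu.
    exact: (cvgM cS cS).
  by have [-> _] := cvg_limn_einf_sup c.
apply: le_trans H _.
rewrite limn_einf_lim; apply: lime_le; first exact: is_cvg_einfs.
apply: nearW => n; case: (L2S n) => _ _; apply: le_trans.
by apply: ereal_inf_lbound; exists n => /=.
Qed.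

Lemma sobolev2_ge0 f w v : (0 <= sobolev2 f w v)%E.
Proof.
by apply: adde_ge0; [apply: adde_ge0; exact: nrm2_ge0|exact: gradient2_ge0].
Qed.

(** Both functions are taken at scale 0, where the slice energy is part of the Sobolev norm. *)
Lemma pairing_L1_bound f w v h z v' (A B : R) :
  sobolev_data f w v -> sobolev_data h z v' ->
  (sobolev2 f w v <= A%:E)%E -> (sobolev2 h z v' <= B%:E)%E ->
  (\int[leb2]_x `|pairing w h x|%:E <= (Num.sqrt 57 * Num.sqrt (A * B))%:E)%E.
Proof.
move=> [cf cw _ fw _] [ch cz _ hz _] HA HB.
have [A1 A2 _] := leeD3 (nrm2_ge0 _) (nrm2_ge0 _) (gradient2_ge0 _) HA.
have A0 : 0 <= A by rewrite -lee_fin; exact: le_trans (nrm2_ge0 f) A1.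
have [B1 B2 _] := leeD3 (nrm2_ge0 _) (nrm2_ge0 _) (gradient2_ge0 _) HB.
have B0 : 0 <= B by rewrite -lee_fin; exact: le_trans (nrm2_ge0 h) B1.
have E (f0 w0 : Y -> R) v0 (D : R) : continuous f0 -> continuous w0 ->
    (sobolev2 f0 w0 v0 <= D%:E)%E ->
    (\int[leb2]_x (slice_energy 0 f0 w0 x)%:E <= D%:E)%E.
  move=> cf0 cw0; rewrite (integral_slice_energy 0 cf0 cw0) expr0 expr1n mul1e.
  by apply: le_trans; rewrite leeDl// gradient2_ge0.
have := @pairing_L1 _ 0 0 _ _ _ _ _ _ cf cw ch cz fw hz A0 B0
  (E _ _ _ _ cf cw HA) (E _ _ _ _ ch cz HB).
by rewrite addn0 [step 0]/(1 : R) mulr1 sqrtrM.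
Qed.

(* [P_k] of the smooth part is summed through [weighted_sum_le]; the remainder
   is small in [L^1], hence negligible for the finitely many [k < N]. *)
Lemma LP_partial_sums : exists2 K : R, 0 <= K & forall N f w v h z v' (A B L : R),
  sobolev_data f w v -> sobolev_data h z v' ->
  (sobolev2 f w v <= A%:E)%E -> (sobolev2 h z v' <= B%:E)%E -> 0 < L ->
  (\sum_(k < N) L2norm (LP chi k%:Z (fun x => (pairing w h x)%:C)) <=
    (2^-1 * (L * (K * A) + L^-1 * (K * B)))%:E)%E.
Proof.
have [K K0 HK] := LPre_smooth_part hchi; have [C C0 HC] := LPre_estimates hchi.
have sK := sqrtr_ge0 K; have sC := sqrtr_ge0 C.
exists (Num.sqrt K * 361 * 5); first by do 2 (apply: mulr_ge0; last exact: ler0n).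
move=> N f w v h z v' A B L Df Dh HA HB L0.
have A0 : 0 <= A by rewrite -lee_fin; exact: le_trans (sobolev2_ge0 f w v) HA.
have B0 : 0 <= B by rewrite -lee_fin; exact: le_trans (sobolev2_ge0 h z v') HB.
have [cf cw _ _ _] := Df; have [ch cz _ _ _] := Dh.
set F := pairing w h.
have mF : measurable_fun setT F by exact: measurable_pairing.
have iF := integrable_of_L1 mF (pairing_L1_bound Df Dh HA HB).
(* Total cost from L^1 to L^2 of the first [N] projections; the level [M] below is chosen against
   it. *)
pose D := \sum_(k < N) Num.sqrt C * dyadic k%:Z.
have D0 : 0 <= D by apply: sumr_ge0 => k _; rewrite mulr_ge0// ltW// dyadic_gt0.
pose T := D * (2 * Num.sqrt (57 * (12 * A * (12 * B)))).
have T0 : 0 <= T by rewrite mulr_ge0// mulr_ge0// sqrtr_ge0.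
apply/lee_addgt0Pr => e e0.
have [n Tn] := step_small T0 e0.
(* The L^1 error decays like the square root of [step M], which for this [M] is [step n]. *)
pose M := (n + n)%N; set G := pairing (lowpass M w) (lowpass M h).
have [c [c0 Hc sc]] := real_mass M Df HA; have [d [d0 Hd sd]] := real_mass M Dh HB.
have mG : measurable_fun setT G.
  by apply: measurable_pairing; exact: continuous_lowpass.
pose r := 2 * Num.sqrt (57 * (12 * A * (12 * B))) * step n.
have r0 : 0 <= r by rewrite mulr_ge0 ?(ltW (step_gt0 _))// mulr_ge0// sqrtr_ge0.
have FG : (\int[leb2]_x `|F x - G x|%:E <= r%:E)%E.
  apply: le_trans (pairing_lowpass_L1 M Df Dh HA HB) _; rewrite lee_fin /r /M stepD.
  have p0 : 0 <= 57 * (12 * A * (12 * B)) by rewrite !mulr_ge0.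
  have -> : 57 * (step n * step n) * (12 * A * (12 * B)) =
    57 * (12 * A * (12 * B)) * step n ^+ 2 by ring.
  by rewrite sqrtrM// sqrtr_sqr ger0_norm ?mulrA// ltW// step_gt0.
have iFG := integrable_of_L1 (measurable_funB mF mG) FG.
pose s (k : nat) := \sum_(m < M.+1) \sum_(l < M.+1)
      Num.sqrt (K * rho ^+ (dist k m + dist k l) * (c m * d l)).
have H k : (L2norm (LP chi k%:Z (fun x => (F x)%:C)) <=
    (s k + Num.sqrt C * dyadic k%:Z * r)%:E)%E.
  have [iG LG] := HK k M f w v h z v' c d Df Dh c0 d0 Hc Hd.
  have -> : LP chi k%:Z (fun x => (F x)%:C) = (fun x => (LPre chi k%:Z F x)%:C).
    by apply/funext => x; exact: LP_formula.
  have -> : LPre chi k%:Z F =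
      (fun x => LPre chi k%:Z G x + LPre chi k%:Z (fun y => F y - G y) x).
    apply/funext => x; rewrite -(LPreD hchi k x iG iFG).
    by congr (LPre chi _ _ x); apply/funext => y; rewrite addrC subrK.
  have LR : L2le (LPre chi k%:Z (fun y => F y - G y)) (Num.sqrt C * dyadic k%:Z * r).
    have [m1 H1 _] := HC k%:Z _ iFG; have [H2 _] := H1 r r0 FG.
    split => //; first by rewrite mulr_ge0// mulr_ge0// ltW// dyadic_gt0.
    by rewrite -dyadic_sqr_L2.
  by have [_ p q] := L2leD LG LR; exact: L2norm_le.
apply: le_trans (lee_sum _ (fun (k : 'I_N) _ => H k)) _.
rewrite sumEFin -EFinD lee_fin big_split /= -mulr_suml.
apply: lerD; last by apply: le_trans Tn; rewrite /T -[leRHS]mulrA; exact: lexx.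
apply: le_trans (weighted_sum_le N M.+1 K0 L0 c0 d0) _.
have Li : 0 < L^-1 by rewrite invr_gt0.
rewrite -!mulrA.
have F1 := ler_wpM2l (ltW L0) sc; have F2 := ler_wpM2l (ltW Li) sd.
have F3 := ler_wpM2l sK (lerD F1 F2).
move: F3; set x1 := \sum_(m < _) c m; set x2 := \sum_(m < _) d m => F3.
have -> : 2^-1 * (L * (Num.sqrt K * (361 * (5 * A))) + L^-1 * (Num.sqrt K * (361 * (5 * B)))) =
  361 / 2 * (Num.sqrt K * (L * (5 * A) + L^-1 * (5 * B))) by ring.
have -> : Num.sqrt K * (361 * (2^-1 * (L * x1 + L^-1 * x2))) =
  361 / 2 * (Num.sqrt K * (L * x1 + L^-1 * x2)) by ring.
by apply: ler_wpM2l; [rewrite mulr_ge0 ?invr_ge0 ?ler0n|exact: F3].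
Qed.

(** The bound on partial sums is uniform in [N], hence passes to the series for each weight, and
    [le_sqrt_of_weighted] then optimises the weight. *)
Lemma besov_pairing : exists2 C : R, 0 <= C & forall f w v h z v' (A B : R),
  sobolev_data f w v -> sobolev_data h z v' ->
  (sobolev2 f w v <= A%:E)%E -> (sobolev2 h z v' <= B%:E)%E ->
  (besov chi (fun x => (pairing w h x)%:C) <= (C * Num.sqrt (A * B))%:E)%E.
Proof.
have [K K0 HK] := LP_partial_sums; have [C C0 HC] := LP_neg_bound.
have s57 : 0 <= Num.sqrt 57 :> R by exact: sqrtr_ge0.
exists (K + C * Num.sqrt 57); first by rewrite addr_ge0// mulr_ge0.
move=> f w v h z v' A B Df Dh HA HB.
have A0 : 0 <= A by rewrite -lee_fin; exact: le_trans (sobolev2_ge0 f w v) HA.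
have B0 : 0 <= B by rewrite -lee_fin; exact: le_trans (sobolev2_ge0 h z v') HB.
have [cf cw _ _ _] := Df; have [ch cz _ _ _] := Dh.
have mF := measurable_pairing cw ch.
rewrite mulrDl EFinD /besov; apply: leeD; last first.
  rewrite -mulrA; have q0 := mulr_ge0 s57 (sqrtr_ge0 (A * B)).
  exact: (HC _ _ q0 mF (pairing_L1_bound Df Dh HA HB)).
have E : Num.sqrt (K * A * (K * B)) = K * Num.sqrt (A * B).
  have -> : K * A * (K * B) = K ^+ 2 * (A * B) by ring.
  by rewrite sqrtrM ?sqr_ge0// sqrtr_sqr ger0_norm.
rewrite -E; apply: le_sqrt_of_weighted; rewrite ?mulr_ge0// => L L0.
apply: lime_le; first by apply: is_cvg_nneseries => k _ _; exact: Lnorm_ge0.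
by apply: nearW => N; rewrite big_mkord; exact: (HK N f w v h z v').
Qed.

End BesovPairing.

(** * Functions smooth up to the boundary of the slab *)

Section SlabExtension.
Context {R : realType}.
Local Notation leb := (@lebesgue_measure R).
Local Notation leb2 := (@plane_measure R).
Local Notation X := (R * R)%type.
Local Notation Y := (R * (R * R))%type.
Implicit Types (t s : R) (x : X).

(* This is [max 0 (min 1 t)]; the closed form makes continuity automatic. *)
Definition clamp t : R := 2^-1 * (1 + `|t| + - `|t - 1|).

Lemma clamp_ge0_le1 t : 0 <= clamp t <= 1.
Proof.
rewrite /clamp; case: (ger0P t) => t0; case: (ger0P (t - 1)) => t1.
all: by apply/andP; split; lra.
Qed.

Lemma clamp_id t : 0 <= t <= 1 -> clamp t = t.
Proof. by move=> /andP[t0 t1]; rewrite /clamp ger0_norm// ler0_norm ?subr_le0//; field. Qed.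

Lemma continuous_clamp : continuous clamp.
Proof. by rewrite /clamp; cont. Qed.

Definition clampY (p : Y) : Y := (clamp p.1, p.2).

(** Continuation by constants in time beyond the two faces. It gives up the time derivative outside
    the slab, but [tprimitive] only looks at times in [0,1]. *)
Definition slab_ext (q : spacetime R -> R) (p : Y) : R := q (clampY p).

Lemma slab_clampY (p : Y) : slab (clampY p : spacetime R).
Proof. by rewrite /slab /=; exact: clamp_ge0_le1. Qed.

Lemma continuous_clampY : continuous clampY.
Proof. by have cc := continuous_clamp; rewrite /clampY; cont. Qed.

Lemma continuous_slab_ext (q : spacetime R -> R^o) :
  {within slab, continuous q} -> continuous (slab_ext q : Y -> R).
Proof.
move=> cq p A HA.
have sp := slab_clampY p.
have H : within slab (nbhs (clampY p : spacetime R)) (q @^-1` A).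
  by rewrite (nbhs_subspace_in sp); exact: cq HA.
have N : nbhs p (fun p1 => slab (clampY p1 : spacetime R) -> A (q (clampY p1))).
  exact: (continuous_clampY H).
exact: (@filterS Y (nbhs p) _ _ _ (fun p1 K => K (slab_clampY p1)) N).
Qed.

Lemma slab_interior (p : Y) : 0 < p.1 < 1 -> (slab : set (spacetime R))° p.
Proof.
move=> /andP[p0 p1]; rewrite /interior.
have N : \forall t \near p.1, 0 <= t <= 1.
  near=> t; apply/andP; split; apply: ltW; near: t; [exact: lt_nbhsr|exact: lt_nbhsl].
have cf : continuous (fun p : Y => p.1) by cont.
exact: (cf p _ N).
Unshelve. all: end_near. Qed.

Lemma deriv_at_dilate (psi : R -> R) (c a l : R) :
  deriv_at psi (c * a) l -> deriv_at (fun r => psi (c * r)) a (c * l).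
Proof.
move=> [d1 e1]; have [d2 e2] := deriv_at_affine 0 c a.
have E : (fun r : R => c * r + 0) = (fun r => c * r) by apply/funext => r; rewrite addr0.
rewrite E in d2 e2; rewrite derive1E in e1; rewrite derive1E in e2.
have [d3 e3] := @is_derive1_comp R psi (fun r => c * r) a _ _
  (DeriveDef d1 e1) (DeriveDef d2 e2).
by split; [exact: d3|rewrite derive1E [LHS]e3; ring].
Qed.

Lemma deriv_at_line (f : spacetime R -> R^o) (v q : spacetime R) (r : R) :
  derivable f (r *: v + q) v ->
  deriv_at (fun y : R => f (y *: v + q)) r ('D_v f (r *: v + q)).
Proof.
move=> df.
have E : (fun h : R => h^-1 *: ((f \o shift (r *: v + q)) (h *: v) - f (r *: v + q))) =
   (fun h : R => h^-1 *: (((fun y : R => f (y *: v + q)) \o shift r) (h *: (1 : R^o)) - f (r *: v + q))).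
  apply/funext => h; congr (_ *: (_ - _)); rewrite /= /shift /=; congr f.
  by rewrite addrA -scalerDl -[h *: 1]/(h * 1) mulr1.
split; first by move: df; rewrite /derivable E.
by rewrite derive1E /derive E.
Qed.

Lemma eq0_of_open_interval (E : R -> R) : continuous E ->
  (forall t, 0 < t < 1 -> E t = 0) -> forall t, 0 <= t <= 1 -> E t = 0.
Proof.
move=> cE E0 t /andP[t0 t1].
apply/eqP; rewrite -normr_le0; apply/ler_addgt0Pr => e e0; rewrite add0r.
have /nbhs_ballP[d /= d0 Hd] : \forall s \near t, `|E t - E s| < e.
  by have /(@cvgrPdist_lt R R^o)/(_ e e0) := cE t.
pose m := Num.min (d / 2) (2^-1).
have m0 : 0 < m by rewrite lt_min; apply/andP; split; lra.
have md : m < d by rewrite /m gt_min; apply/orP; left; lra.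
have mh : m <= 2^-1 by rewrite /m ge_min lexx orbT.
(* A point of the open interval close to [t], reached by a small step towards the middle. *)
pose s := if t <= 2^-1 then t + m / 2 else t - m / 2.
have st : ball t d s.
  rewrite /ball /= /s; case: ifP => _; rewrite ltr_norml; apply/andP; split; lra.
have s01 : 0 < s < 1.
  rewrite /s; case: ifPn; rewrite -?ltNge => h; apply/andP; split; lra.
by have := Hd s st; rewrite (E0 s s01) subr0 => /ltW.
Qed.

Variable g : spacetime R -> R^o.
Hypothesis sg : smooth_on slab g.

Definition dir (j : bool) : spacetime R := (0, ax j 1).

(** [smooth_on] provides a continuous extension of the derivative up to the faces, and clamping
    extends it further. Its invariance under [clampY] is kept for [slab_ext_slope], which speaks of
    all times. *)
Lemma slab_derivative (v : spacetime R) : exists2 u : Y -> R, continuous u &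
  (forall p, u p = u (clampY p)) /\
  forall p : Y, 0 < p.1 < 1 -> derivable g p v /\ 'D_v g p = u p.
Proof.
have [cg dg ug] := sg; have [u cu eu] := ug [:: v].
exists (slab_ext u); first exact: continuous_slab_ext.
have cK p : clampY (clampY p) = clampY p.
  by rewrite /clampY /= (clamp_id (clamp_ge0_le1 _)).
split; first by move=> p; rewrite /slab_ext cK.
move=> p p01; have ip := slab_interior p01; split; first exact: (dg [::] v p ip).
rewrite /slab_ext; have -> : clampY p = p.
  by rewrite /clampY clamp_id -?surjective_pairing//; move/andP: p01 => [? ?]; rewrite !ltW.
exact: eu ip.
Qed.

Lemma clampY_id (p : Y) : 0 <= p.1 <= 1 -> clampY p = p.
Proof. by move=> p01; rewrite /clampY clamp_id// -surjective_pairing. Qed.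

Lemma slab_ext_time (u : Y -> R) : continuous u ->
  (forall p : Y, 0 < p.1 < 1 -> derivable g p e_t /\ 'D_e_t g p = u p) ->
  tprimitive (slab_ext g) u.
Proof.
move=> cu gu x t /andP[t0 t1].
have [->|tn0] := eqVneq t 0; first by rewrite /itvint set_itv1 Rintegral_set1 addr0.
have [cg _ _] := sg; have cG := continuous_slab_ext cg.
rewrite (@itvint_derive _ (fun s => slab_ext g (s, x))).
- by rewrite addrC subrK.
- exact: (@continuous_time _ _ x cG).
- exact: (@continuous_time _ _ x cu).
- move=> s /andP[s0 s1].
  have s01 : 0 < (s, x).1 < 1 by rewrite /= s0.
  have [ds <-] := gu (s, x) s01.
  have E (r : R) : r *: (e_t : spacetime R) + ((0, x) : spacetime R) = (r, x).
    rewrite -[LHS]/(r *: (1 : R^o) + 0, (r *: (0 : R^o) + x.1, r *: (0 : R^o) + x.2)).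
    by rewrite !scaler0 !add0r addr0 -[r *: 1]/(r * 1) mulr1 -surjective_pairing.
  have := @deriv_at_line g e_t (0, x) s; rewrite E => /(_ ds).
  apply: deriv_at_near; near=> r; rewrite E /slab_ext clampY_id//=.
  by apply/andP; split; apply: ltW; near: r; [exact: lt_nbhsr|exact: lt_nbhsl].
by rewrite lt_neqAle eq_sym tn0 t0.
Unshelve. all: end_near. Qed.

(** For interior times this is the fundamental theorem along a line in [x]; the faces follow by
    continuity, and the remaining times because both sides depend on time only through [clamp]. *)
Lemma slab_ext_slope j (u : Y -> R) : continuous u -> (forall p, u p = u (clampY p)) ->
  (forall p : Y, 0 < p.1 < 1 -> derivable g p (dir j) /\ 'D_(dir j) g p = u p) ->
  slope j (slab_ext g) u.
Proof.
move=> cu uc gu s s0 p.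
have [cg _ _] := sg; have cG := continuous_slab_ext cg.
pose E t := slab_ext g (t, p.2) - tr (ax j (- s)) (slab_ext g) (t, p.2) -
  s * avg (ax j (- s)) u (t, p.2).
have ct := @continuous_tr _ (ax j (- s)) _ cG; have ca := @continuous_avg _ (ax j (- s)) _ cu.
have cE : continuous E.
  have c1 := @continuous_time _ _ p.2 cG; have c2 := @continuous_time _ _ p.2 ct.
  have c3 := @continuous_time _ _ p.2 ca.
  apply: continuous_funD; first exact: continuous_funD c1 (continuous_funN c2).
  by apply: continuous_funN; apply: continuous_funM c3; exact: continuous_cst.
have E0 t : 0 < t < 1 -> E t = 0.
  move=> t01; have t01' : 0 <= t <= 1 by move/andP: t01 => [? ?]; rewrite !ltW.
  pose phi y := slab_ext g (t, (p.2.1 + y * (ax j (- s)).1, p.2.2 + y * (ax j (- s)).2)).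
  pose dphi y := - s * u (t, (p.2.1 + y * (ax j (- s)).1, p.2.2 + y * (ax j (- s)).2)).
  have cphi : continuous phi by rewrite /phi; cont.
  have cl : continuous (fun y : R => u (t, (p.2.1 + y * (ax j (- s)).1, p.2.2 + y * (ax j (- s)).2))) by cont.
  have cdphi : continuous dphi by rewrite /dphi; cont.
  have L (y : R) : y *: (dir j) + ((t, p.2) : spacetime R) =
      (t, (p.2.1 + y * (ax j 1).1, p.2.2 + y * (ax j 1).2)).
    rewrite -[LHS]/(y *: (0 : R^o) + t, (y *: ((ax j 1).1 : R^o) + p.2.1, y *: ((ax j 1).2 : R^o) + p.2.2)).
    by rewrite scaler0 add0r (addrC _ p.2.1) (addrC _ p.2.2).
  have D y : 0 < y < 1 -> derivable phi y 1 /\ derive1 phi y = dphi y.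
    move=> _; have := deriv_at_dilate (a := y) (c := - s)
      (@deriv_at_line g (dir j) (t, p.2) (- s * y) _); rewrite L.
    have [d e] := gu (t, (p.2.1 + - s * y * (ax j 1).1, p.2.2 + - s * y * (ax j 1).2)) t01.
    move=> /(_ d); rewrite e.
    have A (r : R) (q : Y -> R) : q (t, (p.2.1 + - s * r * (ax j 1).1, p.2.2 + - s * r * (ax j 1).2)) =
      q (t, (p.2.1 + r * (ax j (- s)).1, p.2.2 + r * (ax j (- s)).2)).
      by congr (q (_, (_ + _, _ + _))); case: (j); rewrite /= ?mulr0 ?mulr1 // mulrC.
    rewrite A; apply: deriv_at_near; near=> r.
    by rewrite L (A r) /phi /slab_ext clampY_id.
  have := @itvint_derive _ phi dphi cphi cdphi D 1; rewrite ltr01 lexx => /(_ isT).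
  rewrite /dphi itvintZ; last exact: cl.
  rewrite /phi !mul0r !addr0 !mul1r -surjective_pairing /E /avg /tr /=.
  by move=> H; rewrite -[X in X - _]opprB -H; ring.
have := eq0_of_open_interval cE E0 (clamp_ge0_le1 p.1).
have gc (q : Y) : slab_ext g (clampY q) = slab_ext g q.
  by rewrite /slab_ext (clampY_id (slab_clampY q)).
rewrite /E => /eqP; rewrite subr_eq0 => /eqP.
rewrite -[(clamp p.1, p.2)]/(clampY p) gc.
have -> : tr (ax j (- s)) (slab_ext g) (clampY p) = tr (ax j (- s)) (slab_ext g) p.
  by rewrite /tr -(gc (p.1, _)).
have -> : avg (ax j (- s)) u (clampY p) = avg (ax j (- s)) u p.
  by apply: eq_itvint => r _; rewrite [RHS]uc.
by [].
Unshelve. all: end_near. Qed.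

End SlabExtension.

(** * The norms and the time integral in terms of the extensions *)

Section SlabNorms.
Context {R : realType}.
Local Notation leb := (@lebesgue_measure R).
Local Notation leb2 := (@plane_measure R).
Local Notation X := (R * R)%type.
Local Notation Y := (R * (R * R))%type.
Implicit Types (f w : Y -> R) (v : bool -> Y -> R) (t : R) (x : X).

Lemma smooth_on_slab_data (g : spacetime R -> R^o) : smooth_on slab g ->
  exists u v, sobolev_data (slab_ext g) u v /\
    forall p : Y, 0 < p.1 < 1 ->
      'D_e_t g p = u p /\ forall j, 'D_(dir j) g p = v j p.
Proof.
move=> sg; have [u cu [_ Hu]] := slab_derivative sg e_t.
have /choice[v Hv] : forall j, exists v : Y -> R, continuous v /\
    ((forall p, v p = v (clampY p)) /\
     forall p : Y, 0 < p.1 < 1 -> derivable g p (dir j) /\ 'D_(dir j) g p = v p).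
  by move=> j; have [v cv Hv] := slab_derivative sg (dir j); exists v.
exists u, v; split.
  split.
  - by have [cg _ _] := sg; exact: continuous_slab_ext.
  - exact: cu.
  - by move=> j; have [] := Hv j.
  - exact: slab_ext_time.
  - by move=> j; have [cv [vc Dv]] := Hv j; exact: slab_ext_slope.
move=> p p01; split; first by have [] := Hu p p01.
by move=> j; have [_ [_ /(_ p p01)[]]] := Hv j.
Qed.

Definition density f w v (p : Y) : R :=
  f p ^+ 2 + w p ^+ 2 + (v false p ^+ 2 + v true p ^+ 2).

Lemma continuous_density f w v : continuous f -> continuous w ->
  (forall j, continuous (v j)) -> continuous (density f w v).
Proof.
by move=> cf cw cv; have c0 := cv false; have c1 := cv true; rewrite /density; cont.
Qed.

Lemma sobolev2E f w v : continuous f -> continuous w -> (forall j, continuous (v j)) ->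
  (sobolev2 f w v =
   \int[leb]_(t in `[0%R, 1%R]) \int[leb2]_x (density f w v (t, x))%:E)%E.
Proof.
move=> cf cw cv; have c0 := cv false; have c1 := cv true.
have mt (q : Y -> R) : continuous q -> measurable_fun setT (tint q) by exact: measurable_tint.
have cd := continuous_density cf cw cv.
have md : measurable_fun setT (EFin \o density f w v).
  by apply/measurable_EFinP; exact: measurable_continuous3.
have d0 p : 0 <= density f w v p by rewrite /density !addr_ge0// sqr_ge0.
have d0' p : (0 <= (EFin \o density f w v) p)%E by rewrite lee_fin d0.
rewrite (tonelli_itv leb2 0 1 md d0').
have E x : (\int[leb]_(t in `[0%R, 1%R]) (EFin \o density f w v) (t, x) =
    (tint f x + tint w x + (tint (v false) x + tint (v true) x))%:E)%E.
  have cx (q : Y -> R) : continuous q -> continuous (fun t : R => q (t, x) ^+ 2) by move=> cq; cont.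
  rewrite -(itvint_EFin _ _ (@continuous_time _ _ x cd)) /density.
  have c2 := continuous_funD (cx _ cf) (cx _ cw); have c3 := continuous_funD (cx _ c0) (cx _ c1).
  by rewrite (itvintD _ _ c2 c3) (itvintD _ _ (cx _ cf) (cx _ cw)) (itvintD _ _ (cx _ c0) (cx _ c1)).
under [RHS]eq_integral do rewrite E.
have t0 q x := tint_ge0 q x.
rewrite (@integral_EFinD _ _ R leb2 (fun x => tint f x + tint w x) (fun x => tint (v false) x + tint (v true) x)); last 4 first.
- exact: (measurable_funD (mt _ cf) (mt _ cw)).
- exact: (measurable_funD (mt _ c0) (mt _ c1)).
- by move=> x; apply: addr_ge0; exact: t0.
- by move=> x; apply: addr_ge0; exact: t0.
rewrite (@integral_EFinD _ _ R leb2 (tint f) (tint w) (mt _ cf) (mt _ cw) (t0 f) (t0 w)).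
by rewrite (@integral_EFinD _ _ R leb2 _ _ (mt _ c0) (mt _ c1) (t0 _) (t0 _)).
Qed.

(** The end points are null sets, so the values that the two-sided derivatives take on the faces are
    harmless. Measurability of [f] on the open interval is inherited from [g]. *)
Lemma integral_itv_eq_interior (f g : R -> \bar R) : measurable_fun setT g ->
  (forall t, 0 < t < 1 -> f t = g t) ->
  (\int[leb]_(t in `[0%R, 1%R]) f t = \int[leb]_(t in `[0%R, 1%R]) g t)%E.
Proof.
move=> mg fg.
have mgo : measurable_fun (`]0%R, 1%R[%classic : set R) g by exact: measurable_funTS.
have E : {in (`]0%R, 1%R[%classic : set R), g =1 f}.
  by move=> t; rewrite inE /= in_itv /= => t01; rewrite fg.
have mfo : measurable_fun (`]0%R, 1%R[%classic : set R) f by exact: eq_measurable_fun E mgo.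
rewrite (@integral_itv_bndoo R 0 1 f true false mfo) (@integral_itv_bndoo R 0 1 g true false mgo).
by apply: eq_integral => t /E ->.
Qed.

Lemma H1norm_data (g : spacetime R -> R^o) (u : Y -> R) (v : bool -> Y -> R) :
  sobolev_data (slab_ext g) u v ->
  (forall p : Y, 0 < p.1 < 1 -> 'D_e_t g p = u p /\ forall j, 'D_(dir j) g p = v j p) ->
  H1norm g = sqrte (sobolev2 (slab_ext g) u v).
Proof.
move=> [cg cu cv _ _] Hg.
have -> := sobolev2E cg cu cv; apply: (congr1 (@sqrte R)).
have cd := continuous_density cg cu cv.
have md : measurable_fun setT (EFin \o density (slab_ext g) u v).
  by apply/measurable_EFinP; exact: measurable_continuous3.
have d0' p : (0 <= (EFin \o density (slab_ext g) u v) p)%E.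
  by rewrite lee_fin /density !addr_ge0// sqr_ge0.
apply: integral_itv_eq_interior.
  exact: (measurable_fun_fubini_tonelli_F (m2 := leb2) _ md d0').
move=> t t01; apply: eq_integral => x _.
have t01' : 0 <= (t, x).1 <= 1 by move/andP: t01 => [? ?]; rewrite /= !ltW.
have [-> Hv] := Hg (t, x) t01.
by rewrite (Hv false : 'D_e_1 g (t, x) = _) (Hv true : 'D_e_2 g (t, x) = _) /density /slab_ext clampY_id.
Qed.

Lemma time_integral_data (g h : spacetime R -> R^o) (u : Y -> R) x :
  smooth_on slab h -> continuous u ->
  (forall p : Y, 0 < p.1 < 1 -> 'D_e_t g p = u p) ->
  time_integral g h x = pairing u (slab_ext h) x.
Proof.
move=> [ch _ _] cu Hg; have ce := continuous_slab_ext ch.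
rewrite /time_integral /pairing /itvint /Rintegral; congr fine.
apply: integral_itv_eq_interior.
  have cx := @continuous_time _ _ x cu; have ex := @continuous_time _ _ x ce.
  apply/measurable_EFinP; apply: measurable_continuous.
  exact: continuous_funM cx ex.
move=> t t01; have t01' : 0 <= (t, x).1 <= 1 by move/andP: t01 => [? ?]; rewrite /= !ltW.
by rewrite (Hg (t, x) t01) /slab_ext clampY_id.
Qed.

End SlabNorms.
Theorem proposition1p2 (R : realType) (chi : plane R -> R)
    (hchi : LP_cutoff chi) :
  exists C : R, forall g h : spacetime R -> R^o,
    smooth_on slab g -> smooth_on slab h ->
    (H1norm g < +oo)%E -> (H1norm h < +oo)%E ->
    (besov chi (fun x => (time_integral g h x)%:C)
       <= C%:E * H1norm g * H1norm h)%E.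
Proof.
have [C C0 HC] := besov_pairing hchi; exists C => g h sg sh Hg Hh.
have [u [v [Dg Eg]]] := smooth_on_slab_data sg.
have [z [v' [Dh Eh]]] := smooth_on_slab_data sh.
rewrite (H1norm_data Dg Eg) in Hg *; rewrite (H1norm_data Dh Eh) in Hh *.
have -> : (fun x => (time_integral g h x)%:C) = (fun x => (pairing u (slab_ext h) x)%:C).
  apply/funext => x; congr (_%:C); apply: time_integral_data => //.
    exact: data_cw Dg.
  by move=> p p01; have [] := Eg p p01.
(* Finiteness of the norms enters here: [HC] takes real bounds for the squared norms. *)
have real (q : \bar R) : (0 <= q -> sqrte q < +oo -> exists2 r : R, (0 <= r)%R & q = r%:E)%E.
  by case: q => [r|//|//]; rewrite lee_fin => r0 _; exists r.
have [A A0 EA] := real _ (sobolev2_ge0 _ _ _) Hg.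
have [B B0 EB] := real _ (sobolev2_ge0 _ _ _) Hh.
rewrite EA EB /= -muleA -!EFinM -sqrtrM//.
by apply: (HC _ _ _ _ _ _ A B Dg Dh); rewrite ?EA ?EB.
Qed.
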